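(* The following problem can be decided in $\mathsf{DEXPTIME}$. Input: a finite alphabet $A$ with involution and a finite system $\mathcal S$ of equations in idempotent variables over $\mathrm{FIM}(A)$ (i.e. each equation is a pair $(U,V)$ of words over $A\cup\Omega$ with $\Omega$ a set of idempotent variables, and no other variables). Question: does $\mathcal S$ have a solution in $\mathrm{FIM}(A)$? Moreover, if $A$ contains four pairwise different letters $\alpha,\overline\alpha,\beta,\overline\beta$, then this problem is $\mathsf{DEXPTIME}$-hard already for systems consisting of two equations.
   Context: An involution is a map $y\mapsto\overline y$ with $\overline{\overline y}=y$, extended to words by reversal. $\mathrm{FG}(A)=A^*/\{a\overline a=1\}$, identified with reduced words. $\mathrm{FIM}(A)$ is the free inverse monoid: pairs $(P,g)$ with $P$ a finite prefix-closed set of reduced words and $g\in P$, multiplication $(P,g)(Q,h)=(P\cup gQ,gh)$; $\psi:A^*\to\mathrm{FIM}(A)$, $\psi(a)=(\{1,a\},a)$. Idempotent variables $Z\in\Omega$ satisfy $\overline Z=Z$. A solution of $\mathcal S$ assigns to each $Z\in\Omega$ a word $\sigma(Z)\in A^*$ such that $\psi(\sigma(Z))$ is idempotent in $\mathrm{FIM}(A)$ (equivalently, assigns an element of the form $(P,1)$), and such that $\psi(\sigma(U))=\psi(\sigma(V))$ for all $(U,V)\in\mathcal S$, where $\sigma$ is extended to a morphism fixing letters of $A$. Hardness is with respect to polynomial-time many-one reductions. *)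

(* Defs.v *)
From HB Require Import structures.
From mathcomp Require Import all_boot finmap.

Set Implicit Arguments.
Unset Strict Implicit.
Unset Printing Implicit Defensive.

Local Open Scope fset_scope.
Local Open Scope group_scope.

(* The involution may have fixed points. *)
Record invAlphabet := InvAlphabet {
  letter :> finType;
  bar : letter -> letter;
  barK : involutive bar
}.

Definition bar_word (A : invAlphabet) (w : seq A) : seq A := rev (map (@bar A) w).

Definition reduced (A : invAlphabet) (w : seq A) : bool :=
  sorted (fun a b => b != bar a) w.

Definition cons_red (A : invAlphabet) (a : A) (w : seq A) : seq A :=
  if w is b :: w' then if b == bar a then w' else a :: w else [:: a].

(* On reduced u and v this is the reduced form of the concatenation uv. *)
Definition cat_red (A : invAlphabet) (u v : seq A) : seq A :=
  foldr (@cons_red A) v u.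

Lemma cons_red_reduced (A : invAlphabet) (a : A) w :
  reduced w -> reduced (cons_red a w).
Proof.
case: w => [//|b w] /= rw; case: ifPn => [_|nab]; last by rewrite /= nab.
exact: path_sorted rw.
Qed.

Lemma cat_red_reduced (A : invAlphabet) (u v : seq A) :
  reduced v -> reduced (cat_red u v).
Proof. by move=> rv; elim: u => //= a u; apply: cons_red_reduced. Qed.

Lemma cons_red_id (A : invAlphabet) (a : A) w :
  reduced (a :: w) -> cons_red a w = a :: w.
Proof. by case: w => //= b w /andP[/negPf-> _]. Qed.

Lemma reduced_behead (A : invAlphabet) (a : A) w : reduced (a :: w) -> reduced w.
Proof. exact: path_sorted. Qed.

Lemma cons_redK (A : invAlphabet) (a : A) w :
  reduced w -> cons_red a (cons_red (bar a) w) = w.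
Proof.
case: w => [|b w] rw /=; first by rewrite eqxx.
rewrite barK; case: eqP => [eba|_] /=; last by rewrite eqxx.
by subst b; apply: cons_red_id.
Qed.

Lemma cat_red_cons (A : invAlphabet) (a : A) u v :
  reduced v -> cat_red (cons_red a u) v = cons_red a (cat_red u v).
Proof.
move=> rv; case: u => [//|b u] /=; case: eqP => [->|//].
by rewrite cons_redK ?cat_red_reduced.
Qed.

Lemma cat_redA (A : invAlphabet) (u v w : seq A) :
  reduced w -> cat_red u (cat_red v w) = cat_red (cat_red u v) w.
Proof. by move=> rw; elim: u => //= a u ->; rewrite cat_red_cons. Qed.

Lemma cat_red0 (A : invAlphabet) (u : seq A) : reduced u -> cat_red u [::] = u.
Proof.
elim: u => //= a u IHu rau.
by rewrite IHu ?cons_red_id //; apply: path_sorted rau.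
Qed.

Lemma bar_word_reduced (A : invAlphabet) (w : seq A) :
  reduced w -> reduced (bar_word w).
Proof.
rewrite /reduced /bar_word rev_sorted sorted_map.
apply: sub_sorted => a b /=.
by apply: contraNneq; rewrite barK => ->.
Qed.

Lemma cat_redV (A : invAlphabet) (w : seq A) : cat_red (bar_word w) w = [::].
Proof.
elim: w => //= a w IHw.
by rewrite /bar_word /= rev_cons /cat_red foldr_rcons /= barK eqxx.
Qed.

Record FG (A : invAlphabet) := MkFG {
  FG_word :> seq A;
  FG_wordP : reduced FG_word
}.

HB.instance Definition _ A := [isSub for @FG_word A].
HB.instance Definition _ A := [Choice of FG A by <:].

Definition FG_one A : FG A := MkFG (isT : @reduced A [::]).
Definition FG_mul A (g h : FG A) : FG A := MkFG (cat_red_reduced g (FG_wordP h)).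
Definition FG_inv A (g : FG A) : FG A := MkFG (bar_word_reduced (FG_wordP g)).
Definition FG_letter (A : invAlphabet) (a : A) : FG A :=
  MkFG (isT : @reduced A [:: a]).

Lemma FG_mulA A : associative (@FG_mul A).
Proof. by move=> g h k; apply: val_inj; rewrite /= cat_redA ?FG_wordP. Qed.
Lemma FG_mul1 A : left_id (@FG_one A) (@FG_mul A).
Proof. by move=> g; apply: val_inj. Qed.
Lemma FG_mulr1 A : right_id (@FG_one A) (@FG_mul A).
Proof. by move=> g; apply: val_inj; rewrite /= cat_red0 ?FG_wordP. Qed.
Lemma FG_mulV A : left_inverse (@FG_one A) (@FG_inv A) (@FG_mul A).
Proof. by move=> g; apply: val_inj; rewrite /= cat_redV. Qed.
Lemma FG_mulrV A : right_inverse (@FG_one A) (@FG_inv A) (@FG_mul A).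
Proof.
move=> g; rewrite -[RHS](FG_mulV (FG_inv g)); congr FG_mul; apply: val_inj => /=.
by rewrite /bar_word map_rev revK mapK //; apply: barK.
Qed.

HB.instance Definition _ A := isGroup.Build (FG A)
  (@FG_mulA A) (@FG_mul1 A) (@FG_mulr1 A) (@FG_mulV A) (@FG_mulrV A).

Lemma take_reduced (A : invAlphabet) i (w : seq A) : reduced w -> reduced (take i w).
Proof. exact: take_sorted. Qed.

Definition FG_take A i (g : FG A) : FG A := MkFG (take_reduced i (FG_wordP g)).

Definition prefix_closed A (P : {fset FG A}) : bool :=
  all (fun u => all (fun i => FG_take i u \in P) (iota 0 (size u))) P.

Lemma prefix_closedP A (P : {fset FG A}) :
  reflect (forall u v : FG A, u \in P -> prefix v u -> v \in P) (prefix_closed P).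
Proof.
apply: (iffP allP) => [clP u v Pu | clP u Pu].
  rewrite prefixE => /eqP tvu.
  have Dv: v = FG_take (size v) u by apply: val_inj; rewrite /= tvu.
  have [lt_vu|le_uv] := ltnP (size v) (size u).
    by rewrite Dv; apply: (allP (clP u Pu)); rewrite mem_iota.
  by suff ->: v = u by []; rewrite Dv; apply: val_inj; rewrite /= take_oversize.
by apply/allP=> i _; apply: clP Pu _; apply: prefix_take.
Qed.

Record FIM (A : invAlphabet) := MkFIM {
  FIM_pair :> {fset FG A} * FG A;
  FIM_pairP : prefix_closed FIM_pair.1 && (FIM_pair.2 \in FIM_pair.1)
}.

HB.instance Definition _ A := [isSub for @FIM_pair A].
HB.instance Definition _ A := [Choice of FIM A by <:].

Lemma FIM_one_subproof A :
  prefix_closed [fset (1 : FG A)] && ((1 : FG A) \in [fset (1 : FG A)]).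
Proof.
rewrite in_fset1 eqxx andbT; apply/prefix_closedP=> u v.
rewrite !in_fset1 => /eqP-> pv; apply/eqP/val_inj/eqP.
by rewrite /= -prefixs0.
Qed.
Definition FIM_one A : FIM A := @MkFIM A ([fset 1], 1) (FIM_one_subproof A).

Lemma FIM_letter_subproof (A : invAlphabet) (a : A) :
  prefix_closed [fset 1; FG_letter a] && (FG_letter a \in [fset 1; FG_letter a]).
Proof.
rewrite in_fset2 eqxx orbT andbT; apply/prefix_closedP=> u v.
rewrite !in_fset2 => /orP[]/eqP-> pv.
  by apply/orP; left; apply/eqP/val_inj/eqP; rewrite /= -prefixs0.
move: pv.
rewrite -!val_eqE /=; case: (v : seq A) => [//|b [|c w]] /=; last by rewrite andbF.
by rewrite andbT => /eqP->.
Qed.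
Definition FIM_letter (A : invAlphabet) (a : A) : FIM A :=
  @MkFIM A ([fset 1; FG_letter a], FG_letter a) (FIM_letter_subproof a).

Lemma prefix_cat_red (A : invAlphabet) (u v w : seq A) :
  reduced u -> reduced v -> prefix w (cat_red u v) ->
  prefix w u \/ exists2 v', prefix v' v & w = cat_red u v'.
Proof.
move=> + rv; elim: u w => [|a u IHu] w rau; first by right; exists w.
have ru := reduced_behead rau.
rewrite [cat_red _ _]/(cons_red a (cat_red u v)).
case: w => [|c w]; first by left; apply: prefix0s.
case Dt: (cat_red u v) (IHu^~ ru) => [|b t] IH.
  rewrite prefix_cons prefixs0 => /andP[/eqP<- /eqP->].
  by left; rewrite prefix_cons eqxx prefix0s.
case: eqP => [Db | /eqP nb] pw.
  have [|pu|[v' pv' Dw]] := IH (b :: c :: w); first by rewrite prefix_cons eqxx.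
    move: pu rau; case: (u) => // d u'; rewrite prefix_cons => /andP[/eqP<- _].
    by rewrite /reduced /= Db eqxx.
  by right; exists v'; rewrite //= -Dw /= Db eqxx.
move: pw; rewrite !prefix_cons => /andP[/eqP-> pw].
have [pu|[v' pv' Dw]] := IH w pw; first by left; rewrite eqxx.
right; exists v' => //=; rewrite -Dw.
case: (w) pw => // d w'; rewrite prefix_cons => /andP[/eqP-> _].
by rewrite /= (negPf nb).
Qed.

Lemma FIM_mul_subproof A (x y : FIM A) :
  let P := x.1 `|` [fset x.2 * h | h in y.1] in
  prefix_closed P && (x.2 * y.2 \in P).
Proof.
case: x y => [[P g] /= /andP[/prefix_closedP clP Pg]].
case=> [[Q h] /= /andP[/prefix_closedP clQ Qh]].
apply/andP; split; last by rewrite in_fsetU in_imfset ?orbT.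
apply/prefix_closedP=> u v /=; rewrite !in_fsetU => /orP[Pu pv|].
  by rewrite (clP _ _ Pu pv).
case/imfsetP=> /= k Qk -> pv.
have [pg|[w pw Dv]] := prefix_cat_red (FG_wordP g) (FG_wordP k) pv.
  by rewrite (clP _ _ Pg pg).
have rw: reduced w by move: pw; rewrite prefixE => /eqP<-; apply/take_reduced/FG_wordP.
have Qw: MkFG rw \in Q by apply: (clQ k).
apply/orP; right; apply/imfsetP; exists (MkFG rw) => //.
exact: val_inj.
Qed.

Definition FIM_mul A (x y : FIM A) : FIM A :=
  @MkFIM A (x.1 `|` [fset x.2 * h | h in y.1], x.2 * y.2) (FIM_mul_subproof x y).

Lemma FIM_mulA A : associative (@FIM_mul A).
Proof.
move=> x y z; apply: val_inj => /=; rewrite mulgA; congr pair.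
rewrite -fsetUA; congr (_ `|` _); apply/fsetP=> u; rewrite in_fsetU.
apply/imfsetP/orP => [[/= k + ->]|].
  rewrite in_fsetU => /orP[yk|/imfsetP[/= l zl ->]].
    by left; apply/imfsetP; exists k.
  by right; apply/imfsetP; exists l; rewrite ?mulgA.
case=> /imfsetP[/= k yk ->]; first by exists k; rewrite //= in_fsetU yk.
exists (y.2 * k); rewrite ?mulgA //= in_fsetU; apply/orP; right.
by apply/imfsetP; exists k.
Qed.

Lemma FIM_mul1 A : left_id (@FIM_one A) (@FIM_mul A).
Proof.
move=> [[P g] /= xP]; apply: val_inj => /=; rewrite mul1g; congr pair.
apply/fsetP=> u; have /andP[/prefix_closedP clP Pg] := xP.
rewrite in_fsetU in_fset1; apply/orP/idP=> [[/eqP->|/imfsetP[/= k Pk ->]]|Pu].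
- by apply: clP Pg _; apply: prefix0s.
- by rewrite mul1g.
by right; apply/imfsetP; exists u; rewrite ?mul1g.
Qed.

Lemma FIM_mulr1 A : right_id (@FIM_one A) (@FIM_mul A).
Proof.
move=> [[P g] /= xP]; apply: val_inj => /=; rewrite mulg1; congr pair.
apply/fsetP=> u; have /andP[_ Pg] := xP; rewrite in_fsetU.
apply/orP/idP=> [[//|/imfsetP[/= k]]|]; last by left.
by rewrite in_fset1 => /eqP-> ->; rewrite mulg1.
Qed.

HB.instance Definition _ A := isMonoid.Build (FIM A)
  (@FIM_mulA A) (@FIM_mul1 A) (@FIM_mulr1 A).

Definition psi (A : invAlphabet) (w : seq A) : FIM A :=
  \prod_(a <- w) FIM_letter a.

(* Variables are self-involutive, so a word over A and Omega is a plain sequence. *)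
Definition eqn_word (A : invAlphabet) (Omega : Type) := seq (A + Omega).
Definition equation (A : invAlphabet) (Omega : Type) :=
  (eqn_word A Omega * eqn_word A Omega)%type.

Definition extend (A : invAlphabet) (Omega : Type) (sigma : Omega -> seq A)
    (W : eqn_word A Omega) : seq A :=
  flatten [seq match x with inl a => [:: a] | inr Z => sigma Z end | x <- W].

Definition is_solution (A : invAlphabet) (Omega : eqType)
    (S : seq (equation A Omega)) (sigma : Omega -> seq A) : Prop :=
  (forall Z, psi (sigma Z) * psi (sigma Z) = psi (sigma Z)) /\
  (forall U V, (U, V) \in S -> psi (extend sigma U) = psi (extend sigma V)).

Definition solvable (A : invAlphabet) (Omega : eqType)
    (S : seq (equation A Omega)) : Prop :=
  exists sigma, is_solution S sigma.

Inductive move := MoveL | MoveN | MoveR.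

(* Two-way infinite tape: [tleft] is read from the head outwards, and [None] is
   the blank symbol, which also fills everything beyond the two lists. *)
Record tape (G : Type) := Tape {
  tleft : seq (option G);
  tcur : option G;
  tright : seq (option G)
}.

Definition write_move (G : Type) (sm : option G * move) (t : tape G) : tape G :=
  let: (s, m) := sm in
  let: Tape l _ r := t in
  match m with
  | MoveL => Tape (behead l) (head None l) (s :: r)
  | MoveN => Tape l s r
  | MoveR => Tape (s :: l) (head None r) (behead r)
  end.

Record TM := MkTM {
  tape_sym : finType;
  state : finType;
  extra_tapes : nat;
  start : state;
  halting : pred state;
  accepting : pred state;
  delta : state -> {ffun 'I_extra_tapes.+1 -> option tape_sym} ->
          state * ('I_extra_tapes.+1 -> option tape_sym * move)
}.

Record config (M : TM) := Config {
  cstate : state M;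
  ctape : 'I_(extra_tapes M).+1 -> tape (tape_sym M)
}.

Definition step (M : TM) (c : config M) : config M :=
  if halting (cstate c) then c else
  let: (q, act) := delta (cstate c) [ffun i => tcur (ctape c i)] in
  Config q (fun i => write_move (act i) (ctape c i)).

(* The input is on tape 0, with the head on its first symbol. *)
Definition init (M : TM) (w : seq (tape_sym M)) : config M :=
  let s := map Some w in
  Config (start M)
    (fun i => if i == ord0 then Tape [::] (head None s) (behead s)
              else Tape [::] None [::]).

Fixpoint upto_blank (G : Type) (s : seq (option G)) : seq G :=
  if s is Some a :: s' then a :: upto_blank s' else [::].

(* The output is the maximal blank-free word starting at the head of tape 0. *)
Definition output (M : TM) (c : config M) : seq (tape_sym M) :=
  let t := ctape c ord0 in upto_blank (tcur t :: tright t).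

Definition language (Sigma : finType) := seq Sigma -> Prop.

Definition decides_in_time (Sigma : finType) (L : language Sigma)
    (T : nat -> nat) : Prop :=
  exists (M : TM) (i : Sigma -> tape_sym M), injective i /\
    forall w : seq Sigma, exists2 t, (t <= T (size w))%N &
      let c := iter t (@step M) (init (map i w)) in
      halting (cstate c) /\ (accepting (cstate c) <-> L w).

Definition computes_in_time (Sigma Delta : finType) (f : seq Sigma -> seq Delta)
    (T : nat -> nat) : Prop :=
  exists (M : TM) (i : Sigma -> tape_sym M) (o : Delta -> tape_sym M),
    [/\ injective i, injective o &
    forall w : seq Sigma, exists2 t, (t <= T (size w))%N &
      let c := iter t (@step M) (init (map i w)) in
      halting (cstate c) /\ output c = map o (f w)].

Definition poly_bounded (T : nat -> nat) : Prop :=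
  exists c d, forall n, (T n <= c * n ^ d + c)%N.

Definition DEXPTIME (Sigma : finType) (L : language Sigma) : Prop :=
  exists2 p, poly_bounded p & decides_in_time L (fun n => 2 ^ p n)%N.

Definition poly_time (Sigma Delta : finType) (f : seq Sigma -> seq Delta) : Prop :=
  exists2 p, poly_bounded p & computes_in_time f p.

Definition poly_many_one (Sigma Delta : finType) (L : language Sigma)
    (K : language Delta) : Prop :=
  exists2 f, poly_time f & forall w, L w <-> K (f w).

Definition DEXPTIME_hard (Delta : finType) (K : language Delta) : Prop :=
  forall (Sigma : finType) (L : language Sigma), DEXPTIME L -> poly_many_one L K.

Inductive symbol := Bit of bool | LetterMark | VarMark | EqnMark | EqualMark.

Definition symbol_code (s : symbol) : bool + 'I_4 :=
  match s with
  | Bit b => inl b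
  | LetterMark => inr (inord 0)
  | VarMark => inr (inord 1)
  | EqnMark => inr (inord 2)
  | EqualMark => inr (inord 3)
  end.
Definition symbol_decode (c : bool + 'I_4) : symbol :=
  match c with
  | inl b => Bit b
  | inr i => nth EqualMark [:: LetterMark; VarMark; EqnMark] i
  end.
Lemma symbol_codeK : cancel symbol_code symbol_decode.
Proof. by case=> [b| | | |] //=; rewrite inordK. Qed.

HB.instance Definition _ := Countable.copy symbol (can_type symbol_codeK).
HB.instance Definition _ : isFinite symbol := CanIsFinite symbol_codeK.

(* Variables are named by bit strings, so that the supply is unbounded and the
   length of a name counts in the size of an instance. *)
Definition var := seq bool.
Definition system (A : invAlphabet) := seq (equation A var).

(* Letters are numbered along [enum A] and written in unary; this is harmless for
   complexity because an instance lists all letters of A anyway. *)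
Definition enc_letter (A : invAlphabet) (a : A) : seq symbol :=
  LetterMark :: nseq (enum_rank a) (Bit true).

Definition enc_var (Z : var) : seq symbol := VarMark :: map Bit Z.

Definition enc_word (A : invAlphabet) (W : eqn_word A var) : seq symbol :=
  flatten [seq match x with inl a => enc_letter a | inr Z => enc_var Z end | x <- W].

(* The table of the involution along [enum A]. *)
Definition enc_alphabet (A : invAlphabet) : seq symbol :=
  flatten [seq enc_letter (bar a) | a <- enum A].

Definition enc_instance (A : invAlphabet) (S : system A) : seq symbol :=
  enc_alphabet A ++
  flatten [seq EqnMark :: enc_word e.1 ++ EqualMark :: enc_word e.2 | e <- S].

Definition idempotent_systems : language symbol := fun w =>
  exists (A : invAlphabet) (S : system A), w = enc_instance S /\ solvable S.

Definition idempotent_systems_two (A : invAlphabet) : language symbol := fun w =>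
  exists S : system A, [/\ w = enc_instance S, size S = 2 & solvable S].

(* Main.v *)
From HB Require Import structures.
From mathcomp Require Import all_boot finmap zify.
From mathcomp Require ssralg ssrnum ssrint.
From Stdlib Require Import FunctionalExtensionality.
From Stdlib Require ClassicalDescription.
Require Import Defs.

(* With idempotent variables only, an equation over FIM(A) says that two finite sets of
   elements of FG(A), unions of translates of prefixes and of the sets of the variables,
   are equal, and that two group elements coincide.

   Membership. Let every node s of the Cayley tree carry, for each position i of the
   text of the system, the bit telling whether s lies in the set of the word starting
   at i. These bits are related locally, by comparing a node with its neighbours, so a
   solution is a finite tree of labels of linear size. An alternating linear space
   machine guesses such a tree branch by branch, and alternating linear space is
   contained in DEXPTIME by iterating over the table of all configurations.

   Hardness. An exponential time machine is simulated by an alternating linear space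
   machine whose configurations are claims about a tape cell at a time written in
   binary. This one is made to work on a queue; as a queue is a window of its history,
   which only grows, a configuration becomes a stack and hence a word. For each state
   take a variable for the set of accepted stacks that are used: the transition rules
   are inclusions between unions of left translates of these sets. All of them are
   merged into one equation by a prefix code, and a further equation forces the sets
   to consist of positive words. Since the sets are finite, every chain of rules ends,
   so the system is solvable if and only if the machine accepts. *)

Set Implicit Arguments.
Unset Strict Implicit.
Unset Printing Implicit Defensive.

(** Both halves share one machine model. Automata with finitely many heads on a word of fixed length
    are convenient to program, but an equation only compares left translates of finite sets: it can
    prepend constant letters, while rewriting in place is out of reach. On a queue, each step of
    such an automaton reads a letter and appends another, so the history only gains a letter. Queues
    of fixed length also index a table of exponential size, which serves the upper bound. Three
    obstacles shape the rest. Values in FIM(A) are prefix closed, so a stack must be told apart from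
    prefixes of longer stacks: stacks carry an end marker, and an extra variable absorbs the
    unfinished prefixes. The letter at the front of the queue lies deep in the history; variables
    indexed by depth reach it. Complexity is defined by concrete multitape machines, so all
    algorithms are written as programs on stacks whose compiled running time is known. *)

Module StackPrograms.

(** * Programs on eight stacks and their compilation to Turing machines *)

Inductive reg := R0 | R1 | R2 | R3 | R4 | R5 | R6 | R7.

Definition reg_of (n : nat) : reg :=
  match n with 0 => R0 | 1 => R1 | 2 => R2 | 3 => R3 | 4 => R4 | 5 => R5
  | 6 => R6 | _ => R7 end.

Definition ord_of (r : reg) : 'I_8 :=
  match r with
  | R0 => @Ordinal 8 0 isT | R1 => @Ordinal 8 1 isT | R2 => @Ordinal 8 2 isT
  | R3 => @Ordinal 8 3 isT | R4 => @Ordinal 8 4 isT | R5 => @Ordinal 8 5 isT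
  | R6 => @Ordinal 8 6 isT | R7 => @Ordinal 8 7 isT
  end.

Lemma ord_ofK r : reg_of (ord_of r) = r.
Proof. by case: r. Qed.

Section StackPrograms.
Variable G : finType.

Record store := St {
  s0 : seq G; s1 : seq G; s2 : seq G; s3 : seq G;
  s4 : seq G; s5 : seq G; s6 : seq G; s7 : seq G }.

Definition get (s : store) (r : reg) : seq G :=
  match r with R0 => s0 s | R1 => s1 s | R2 => s2 s | R3 => s3 s
  | R4 => s4 s | R5 => s5 s | R6 => s6 s | R7 => s7 s end.

Definition put (s : store) (r : reg) (x : seq G) : store :=
  let: St a b c d e f g h := s in
  match r with
  | R0 => St x b c d e f g h | R1 => St a x c d e f g h
  | R2 => St a b x d e f g h | R3 => St a b c x e f g h
  | R4 => St a b c d x f g h | R5 => St a b c d e x g h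
  | R6 => St a b c d e f x h | R7 => St a b c d e f g x end.

Definition reg_eq (r r' : reg) : bool := ord_of r == ord_of r'.

Lemma get_put s r x r' : get (put s r x) r' = if reg_eq r' r then x else get s r'.
Proof. by case: s => *; case: r; case: r'. Qed.

(** [Case] has one continuation for each possible top of the stack; as [G] is finite, a compiled
    program still has finitely many states. *)
Inductive cmd :=
| Skip
| Push of reg & G
| Pop of reg
| Seq of cmd & cmd
| Case of reg & (option G -> cmd)
| While of reg & cmd.

(* The last argument counts the steps of the compiled machine. *)
Inductive exec : cmd -> store -> store -> nat -> Prop :=
| x_skip s : exec Skip s s 1
| x_push s r a : exec (Push r a) s (put s r (a :: get s r)) 2
| x_pop s r : exec (Pop r) s (put s r (behead (get s r))) 1
| x_seq c d s s' s'' t t' :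
    exec c s s' t -> exec d s' s'' t' -> exec (Seq c d) s s'' (t + t')
| x_case r f s s' t :
    exec (f (ohead (get s r))) s s' t -> exec (Case r f) s s' t.+1
| x_while0 r c s : get s r = [::] -> exec (While r c) s s 1
| x_while r c s s' s'' t t' :
    get s r != [::] -> exec c s s' t -> exec (While r c) s' s'' t' ->
    exec (While r c) s s'' (t + t').+1.

Definition scan (T : reg -> tape G) (r : reg) : option G := tcur (T r).
Definition acts := reg -> option G * move.
Definition keep (v : reg -> option G) : acts := fun r => (v r, MoveN).
Definition act1 (v : reg -> option G) (r : reg) (am : option G * move) : acts :=
  fun r' => if reg_eq r' r then am else (v r', MoveN).
Definition app_acts (a : acts) (T : reg -> tape G) : reg -> tape G :=
  fun r => write_move (a r) (T r).

(** A machine with one entry; the successor [None] is its exit, which is redirected when fragments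
    are composed. *)
Record frag := Frag {
  fstate :> finType;
  fstart : fstate;
  fdelta : fstate -> (reg -> option G) -> option fstate * acts
}.

Inductive frun (F : frag) : F -> (reg -> tape G) -> nat -> (reg -> tape G) -> Prop :=
| fr_exit q T a : fdelta q (scan T) = (None, a) -> frun q T 1 (app_acts a T)
| fr_step q q' T a n T' : fdelta q (scan T) = (Some q', a) ->
    frun q' (app_acts a T) n T' -> frun q T n.+1 T'.

Definition frag_skip : frag := @Frag unit tt (fun _ v => (None, keep v)).
Definition frag_push r x : frag := @Frag bool false (fun b v =>
  if b then (None, act1 v r (Some x, MoveN))
  else (Some true, act1 v r (v r, MoveL))).
Definition frag_pop r : frag :=
  @Frag unit tt (fun _ v => (None, act1 v r (v r, MoveR))).
Definition frag_seq (F1 F2 : frag) : frag :=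
  @Frag (F1 + F2)%type (inl (fstart F1)) (fun q v =>
    match q with
    | inl q1 => let: (q', a) := fdelta q1 v in
                (Some (if q' is Some q'' then inl q'' else inr (fstart F2)), a)
    | inr q2 => let: (q', a) := fdelta q2 v in (omap inr q', a)
    end).
(** The state remembers which branch was entered, as an element of the dependent sum over the letter
    read; in state [None] that letter is still to be read. *)
Definition frag_case r (F : option G -> frag) : frag :=
  @Frag (option {o : option G & fstate (F o)}) None (fun q v =>
    match q with
    | None => (Some (Some (existT (fun o => fstate (F o)) (v r) (fstart (F (v r))))),
               keep v)
    | Some p => let: (q', a) := fdelta (projT2 p) v in
      (omap (fun x => Some (existT (fun o => fstate (F o)) (projT1 p) x)) q', a)
    end).
Definition frag_while r (F : frag) : frag :=
  @Frag (option F) None (fun q v =>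
    match q with
    | None => (if v r is Some _ then Some (Some (fstart F)) else None, keep v)
    | Some p => let: (q', a) := fdelta p v in (Some q', a)
    end).

Fixpoint compile (c : cmd) : frag :=
  match c with
  | Skip => frag_skip
  | Push r x => frag_push r x
  | Pop r => frag_pop r
  | Seq c d => frag_seq (compile c) (compile d)
  | Case r f => frag_case r (fun o => compile (f o))
  | While r c => frag_while r (compile c)
  end.

(** The stack is what lies at the head and to its right; the cells on the left are garbage. Hence a
    pop is a single move to the right, while a push moves left and then overwrites, which takes two
    steps. *)
Definition holds (t : tape G) (x : seq G) : Prop :=
  forall j, nth None (tcur t :: tright t) j = nth None (map Some x) j.
Definition represents (T : reg -> tape G) (s : store) : Prop :=
  forall r, holds (T r) (get s r).

Lemma holds_cur t x : holds t x -> tcur t = ohead x.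
Proof. by move=> /(_ 0) /= ->; case: x. Qed.

Lemma holds_keep t x : holds t x -> holds (write_move (tcur t, MoveN) t) x.
Proof. by case: t. Qed.

Lemma holds_pop t x s : holds t x -> holds (write_move (s, MoveR) t) (behead x).
Proof.
case: t => l c r h j; have := h j.+1 => /=.
by case: r {h} => [|b r] /=; case: x => [|a x] //=; case: j => [|[]].
Qed.

(** The second alternative disposes of the moves other than [MoveN], the one made when the pushed
    letter is written. *)
Lemma holds_push t x s a :
  holds t x -> holds (write_move (Some a, s) (write_move (tcur t, MoveL) t)) (a :: x)
  \/ s <> MoveN.
Proof.
case: t => l c r h; case: s; [by right | left | by right].
by case=> [//|j] /=; apply: h.
Qed.

Lemma rep_keep T s : represents T s -> represents (app_acts (keep (scan T)) T) s.
Proof. by move=> h r; apply: holds_keep. Qed.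

Lemma rep_pop T s r : represents T s ->
  represents (app_acts (act1 (scan T) r (scan T r, MoveR)) T)
             (put s r (behead (get s r))).
Proof.
move=> h r'; rewrite /app_acts /act1 get_put; case: ifP => [e|_].
  have -> : r' = r by rewrite -[r']ord_ofK (eqP e) ord_ofK.
  exact/holds_pop.
exact/holds_keep.
Qed.

Lemma rep_push T s r x : represents T s ->
  let T1 := app_acts (act1 (scan T) r (scan T r, MoveL)) T in
  represents (app_acts (act1 (scan T1) r (Some x, MoveN)) T1)
             (put s r (x :: get s r)).
Proof.
move=> h T1 r'; rewrite /app_acts /act1 get_put; case: ifP => [e|ne].
  have -> : r' = r by rewrite -[r']ord_ofK (eqP e) ord_ofK.
  have [|//] := @holds_push (T r) (get s r) MoveN x (h r).
  by rewrite /T1 /app_acts /act1 /reg_eq eqxx.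
rewrite /T1 /scan /app_acts /act1 ne.
by apply/holds_keep/holds_keep.
Qed.

Lemma run_seq (F1 F2 : frag) q T n T' m T'' :
  @frun F1 q T n T' -> @frun F2 (fstart F2) T' m T'' ->
  @frun (frag_seq F1 F2) (inl q) T (n + m) T''.
Proof.
have H2 q2 U k U' : @frun F2 q2 U k U' -> @frun (frag_seq F1 F2) (inr q2) U k U'.
  elim=> {q2 U k U'} [q2 U a e|q2 q' U a k U' e _ IH].
    by apply: fr_exit; rewrite /= e.
  by apply: fr_step IH; rewrite /= e.
elim=> {q T n T'} [q T a e|q q' T a n T' e _ IH] R2.
  by rewrite add1n; apply: fr_step (H2 _ _ _ _ R2); rewrite /= e.
by rewrite addSn; apply: fr_step (IH R2); rewrite /= e.
Qed.

Lemma run_case r (F : option G -> frag) T n T' o (q : F o) :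
  @frun (F o) q T n T' -> @frun (frag_case r F) (Some (existT _ o q)) T n T'.
Proof.
elim=> {q T n T'} [q T a e|q q' T a n T' e _ IH].
  by apply: fr_exit; rewrite /= e.
by apply: fr_step IH; rewrite /= e.
Qed.

Lemma run_while r F T n T' m T'' q :
  @frun F q T n T' -> @frun (frag_while r F) None T' m T'' ->
  @frun (frag_while r F) (Some q) T (n + m) T''.
Proof.
elim=> {q T n T'} [q T a e|q q' T a n T' e _ IH] R2.
  by rewrite add1n; apply: fr_step R2; rewrite /= e.
by rewrite addSn; apply: fr_step (IH R2); rewrite /= e.
Qed.

Lemma compileP c s s' t T : exec c s s' t -> represents T s ->
  exists2 T', represents T' s' & @frun (compile c) (fstart (compile c)) T t T'.
Proof.
move=> E; elim: E T => {c s s' t} /=.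
- move=> s T h; exists (app_acts (keep (scan T)) T); first exact: rep_keep.
  exact: fr_exit.
- move=> s r a T h; have := rep_push r a h => /= h'.
  eexists; first exact: h'.
  by apply: (@fr_step (frag_push r a) false true) => //; apply: fr_exit.
- move=> s r T h; eexists; first exact: (rep_pop r h).
  exact: fr_exit.
- move=> c d s s' s'' t t' _ IH1 _ IH2 T /IH1[T1 /IH2[T2 h2 R2] R1].
  by exists T2 => //; apply: run_seq R1 R2.
- move=> r f s s' t _ IH T h.
  have [T1 h1 R1] := IH _ (rep_keep h); exists T1 => //.
  apply: fr_step (run_case _ R1); rewrite /=.
  by rewrite /scan (holds_cur (h r)).
- move=> r c s e T h; exists (app_acts (keep (scan T)) T); first exact: rep_keep.
  by apply: fr_exit; rewrite /= /scan (holds_cur (h r)) e.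
move=> r c s s' s'' t t' ne _ IH1 _ IH2 T h.
have [T1 /IH2[T2 h2 R2] R1] := IH1 _ (rep_keep h).
exists T2 => //; apply: fr_step (run_while R1 R2).
by rewrite /= /scan (holds_cur (h r)); case: (get s r) ne.
Qed.

(** The exit of the fragment leads to [inr None]; one further step applies [pa] to the top of the
    first stack and halts with that verdict. This is the additional step in [tm_exec]. *)
Definition tm_delta (F : frag) (pa : option G -> bool) (q : F + option bool)
    (v : {ffun 'I_8 -> option G}) : (F + option bool) * ('I_8 -> option G * move) :=
  let v' r := v (ord_of r) in
  match q with
  | inl q => let: (q', a) := fdelta q v' in
      (if q' is Some q'' then inl q'' else inr None, fun i : 'I_8 => a (reg_of i))
  | inr _ => (inr (Some (pa (v' R0))), fun i : 'I_8 => keep v' (reg_of i))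
  end.

Definition tm_of (F : frag) (pa : option G -> bool) : TM :=
  @MkTM G (F + option bool)%type 7 (inl (fstart F))
    (fun q => if q is inr (Some _) then true else false)
    (fun q => if q is inr (Some b) then b else false)
    (tm_delta pa).

Lemma tm_run F pa q T n T' : @frun F q T n T' ->
  forall (c : config (tm_of F pa)),
    cstate c = inl q -> (forall r, ctape c (ord_of r) = T r) ->
  let c' := iter n (@step _) c in
  cstate c' = inr None /\ (forall r, ctape c' (ord_of r) = T' r).
Proof.
have sc (U : reg -> tape G) (c : config (tm_of F pa)) :
  (forall r, ctape c (ord_of r) = U r) ->
  forall q0 : F, fdelta q0 (fun r => [ffun i => tcur (ctape c i)] (ord_of r)) =
    fdelta q0 (scan U).
  move=> hU q0; congr fdelta.
  by apply: functional_extensionality => r; rewrite ffunE hU.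
elim=> {q T n T'} [q T a e|q q' T a n T' e _ IH] c cq cT.
  rewrite /= /step cq /= /tm_delta (sc T) // e /=; split => // r.
  by rewrite ord_ofK cT.
rewrite iterSr; apply: IH; rewrite /step cq /= /tm_delta (sc T) // e //= => r.
by rewrite ord_ofK cT.
Qed.

Lemma rep_init F pa (w : seq G) :
  represents (fun r => ctape (@init (tm_of F pa) w) (ord_of r))
    (St w [::] [::] [::] [::] [::] [::] [::]).
Proof.
move=> r; case: r => /= j; try by case: j => [|[]].
by case: w j => [|a w] [|[]].
Qed.

Lemma upto_blank_holds t x : holds t x -> upto_blank (tcur t :: tright t) = x.
Proof.
rewrite /holds; elim: x (tcur t :: tright t) => [|a x IH] [|b s] h //.
- by have := h 0 => /= ->.
- by have := h 0.
have := h 0 => /= ->; rewrite IH // => j; exact: (h j.+1).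
Qed.

Lemma tm_exec c (pa : option G -> bool) w s' t :
  exec c (St w [::] [::] [::] [::] [::] [::] [::]) s' t ->
  let c' := iter t.+1 (@step (tm_of (compile c) pa)) (@init (tm_of (compile c) pa) w) in
  [/\ halting (cstate c'), accepting (cstate c') = pa (ohead (s0 s'))
    & output c' = s0 s'].
Proof.
move=> /compileP /(_ (rep_init (compile c) pa w)) [T' h R].
have [] := tm_run R (pa := pa) (c := @init (tm_of (compile c) pa) w) erefl (fun=> erefl).
set c' := iter t _ _ => cs ct; rewrite iterS -/c'.
have e0 : ord_of R0 = ord0 by apply: val_inj.
rewrite /step cs /=; split=> //; rewrite /output /= ?ffunE.
  by rewrite (ct R0) (holds_cur (h R0)).
have := h R0; rewrite -(ct R0) e0 => h0.
rewrite /keep /= -[s0 s']/(get s' R0) -(upto_blank_holds h0) ?ffunE ?e0.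
have -> : @Ordinal 8 0 isT = ord0 by apply: val_inj.
by case: (ctape c' ord0).
Qed.

Lemma stack_computes (Sigma Delta : finType) (f : seq Sigma -> seq Delta)
    (T : nat -> nat) c (i : Sigma -> G) (o : Delta -> G) :
  injective i -> injective o ->
  (forall w, exists s' t, [/\ exec c (St (map i w) [::] [::] [::] [::] [::] [::] [::]) s' t,
     t < T (size w) & s0 s' = map o (f w)]) ->
  computes_in_time f T.
Proof.
move=> ii oi h; exists (tm_of (compile c) (fun=> true)), i, o; split=> // w.
have [s' [t [E lt e]]] := h w; have [a _ b] := tm_exec (fun=> true) E.
by exists t.+1 => //; rewrite -e.
Qed.

Lemma stack_decides (Sigma : finType) (L : language Sigma)
    (T : nat -> nat) c (i : Sigma -> G) (pa : option G -> bool) :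
  injective i ->
  (forall w, exists s' t, [/\ exec c (St (map i w) [::] [::] [::] [::] [::] [::] [::]) s' t,
     t < T (size w) & pa (ohead (s0 s')) <-> L w]) ->
  decides_in_time L T.
Proof.
move=> ii h; exists (tm_of (compile c) pa), i; split=> // w.
have [s' [t [E lt e]]] := h w; have [a b _] := tm_exec pa E.
by exists t.+1 => //; cbv zeta; rewrite b.
Qed.

(** Upper bounds instead of exact times, so that estimates can be rounded at every composition. *)
Definition ex (c : cmd) (s s' : store) (T : nat) : Prop :=
  exists2 t, t <= T & exec c s s' t.

Lemma ex_le c s s' T T' : ex c s s' T -> T <= T' -> ex c s s' T'.
Proof. by case=> t le E le'; exists t => //; apply: leq_trans le'. Qed.

Lemma ex_skip s : ex Skip s s 1.
Proof. by exists 1 => //; constructor. Qed.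

Lemma ex_push r a s s' : s' = put s r (a :: get s r) -> ex (Push r a) s s' 2.
Proof. by move->; exists 2 => //; constructor. Qed.

Lemma ex_pop r s s' : s' = put s r (behead (get s r)) -> ex (Pop r) s s' 1.
Proof. by move->; exists 1 => //; constructor. Qed.

Lemma ex_seq c d s s' s'' t t' :
  ex c s s' t -> ex d s' s'' t' -> ex (Seq c d) s s'' (t + t').
Proof.
case=> u lu E [u' lu' E']; exists (u + u'); first exact: leq_add.
exact: x_seq E E'.
Qed.

Lemma ex_case r f s s' t o : ohead (get s r) = o ->
  ex (f o) s s' t -> ex (Case r f) s s' t.+1.
Proof. by move=> <- [u lu E]; exists u.+1 => //; constructor. Qed.

Lemma ex_while0 r c s : get s r = [::] -> ex (While r c) s s 1.
Proof. by move=> e; exists 1 => //; constructor. Qed.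

Lemma ex_while r c s s' s'' t t' :
  get s r != [::] -> ex c s s' t -> ex (While r c) s' s'' t' ->
  ex (While r c) s s'' (t + t').+1.
Proof.
move=> ne [u lu E] [u' lu' E']; exists (u + u').+1; first by rewrite ltnS leq_add.
exact: x_while E E'.
Qed.

Definition Loop (r : reg) (body : G -> cmd) : cmd :=
  While r (Case r (fun o => if o is Some a then Seq (Pop r) (body a) else Skip)).

(** The overhead of 3 consists of the loop test, the case distinction and the pop. *)
Lemma ex_loop r body s s' s'' a x t t' : get s r = a :: x ->
  ex (body a) (put s r x) s' t -> ex (Loop r body) s' s'' t' ->
  ex (Loop r body) s s'' (t + t' + 3).
Proof.
move=> e E1 E2; apply: (@ex_le _ _ _ ((1 + t).+1 + t').+1); last by lia.
apply: ex_while E2; first by rewrite e.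
apply: (@ex_case _ _ _ _ _ (Some a)); first by rewrite e.
by apply: ex_seq E1; apply: ex_pop; rewrite e.
Qed.

Definition Pushes (r : reg) (l : seq G) : cmd :=
  foldr (fun a c => Seq (Push r a) c) Skip l.

Lemma ex_pushes r l s s' : s' = put s r (catrev l (get s r)) ->
  ex (Pushes r l) s s' (2 * size l + 1).
Proof.
elim: l s s' => [|a l IH] s s' -> /=.
  by case: s => *; case: r; apply: ex_skip.
apply: (@ex_le _ _ _ (2 + (2 * size l + 1))); last by lia.
apply: ex_seq; first exact: ex_push.
by apply: IH; case: s => *; case: r.
Qed.

End StackPrograms.

End StackPrograms.

(** * Alternating queue automata decide languages in DEXPTIME *)

Module QueueMachines.
Import StackPrograms.

Section Transfer.
Variable G : finType.

(** A transfer from stack to stack reverses the order, so tables are usually transferred back once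
    they have been scanned. *)
Definition Tr (r r' : reg) (f : G -> seq G) : cmd G :=
  Loop r (fun a => Pushes r' (f a)).

Lemma ex_tr r r' f m (s s' : store G) :
  reg_eq r r' = false -> (forall a, size (f a) <= m) ->
  s' = put (put s r' (catrev (flatten (map f (get s r))) (get s r'))) r [::] ->
  ex (Tr r r' f) s s' ((2 * m + 4) * size (get s r) + 1).
Proof.
move=> ne fm ->; move e : (get s r) => x; elim: x s e => [|a x IH] s e.
  rewrite muln0; have -> : put (put s r' (catrev (flatten (map f [::])) (get s r'))) r [::] = s.
    by case: s e => x0 x1 x2 x3 x4 x5 x6 x7 e; move: ne e; case: r => /= ne <-; move: ne; case: r'.
  exact: ex_while0.
apply: (@ex_le _ _ _ _ ((2 * m + 1) + ((2 * m + 4) * size x + 1) + 3)); last first.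
  by rewrite /= mulnS; lia.
set s1 := put (put s r x) r' (catrev (f a) (get s r')).
apply: (@ex_loop _ _ _ s s1 _ a x) => //.
  apply: ex_le (ex_pushes (s' := s1) _) _; last by have := fm a; lia.
  by rewrite get_put /s1; case: s {e IH s1} => *; move: ne; case: r; case: r'.
have e1 : get s1 r = x by rewrite /s1 !get_put ne /reg_eq eqxx.
have := IH s1 e1.
suff -> : put (put s r' (catrev (flatten [seq f i | i <- a :: x]) (get s r'))) r [::]
  = put (put s1 r' (catrev (flatten [seq f i | i <- x]) (get s1 r'))) r [::] by [].
rewrite /s1 /= [in RHS]get_put /reg_eq eqxx.
rewrite catrev_catl.
by case: s {s1 IH e e1} => *; move: ne; case: r; case: r'.
Qed.

Definition Mv (r r' : reg) : cmd G := Tr r r' (fun a => [:: a]).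

Lemma ex_mv r r' (s s' : store G) : reg_eq r r' = false ->
  s' = put (put s r' (catrev (get s r) (get s r'))) r [::] ->
  ex (Mv r r') s s' (6 * size (get s r) + 1).
Proof.
move=> ne e; apply: (@ex_le _ _ _ _ ((2 * 1 + 4) * size (get s r) + 1)); last by lia.
apply: ex_tr => //; suff -> : flatten [seq [:: a] | a <- get s r] = get s r by [].
by elim: (get s r) => //= a x ->.
Qed.
End Transfer.

(* An alternating automaton working on a queue of constant length: it reads the
   front symbol y, picks existentially an option of [aq_delta q y], then
   universally a pair (q', x) of it, and appends x. *)
Record aqm := AQM {
  aq_state : finType;
  aq_sym : finType;
  aq_delta : aq_state -> aq_sym -> seq (seq (aq_state * aq_sym))
}.

Inductive accepts (M : aqm) : aq_state M -> seq (aq_sym M) -> Prop :=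
| Accepts q y u o : o \in aq_delta q y ->
    (forall q' x, (q', x) \in o -> accepts q' (rcons u x)) -> accepts q (y :: u).

Section Table.
Variable M : aqm.
Local Notation Q := (aq_state M).
Local Notation G := (aq_sym M).

Definition upd (y : G) (c : G -> {set Q}) : {set Q} :=
  [set q | has (all (fun p : Q * G => p.1 \in c p.2)) (aq_delta q y)].

(** The table entry of the queue [u] after [k] rounds: the states that accept [u] by a derivation of
    depth at most [k]. *)
Fixpoint cell (k : nat) (u : seq G) : {set Q} :=
  if (k, u) is (k'.+1, y :: v) then upd y (fun x => cell k' (rcons v x)) else set0.

Lemma cell_sound k q u : q \in cell k u -> accepts q u.
Proof.
elim: k q u => [|k IH] q [|y u] /=; rewrite ?inE // => /hasP[o oin /allP al].
by apply: Accepts oin _ => q' x /al; apply: IH.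
Qed.

(** The same recursion as a monotone operator on sets of configurations of one fixed length, the
    form to which the theory of finite fixed points applies. *)
Definition tstep b (X : {set Q * b.+1.-tuple G}) : {set Q * b.+1.-tuple G} :=
  [set p : Q * b.+1.-tuple G | has (all (fun r : Q * G => (r.1, [tuple of rcons (behead p.2) r.2]) \in X))
               (aq_delta p.1 (thead p.2))].

Lemma cell_iter b k (q : Q) (t : b.+1.-tuple G) :
  (q, t) \in iter k (@tstep b) set0 = (q \in cell k t).
Proof.
elim: k q t => [|k IH] q t; first by rewrite !inE.
case: (tupleP t) => y u /=; rewrite !inE /= theadE; apply: eq_has => o.
apply: eq_all => -[q' x] /=; rewrite IH; congr (_ \in cell k _).
Qed.

Lemma tstep_mono b : {homo @tstep b : X Y / X \subset Y}.
Proof.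
move=> X Y /subsetP sXY; apply/subsetP => p; rewrite !inE.
by apply: sub_has => o; apply: sub_all => r; apply: sXY.
Qed.

(** The queue keeps its length, so there are [#|Q| * #|G| ^ size u] configurations, and an
    increasing iteration from the empty set is stationary after that many rounds. *)
Lemma cell_complete q u : accepts q u ->
  q \in cell (#|Q| * #|G| ^ size u) u.
Proof.
move b1 : (size u) => b A; elim: A b1 => {q u} q y u o oin _ IH sz.
case: b sz IH => // b [su] IH.
have -> : (#|Q| * #|G| ^ b.+1)%N = #|{: Q * b.+1.-tuple G}|.
  by rewrite card_prod card_tuple.
pose t : b.+1.-tuple G := Tuple (introT eqP (congr1 S su) : size (y :: u) == b.+1).
rewrite -[y :: u]/(tval t) -cell_iter -/(fixset _) -(fixsetK (@tstep_mono b)) inE /=.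
apply/hasP; exists o; first by rewrite (_ : thead t = y).
apply/allP => -[q' x] /= /IH H.
have {H} := H (etrans (size_rcons _ _) (congr1 S su)).
rewrite /fixset cell_iter /= card_prod card_tuple.
by [].
Qed.

Lemma cellP q u : q \in cell (#|Q| * #|G| ^ size u) u <-> accepts q u.
Proof. by split; [apply: cell_sound | apply: cell_complete]. Qed.

Fixpoint words (n : nat) : seq (seq G) :=
  if n is n'.+1 then flatten [seq map (cons y) (words n') | y <- enum G] else [:: [::]].

(** The same list is grouped by first letters and by last letters. This makes a round of the
    iteration a sequential scan: the new entry of [y :: v] depends on the entries of [rcons v x] for
    all [x], and these are adjacent. *)
Lemma words_rcons n :
  words n.+1 = flatten [seq map (rcons v) (enum G) | v <- words n].
Proof.
elim: n => [|n IH].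
  by rewrite /= cats0; elim: (enum G) => //= y s ->.
have gen (s E : seq G) W :
  flatten [seq map (cons y) (flatten [seq map (rcons v) E | v <- W]) | y <- s] =
  flatten [seq map (rcons v) E | v <- flatten [seq map (cons y) W | y <- s]].
  elim: s => [//|y s IHs] /=; rewrite map_cat flatten_cat -IHs; congr (_ ++ _).
  by rewrite map_flatten -!map_comp; congr flatten; apply: eq_map => v /=; rewrite -map_comp.
by rewrite [LHS]/= -/(words n.+1) {1}IH gen.
Qed.

Lemma size_words n : size (words n) = #|G| ^ n.
Proof.
elim: n => [//|n IH] /=; rewrite size_flatten /shape -map_comp.
rewrite (eq_map (g := fun=> (#|G| ^ n)%N)); last by move=> y /=; rewrite size_map IH.
by rewrite expnS; move: (_ ^ n) => k; rewrite cardE; elim: (enum G) => //= a s ->; rewrite mulSn.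
Qed.

Variables (Sigma : finType) (h : Sigma -> G) (pre post : seq G).
Definition tsym : finType := (Sigma + G + {set Q})%type.
Definition inS (a : Sigma) : tsym := inl (inl a).
Definition inG (x : G) : tsym := inl (inr x).
Definition inC (c : {set Q}) : tsym := inr c.
Definition outC (a : tsym) : {set Q} := if a is inr c then c else set0.

(** Takes the next [n] letters from R1 into the finite control; [k] is a separate program for each
    possible content. *)
Fixpoint chunk (n : nat) (acc : seq tsym) (k : seq tsym -> cmd tsym) : cmd tsym :=
  if n is n'.+1 then
    Case R1 (fun o => Seq (Pop _ R1) (chunk n' (if o is Some a then a :: acc else acc) k))
  else k (rev acc).

Lemma ex_chunk n acc k s s' cs x t : get s R1 = cs ++ x -> size cs = n ->
  ex (k (rev acc ++ cs)) (put s R1 x) s' t -> ex (chunk n acc k) s s' (t + 2 * n).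
Proof.
elim: n acc cs s => [|n IH] acc [|c cs] // s e sz E.
  rewrite muln0 addn0; move: E; rewrite cats0.
  by rewrite (_ : put s R1 x = s) //; case: s e => /= *; subst.
apply: (@ex_le _ _ _ _ (1 + (t + 2 * n)).+1); last by lia.
apply: (@ex_case _ _ _ _ _ _ (Some c)); first by rewrite e.
apply: ex_seq; first exact: ex_pop.
apply: (IH (c :: acc) cs).
- by rewrite get_put e.
- by case: sz.
by rewrite rev_cons cat_rcons; case: s e E => *.
Qed.

Definition cellsel (cs : seq tsym) (x : G) : {set Q} :=
  outC (nth (inC set0) cs (enum_rank x)).

(** A scan of the old table that puts the new entries of all words beginning with [y] on R3, in
    order, and then restores the old table for the next letter. *)
Definition ypass (y : G) : cmd tsym :=
  Seq (While R1 (chunk #|G| [::] (fun cs =>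
         Seq (Pushes R2 cs) (Push R3 (inC (upd y (cellsel cs)))))))
      (Mv _ R2 R1).
Definition pass : cmd tsym :=
  Seq (foldr (fun y c => Seq (ypass y) c) (Skip _) (enum G))
      (Seq (Tr R1 R2 (fun=> [::])) (Mv _ R3 R1)).
(** Keeps the entries of the words ending in [x], now indexed without that letter. Once the whole
    queue has been used up, a single entry is left. *)
Definition select (x : tsym) : cmd tsym :=
  if x is inl (inr x) then
    Seq (While R1 (chunk #|G| [::] (fun cs => Push R2 (inC (cellsel cs x)))))
        (Mv _ R2 R1)
  else Skip _.
(** R5 and R6 both receive the queue, last letter on top: R5 is consumed to build a table of the
    right size, R6 to look up the answer. R4 counts the rounds, with [#|Q|] letters per table entry,
    which makes the number of configurations. *)
Definition decider : cmd tsym :=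
  Seq (Seq (Seq (Pushes R6 (map inG pre)) (Pushes R5 (map inG pre)))
     (Seq (Loop R0 (fun a => if a is inl (inl a) then
                      Seq (Push R6 (inG (h a))) (Push R5 (inG (h a))) else Skip _))
        (Seq (Pushes R6 (map inG post)) (Pushes R5 (map inG post)))))
  (Seq (Seq (Push R1 (inC set0))
     (Loop R5 (fun _ => Seq (Tr R1 R2 (fun a => nseq #|G| a)) (Mv _ R2 R1))))
  (Seq (Loop R1 (fun a => Seq (Pushes R4 (nseq #|Q| a)) (Push R2 a)))
  (Seq (Mv _ R2 R1)
  (Seq (Loop R4 (fun _ => pass))
  (Seq (Loop R6 select)
       (Mv _ R1 R0)))))).

Definition tab (f : seq G -> {set Q}) n : seq tsym := [seq inC (f u) | u <- words n].

Lemma size_tab f n : size (tab f n) = #|G| ^ n.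
Proof. by rewrite size_map size_words. Qed.

Lemma cellsel_enum f v x :
  cellsel [seq inC (f u) | u <- map (rcons v) (enum G)] x = f (rcons v x).
Proof.
rewrite /cellsel -map_comp (nth_map x) ?nth_enum_rank //=.
by rewrite -cardE ltn_ord.
Qed.

Lemma tab_rcons f n : tab f n.+1 =
  flatten [seq [seq inC (f u) | u <- map (rcons v) (enum G)] | v <- words n].
Proof. by rewrite /tab words_rcons map_flatten -map_comp. Qed.

Hypothesis G0 : 0 < #|G|.

Lemma ex_ypass f n y a b c d e g :
  ex (ypass y) (St a (tab f n.+1) [::] b c d e g)
     (St a (tab f n.+1) [::]
         (catrev [seq inC (upd y (fun x => f (rcons v x))) | v <- words n] b) c d e g)
     ((4 * #|G| + 10) * #|G| ^ n.+1 + 2).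
Proof.
pose gg := #|G|.
have E1 vs r2 : ex (While R1 (chunk gg [::] (fun cs =>
         Seq (Pushes R2 cs) (Push R3 (inC (upd y (cellsel cs)))))))
   (St a (flatten [seq [seq inC (f u) | u <- map (rcons v) (enum G)] | v <- vs]) r2 b c d e g)
   (St a [::] (catrev (flatten [seq [seq inC (f u) | u <- map (rcons v) (enum G)] | v <- vs]) r2)
       (catrev [seq inC (upd y (fun x => f (rcons v x))) | v <- vs] b) c d e g)
   ((4 * gg + 4) * size vs + 1).
  elim: vs r2 b => [|v vs IH] r2 b' /=; first by rewrite muln0; exact: ex_while0.
  have szc : size [seq inC (f u) | u <- [seq rcons v i | i <- enum G]] = gg.
    by transitivity (size (enum G)); [rewrite !size_map | exact/esym/cardE].
  set cs := [seq inC (f u) | u <- _] in szc *.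
  apply: (@ex_le _ _ _ _ ((((2 * gg + 1) + 2) + 2 * gg) + ((4 * gg + 4) * size vs + 1)).+1);
    last by rewrite mulnS; lia.
  apply: (ex_while (s' := St a (flatten [seq [seq inC (f u) | u <- map (rcons v) (enum G)] | v <- vs])
     (catrev cs r2) (inC (upd y (fun x => f (rcons v x))) :: b') c d e g)).
  - by case: cs szc => // sz; move: G0; rewrite -/gg -sz.
  - apply: (@ex_chunk _ _ _ _ _ cs) => //.
    rewrite -{1}szc; apply: ex_seq; first exact: ex_pushes.
    apply: ex_push => /=; congr St; congr (inC (upd _ _) :: _).
    by apply: functional_extensionality => x; rewrite /cs cellsel_enum.
  rewrite (_ : catrev (cs ++ _) r2 = catrev (flatten [seq [seq inC (f u) | u <- map (rcons v) (enum G)] | v <- vs]) (catrev cs r2)).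
    exact: IH.
  by rewrite catrev_catl.
apply: (@ex_le _ _ _ _ (((4 * #|G| + 4) * size (words n) + 1) + (6 * #|G| ^ n.+1 + 1))).
  rewrite {1}tab_rcons; apply: (ex_seq (E1 (words n) [::])); rewrite -tab_rcons.
  have := @ex_mv _ R2 R1 (St a [::] (catrev (tab f n.+1) [::])
    (catrev [seq inC (upd y (fun x => f (rcons v x))) | v <- words n] b) c d e g) _ erefl erefl.
  rewrite /= [catrev (tab _ _) _]catrevE cats0 size_rev size_tab.
  by rewrite (catrevE (rev _)) revK cats0.
rewrite size_words; have : #|G| ^ n <= #|G| ^ n.+1 by rewrite expnS leq_pmull.
by move: (#|G| ^ n) (#|G| ^ n.+1) #|G| => x z g1; nia.
Qed.

Lemma ex_pass k n a c d e g :
  ex pass (St a (tab (cell k) n.+1) [::] [::] c d e g)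
     (St a (tab (cell k.+1) n.+1) [::] [::] c d e g)
     (#|G| * ((4 * #|G| + 10) * #|G| ^ n.+1 + 2) + 1 + (10 * #|G| ^ n.+1 + 2)).
Proof.
have E1 ys b : ex (foldr (fun y c => Seq (ypass y) c) (Skip _) ys)
   (St a (tab (cell k) n.+1) [::] b c d e g)
   (St a (tab (cell k) n.+1) [::]
     (catrev [seq inC (cell k.+1 u) | u <- flatten [seq map (cons y) (words n) | y <- ys]] b) c d e g)
   (size ys * ((4 * #|G| + 10) * #|G| ^ n.+1 + 2) + 1).
  elim: ys b => [|y ys IH] b; first exact: ex_skip.
  apply: (@ex_le _ _ _ _ (((4 * #|G| + 10) * #|G| ^ n.+1 + 2) +
    (size ys * ((4 * #|G| + 10) * #|G| ^ n.+1 + 2) + 1))); last by rewrite /= mulSn; lia.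
  apply: ex_seq (ex_ypass _ _ _ _ _ _ _ _ _) _.
  rewrite [flatten _]/= map_cat catrev_catl -map_comp; exact: IH.
apply: ex_seq; first by rewrite [X in X * _]cardE; apply: E1.
rewrite -[flatten _]/(words n.+1) -/(tab _ _).
apply: (@ex_le _ _ _ _ (((2 * 0 + 4) * #|G| ^ n.+1 + 1) + (6 * #|G| ^ n.+1 + 1))); last by lia.
apply: ex_seq.
  rewrite -(size_tab (cell k)).
  by apply: (@ex_tr _ R1 R2 _ 0 (St a (tab (cell k) n.+1) [::] _ c d e g)).
rewrite /= (_ : flatten _ = [::]); last by elim: (tab _ _).
have := @ex_mv _ R3 R1 (St a [::] [::] (catrev (tab (cell k.+1) n.+1) [::]) c d e g) _ erefl erefl.
rewrite /= {2 3}catrevE size_cat size_rev addn0 size_tab cats0.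
by rewrite (catrevE (rev _)) revK cats0.
Qed.

Lemma ex_select f n (x : G) a c d e g :
  ex (select (inG x)) (St a (tab f n.+1) [::] c d e g [::])
     (St a (tab (fun v => f (rcons v x)) n) [::] c d e g [::])
     ((2 * #|G| + 10) * #|G| ^ n + 2).
Proof.
pose gg := #|G|.
have E1 vs r2 : ex (While R1 (chunk gg [::] (fun cs => Push R2 (inC (cellsel cs x)))))
   (St a (flatten [seq [seq inC (f u) | u <- map (rcons v) (enum G)] | v <- vs]) r2 c d e g [::])
   (St a [::] (catrev [seq inC (f (rcons v x)) | v <- vs] r2) c d e g [::])
   ((2 * gg + 3) * size vs + 1).
  elim: vs r2 => [|v vs IH] r2 /=; first by rewrite muln0; apply: ex_while0.
  have szc : size [seq inC (f u) | u <- [seq rcons v i | i <- enum G]] = gg.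
    by transitivity (size (enum G)); [rewrite !size_map | exact/esym/cardE].
  set cs := [seq inC (f u) | u <- _] in szc *.
  apply: (@ex_le _ _ _ _ ((2 + 2 * gg) + ((2 * gg + 3) * size vs + 1)).+1);
    last by rewrite mulnS; lia.
  apply: ex_while (IH _).
  - by case: cs szc => // sz; move: G0; rewrite -/gg -sz.
  - apply: (@ex_chunk _ _ _ _ _ cs) => //.
    by apply: ex_push => /=; rewrite /cs cellsel_enum.
rewrite tab_rcons /select.
apply: (@ex_le _ _ _ _ (((2 * #|G| + 3) * size (words n) + 1) + (6 * #|G| ^ n + 1))); last first.
  by rewrite size_words; nia.
apply: ex_seq (E1 _ _) _.
have := @ex_mv _ R2 R1 (St a [::] (catrev (tab (fun v => f (rcons v x)) n) [::]) c d e g [::]) _ erefl erefl.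
rewrite /= catrevE cats0 size_rev size_tab.
by rewrite (catrevE (rev _)) revK cats0.
Qed.

Lemma ex_rounds l k n a d e g :
  ex (Loop R4 (fun _ => pass)) (St a (tab (cell k) n.+1) [::] [::] l d e g)
     (St a (tab (cell (k + size l)) n.+1) [::] [::] [::] d e g)
     (size l * ((4 * #|G| + 20) * #|G| ^ n.+2 + 2 * #|G| + 6) + 1).
Proof.
elim: l k => [|b l IH] k; first by rewrite addn0; apply: ex_while0.
have gp : 0 < #|G| ^ n.+1 by rewrite expn_gt0 G0.
apply: (@ex_le _ _ _ _ ((#|G| * ((4 * #|G| + 10) * #|G| ^ n.+1 + 2) + 1 + (10 * #|G| ^ n.+1 + 2))
   + (size l * ((4 * #|G| + 20) * #|G| ^ n.+2 + 2 * #|G| + 6) + 1) + 3)).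
  apply: (@ex_loop _ _ _ _ (St a (tab (cell k.+1) n.+1) [::] [::] l d e g) _ b l) => //.
    exact: ex_pass.
  by rewrite [size _]/= addnS -addSn; apply: IH.
rewrite [size (b :: l)]/= (mulSn (size l)); move: (size l * _) => z; rewrite [#|G| ^ n.+2]expnS.
by nia.
Qed.

Lemma ex_selects l f n a c d e : size l = n ->
  ex (Loop R6 select) (St a (tab f n) [::] c d e (map inG l) [::])
     (St a (tab (fun v => f (v ++ rev l)) 0) [::] c d e [::] [::])
     (n * ((2 * #|G| + 10) * #|G| ^ n + 6) + 1).
Proof.
elim: l f n => [|x l IH] f n /=.
  by move<-; rewrite (_ : tab (fun v => _) 0 = tab f 0) //; apply: ex_while0.
case: n => // n [sz].
apply: (@ex_le _ _ _ _ (((2 * #|G| + 10) * #|G| ^ n + 2)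
   + (n * ((2 * #|G| + 10) * #|G| ^ n + 6) + 1) + 3)); last first.
  have : (2 * #|G| + 10) * #|G| ^ n <= (2 * #|G| + 10) * #|G| ^ n.+1.
    by rewrite leq_mul2l expnS leq_pmull ?orbT.
  by move: (_ * _ ^ n) (_ * _ ^ n.+1) => y z; nia.
apply: (@ex_loop _ _ _ _ (St a (tab (fun v => f (rcons v x)) n) [::] c d e (map inG l) [::]) _ (inG x) (map inG l)) => //.
  exact: ex_select.
have := IH (fun v => f (rcons v x)) n sz.
by rewrite /tab /= rev_cons.
Qed.

Lemma ex_build l k a b c d :
  ex (Loop R5 (fun _ => Seq (Tr R1 R2 (fun a => nseq #|G| a)) (Mv _ R2 R1)))
     (St a (nseq (#|G| ^ k) (inC set0)) [::] b c l d [::])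
     (St a (nseq (#|G| ^ (k + size l)) (inC set0)) [::] b c [::] d [::])
     (size l * ((8 * #|G| + 10) * #|G| ^ (k + size l)) + 1).
Proof.
elim: l k => [|x l IH] k; first by rewrite addn0; apply: ex_while0.
have gp : 0 < #|G| ^ (k + size l) by rewrite expn_gt0 G0.
have gp' : #|G| ^ k <= #|G| ^ (k + size l) by rewrite leq_pexp2l // leq_addr.
apply: (@ex_le _ _ _ _ ((((2 * #|G| + 4) * #|G| ^ k + 1) + (6 * #|G| ^ k.+1 + 1))
   + (size l * ((8 * #|G| + 10) * #|G| ^ (k.+1 + size l)) + 1) + 3)); last first.
  rewrite [size (x :: l)]/= (addnS k) (addSn k) !expnS (mulSn (size l)).
  by move: (size l * _) => z; nia.
have fl m : flatten [seq nseq #|G| a0 | a0 <- nseq m (inC set0 : tsym)] = nseq (#|G| * m) (inC set0).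
  by elim: m => [|m IHm] /=; rewrite ?muln0 // IHm mulnS nseqD.
have cr m : catrev (nseq m (inC set0 : tsym)) [::] = nseq m (inC set0).
  by rewrite catrevE cats0 rev_nseq.
apply: ex_loop (_ : ex _ _ (St a (nseq (#|G| ^ k.+1) (inC set0)) [::] b c l d [::]) _) _ => //.
  apply: ex_seq.
    rewrite -{2}(size_nseq (#|G| ^ k) (inC set0 : tsym)).
    apply: (@ex_tr _ R1 R2 _ #|G| (St a (nseq (#|G| ^ k) (inC set0)) [::] b c l d [::])) => //.
    by move=> ?; rewrite size_nseq.
  rewrite /= fl -expnS cr.
  have := @ex_mv _ R2 R1 (St a [::] (nseq (#|G| ^ k.+1) (inC set0)) b c l d [::]) _ erefl erefl.
  by rewrite /= size_nseq cr.
by rewrite [size (x :: l)]/= (addnS k) -(addSn k); apply: IH.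
Qed.

Lemma ex_count x y a b c d e :
  ex (Loop R1 (fun a => Seq (Pushes R4 (nseq #|Q| a)) (Push R2 a)))
     (St a (nseq x (inC set0)) y b c d e [::])
     (St a [::] (catrev (nseq x (inC set0)) y) b (catrev (nseq (#|Q| * x) (inC set0)) c) d e [::])
     (x * (2 * #|Q| + 6) + 1).
Proof.
elim: x y c => [|x IH] y c; first by rewrite muln0; apply: ex_while0.
apply: (@ex_le _ _ _ _ (((2 * #|Q| + 1) + 2) + (x * (2 * #|Q| + 6) + 1) + 3)); last by lia.
apply: ex_loop => //=.
  apply: ex_seq; last exact: ex_push.
  by apply: ex_le (ex_pushes erefl) _; rewrite size_nseq.
by rewrite mulnS nseqD catrev_catl; apply: IH.
Qed.

Lemma ex_input w b c : 
  ex (Loop R0 (fun a => if a is inl (inl a) then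
                      Seq (Push R6 (inG (h a))) (Push R5 (inG (h a))) else Skip _))
     (St (map inS w) [::] [::] [::] [::] b c [::])
     (St [::] [::] [::] [::] [::] (catrev (map (inG \o h) w) b) (catrev (map (inG \o h) w) c) [::])
     (7 * size w + 1).
Proof.
elim: w b c => [|x w IH] b c; first exact: ex_while0.
apply: (@ex_le _ _ _ _ ((2 + 2) + (7 * size w + 1) + 3)); last by rewrite /=; lia.
apply: ex_loop (IH _ _) => //=.
by apply: ex_seq; apply: ex_push.
Qed.

Definition queue (w : seq Sigma) : seq G := pre ++ map h w ++ post.

Lemma ex_decider w : 0 < size (queue w) ->
  let B := size (queue w) in let g := #|G| in
  ex decider (St (map inS w) [::] [::] [::] [::] [::] [::] [::])
     (St [:: inC (cell (#|Q| * g ^ B) (queue w))] [::] [::] [::] [::] [::] [::] [::])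
     ((20 * B + 20) + ((2 + (B * ((8 * g + 10) * g ^ B) + 1)) + ((g ^ B * (2 * #|Q| + 6) + 1)
      + ((6 * g ^ B + 1) + ((#|Q| * g ^ B * ((4 * g + 20) * g ^ B.+1 + 2 * g + 6) + 1)
      + ((B * ((2 * g + 10) * g ^ B + 6) + 1) + 7)))))).
Proof.
move=> B0 B g; set u := queue w.
have eu : catrev (map inG post) (catrev (map (inG \o h) w) (catrev (map inG pre) [::])) = map inG (rev u).
  by rewrite -!catrev_catl catrevE cats0 /u /queue !map_rev !map_cat -map_comp catA.
have su : size (map inG (rev u)) = B by rewrite size_map size_rev.
apply: (ex_seq (s' := St [::] [::] [::] [::] [::] (map inG (rev u)) (map inG (rev u)) [::])).
  have szB : size pre + (size w + size post) = B by rewrite /B /queue !size_cat size_map.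
  apply: (@ex_le _ _ _ _ (((2 * size pre + 1) + (2 * size pre + 1)) + ((7 * size w + 1) +
     ((2 * size post + 1) + (2 * size post + 1))))); last by lia.
  rewrite -eu; apply: ex_seq.
    by apply: ex_seq; (apply: ex_le (ex_pushes erefl) _; rewrite size_map).
  apply: ex_seq (ex_input _ _ _) _.
  apply: ex_seq; first by apply: ex_le (ex_pushes erefl) _; rewrite size_map.
  by apply: ex_le (ex_pushes _) _; rewrite ?size_map.
have tabE n : tab (cell 0) n = nseq (#|G| ^ n) (inC set0).
  by rewrite /tab -size_words; elim: (words n) => //= v s ->.
apply: ex_seq.
  apply: ex_seq; first exact: ex_push.
  by rewrite -su; apply: ex_le (ex_build _ 0 _ _ _ _) _.
rewrite add0n su; apply: ex_seq; first exact: ex_count.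
have cr m l : catrev (nseq m (inC set0 : tsym)) (nseq l (inC set0)) = nseq (m + l) (inC set0).
  by rewrite catrevE rev_nseq nseqD.
rewrite !(cr _ 0) !addn0; apply: ex_seq.
  apply: ex_le (@ex_mv _ R2 R1 (St [::] [::] _ _ _ _ _ _) _ erefl erefl) _.
  by rewrite size_nseq.
rewrite /= (cr _ 0) addn0 -tabE; have : 0 < B := B0; case EB : B => [|n] // _.
apply: ex_seq.
  by apply: ex_le (ex_rounds _ _ _ _ _ _ _) _; rewrite size_nseq.
rewrite size_nseq add0n; apply: ex_seq.
  by apply: ex_selects; rewrite size_rev -EB.
rewrite revK /tab /=.
exact: (@ex_mv _ R1 R0 (St [::] [:: _] [::] [::] [::] [::] [::] [::])).
Qed.

End Table.

Lemma poly_boundedD p q : poly_bounded p -> poly_bounded q ->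
  poly_bounded (fun n => p n + q n).
Proof.
move=> [c [d hp]] [c' [d' hq]]; exists (2 * c + 2 * c'), (d + d') => n.
have e0 k : 0 ^ k <= 1 by case: k => // k; rewrite exp0n.
have := hp n; have := hq n.
case: n => [|n]; first by have := e0 d; have := e0 d'; nia.
have : n.+1 ^ d <= n.+1 ^ (d + d') by rewrite leq_pexp2l // leq_addr.
have : n.+1 ^ d' <= n.+1 ^ (d + d') by rewrite leq_pexp2l // leq_addl.
by nia.
Qed.

Lemma poly_boundedM p q : poly_bounded p -> poly_bounded q ->
  poly_bounded (fun n => p n * q n).
Proof.
move=> [c [d hp]] [c' [d' hq]]; exists (4 * c * c'), (d + d') => n.
apply: leq_trans (leq_mul (hp n) (hq n)) _.
have e0 k : 0 ^ k <= 1 by case: k => // k; rewrite exp0n.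
case: n => [|n].
  apply: leq_trans (leq_addl _ _); apply: (@leq_trans ((2 * c) * (2 * c'))); last by lia.
  by apply: leq_mul; [have := e0 d | have := e0 d']; nia.
have : 0 < n.+1 ^ d by rewrite expn_gt0.
have : 0 < n.+1 ^ d' by rewrite expn_gt0.
by rewrite expnD; move: (n.+1 ^ d) (n.+1 ^ d') => x y; nia.
Qed.

Lemma poly_bounded_const k : poly_bounded (fun=> k).
Proof. by exists k, 0 => n; lia. Qed.

Lemma poly_bounded_id : poly_bounded id.
Proof. by exists 1, 1 => n; rewrite expn1; lia. Qed.

Lemma poly_boundedX p d : poly_bounded p -> poly_bounded (fun n => p n ^ d).
Proof.
move=> hp; elim: d => [|d IH].
  by have [c [e h]] := poly_bounded_const 1; exists c, e.
have [c [e h]] := poly_boundedM hp IH; exists c, e => n; rewrite expnS; exact: h.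
Qed.

Lemma leq_expn2 a b k : a <= b -> a ^ k <= b ^ k.
Proof. by move=> le; elim: k => // k IH; rewrite !expnS leq_mul. Qed.

(** For a queue of length [B] over [g] letters the decider needs at most
    [K * ((B + 1) * g ^ (2 * B))] steps, and each factor is below a power of 2 whose exponent is
    linear in the input. A nonempty [pre] guarantees [B > 0] and [g > 0]. *)
Lemma aqm_DEXPTIME (M : aqm) (Sigma : finType) (h : Sigma -> aq_sym M)
    (pre post : seq (aq_sym M)) (q0 : aq_state M) (L : language Sigma) :
  0 < size pre -> (forall w, L w <-> accepts q0 (queue h pre post w)) -> DEXPTIME L.
Proof.
move=> pre0 HL; pose c0 := size pre + size post; pose g := #|aq_sym M|.
have g0 : 0 < g by case: (pre) pre0 => // x *; apply/card_gt0P; exists x.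
pose K := 1000 * (g + 1) * (g + 1) * (#|aq_state M| + 1).
exists (fun n => K + ((c0 + n) + g * ((c0 + n) + (c0 + n)))).
  apply: poly_boundedD; first exact: poly_bounded_const.
  have l : poly_bounded (fun n => c0 + n).
    by apply: poly_boundedD; [exact: poly_bounded_const | exact: poly_bounded_id].
  by apply: poly_boundedD => //; apply: poly_boundedM; [exact: poly_bounded_const | exact: poly_boundedD].
apply: (stack_decides (c := decider h pre post) (i := @inS M Sigma)
   (pa := fun o => if o is Some (inr c) then q0 \in c else false)).
  by move=> a b [].
move=> w; have sz : size (queue h pre post w) = c0 + size w.
  by rewrite /queue !size_cat size_map /c0; lia.
have [|t lt E] := @ex_decider M Sigma h pre post g0 w _; first by rewrite sz /c0; lia.
eexists; exists t; split; [exact: E | | by rewrite HL /=; apply: cellP].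
apply: leq_ltn_trans lt _; rewrite sz -/g.
set B := c0 + size w; set x := g ^ B; have x0 : 0 < x by rewrite expn_gt0 g0.
apply: (@leq_trans (K * ((B + 1) * (x * x)))).
  by rewrite expnS -/x /K; nia.
rewrite (expnD 2 K); apply: leq_mul; first exact/ltnW/ltn_expl.
rewrite (expnD 2 B).
apply: leq_mul; first by rewrite addn1 ltn_expl.
have le : x <= 2 ^ (g * B) by rewrite expnM; apply: leq_expn2; exact/ltnW/ltn_expl.
by rewrite mulnDr expnD leq_mul.
Qed.

End QueueMachines.

(** * Alternating automata with several heads, run on a queue *)

Module HeadMachines.
Import StackPrograms QueueMachines.

(* An alternating automaton with finitely many heads on a word of constant length.
   Position 0 carries an immutable start mark (read as [None]) and position p.+1 the
   p-th cell. In a move, head i goes to the position of head (mv i).1, plus one if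
   (mv i).2, and the head [hw] may overwrite its cell. *)
Record hmach := HM {
  hq : finType;
  hC : finType;
  hI : finType;
  hw : hI;
  hdelta : hq -> {ffun hI -> option hC * {ffun hI -> bool}} ->
           seq (seq (hq * (option hC * {ffun hI -> hI * bool})))
}.

Section HeadMachine.
Variable M : hmach.
Local Notation I := (hI M).
Local Notation C := (hC M).
Definition letter_t : finType := (option C * {ffun I -> bool})%type.
Definition act_t : finType := (option C * {ffun I -> I * bool})%type.
Definition view_t : finType := {ffun I -> letter_t}.

Definition rdc (cells : seq C) (p : nat) : option C := nth None (None :: map Some cells) p.
Definition hletter (cells : seq C) (pos : I -> nat) (p : nat) : letter_t :=
  (rdc cells p, [ffun j => pos j == p]).
Definition view (cells : seq C) (pos : I -> nat) : view_t :=
  [ffun i => hletter cells pos (pos i)].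
Definition hmove (mv : {ffun I -> I * bool}) (pos : I -> nat) (i : I) : nat :=
  pos (mv i).1 + (mv i).2.
Definition hwrite (wr : option C) (cells : seq C) (p : nat) : seq C :=
  if (wr, p) is (Some c, p'.+1) then set_nth c cells p' c else cells.

(** An option counts only if none of its branches moves a head off the word. *)
Inductive hacc : hq M -> seq C -> (I -> nat) -> Prop :=
| Hacc q cells pos o : o \in hdelta q (view cells pos) ->
    (forall q' wr mv, (q', (wr, mv)) \in o -> forall i, hmove mv pos i <= size cells) ->
    (forall q' wr mv, (q', (wr, mv)) \in o ->
       hacc q' (hwrite wr cells (pos (hw M))) (hmove mv pos)) ->
    hacc q cells pos.

Definition vok (v : view_t) (l : letter_t) : bool := [forall i, l.2 i ==> (v i == l)].
Definition newletter (a : act_t) (prev : {ffun I -> bool}) (l : letter_t) : letter_t :=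
  (omap (fun c => if l.2 (hw M) then odflt c a.1 else c) l.1,
   [ffun i => if (a.2 i).2 then prev (a.2 i).1 else l.2 (a.2 i).1]).
Definition pending (a : act_t) (prev : {ffun I -> bool}) : bool :=
  [exists i, (a.2 i).2 && prev (a.2 i).1].

(** A round is one full turn of the queue. [qSt] begins it at the start mark; [qVf v] compares the
    guessed view [v] with all letters that pass by; [qRn q a prev] rewrites them by the action [a].
    Here [prev] is the set of heads on the preceding cell, from which heads moving right arrive. *)
Definition qstate : finType := (hq M + view_t + (hq M * act_t * {ffun I -> bool}))%type.
Definition qSt (q : hq M) : qstate := inl (inl q).
Definition qVf (v : view_t) : qstate := inl (inr v).
Definition qRn (q : hq M) (a : act_t) (prev : {ffun I -> bool}) : qstate := inr (q, a, prev).

(** The letters under the heads lie anywhere in the queue, so the view is guessed at the start mark;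
    one universal branch verifies it, the others carry out the actions of an option that is
    available under the guess. *)
Definition choices (q : hq M) (l : letter_t) : seq (seq (qstate * letter_t)) :=
  flatten [seq [seq (qVf v, l) ::
                  [seq (qRn p.1 p.2 l.2, newletter p.2 [ffun=> false] l) | p <- o]
               | o <- hdelta q v] | v <- [seq v <- enum view_t | vok v l]].

Definition qdelta (s : qstate) (l : letter_t) : seq (seq (qstate * letter_t)) :=
  match s with
  | inl (inl q) => choices q l
  | inl (inr v) => if l.1 is None then [:: [::]]
                   else if vok v l then [:: [:: (qVf v, l)]] else [::]
  | inr (q, a, prev) =>
      if l.1 is None then if pending a prev then [::] else choices q l
      else [:: [:: (qRn q a l.2, newletter a prev l)]]
  end.

Definition aqm_of : aqm := AQM qdelta.

Definition hword (cells : seq C) (pos : I -> nat) : seq letter_t :=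
  [seq hletter cells pos p | p <- iota 0 (size cells).+1].

Local Notation acc := (@accepts aqm_of).
Definition isc (l : letter_t) : bool := l.1 != None.

Lemma acc_verify v ls m r : all isc ls ->
  acc (qVf v) (ls ++ (None, m) :: r) <-> all (vok v) ls.
Proof.
elim: ls r => [|l ls IH] r /=.
  by move=> _; split=> // _; apply: (@Accepts aqm_of _ _ _ [::]); rewrite ?inE.
case: l => -[c|] mk // /IH {}IH; split.
  move=> A; inversion A as [q y u o oin H e1 [e2 e3]]; subst.
  move: oin; rewrite /= ; case: ifP => //= vk; rewrite inE => /eqP oe.
  have := H (qVf v) (Some c, mk); rewrite oe inE eqxx => /(_ isT).
  by rewrite rcons_cat /= => /IH ->.
case/andP=> vk al; apply: (@Accepts aqm_of _ _ _ [:: (qVf v, (Some c, mk))]).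
  by rewrite /= vk inE.
by move=> q' x; rewrite inE => /eqP [-> ->]; rewrite rcons_cat /=; apply/IH.
Qed.

Fixpoint newl (a : act_t) (prev : {ffun I -> bool}) (ls : seq letter_t) : seq letter_t :=
  if ls is l :: ls' then newletter a prev l :: newl a l.2 ls' else [::].

Lemma acc_run q a prev ls r : all isc ls ->
  acc (qRn q a (last prev (map snd ls))) (r ++ newl a prev ls) ->
  acc (qRn q a prev) (ls ++ r).
Proof.
elim: ls prev r => [|l ls IH] prev r /=; first by rewrite cats0.
case: l => -[c|] mk // al A.
apply: (@Accepts aqm_of _ _ _ [:: (qRn q a mk, newletter a prev (Some c, mk))]).
  by rewrite inE.
move=> q' x; rewrite inE => /eqP [-> ->]; rewrite rcons_cat; apply: IH => //.
by rewrite cat_rcons.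
Qed.

Lemma acc_boundary q a prev m r : ~~ pending a prev ->
  acc (qSt q) ((None, m) :: r) -> acc (qRn q a prev) ((None, m) :: r).
Proof.
move=> np A; inversion A as [q1 y u o oin H e1 [e2 e3]]; subst.
by apply: (@Accepts aqm_of _ _ _ o) => //=; rewrite (negPf np).
Qed.

Lemma map_iota_shift T (f : nat -> T) m n :
  [seq f p | p <- iota m.+1 n] = [seq f p.+1 | p <- iota m n].
Proof. by rewrite -[m.+1]add1n iotaDl -map_comp. Qed.

Lemma hword_cons cells pos : hword cells pos =
  (None, [ffun j => pos j == 0]) ::
  [seq hletter cells pos p.+1 | p <- iota 0 (size cells)].
Proof. by rewrite /hword /= map_iota_shift. Qed.

Lemma isc_tail cells pos :
  all isc [seq hletter cells pos p.+1 | p <- iota 0 (size cells)].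
Proof.
apply/allP => l /mapP[p]; rewrite mem_iota /= => lt ->.
rewrite /isc /hletter /rdc /=; case: cells lt => // c cells lt.
by rewrite (nth_map c).
Qed.

Lemma newl_iota a cells pos k m :
  newl a [ffun j => pos j == k] [seq hletter cells pos p.+1 | p <- iota k m] =
  [seq newletter a [ffun j => pos j == p] (hletter cells pos p.+1) | p <- iota k m].
Proof. by elim: m k => //= m IH k; rewrite IH. Qed.

Lemma size_hwrite wr cells p : p <= size cells -> size (hwrite wr cells p) = size cells.
Proof.
by case: wr p => [c|] [|p] //= lt; rewrite size_set_nth; apply/maxn_idPr.
Qed.

Lemma rdc_hwrite wr cells p k : p <= size cells ->
  rdc (hwrite wr cells p) k = omap (fun c => if p == k then odflt c wr else c) (rdc cells k).
Proof.
case: wr p => [c|] [|p] lt; rewrite /rdc /hwrite; case: k => [|k] //=.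
- by case: nth.
- rewrite eqSS.
  have [ltk|gek] := ltnP k (size cells); last first.
    rewrite !nth_default ?size_map // size_set_nth.
    by rewrite geq_max gek (leq_trans lt gek).
  rewrite (nth_map c) ?size_set_nth ?leq_max ?ltk ?orbT // nth_set_nth /= (nth_map c) //=.
  by rewrite eq_sym; case: eqP => // ->.
- by case: nth.
by case: nth => // x /=; case: ifP.
Qed.

Lemma hword_next wr mv cells pos :
  (forall i, pos i <= size cells) -> (forall i, hmove mv pos i <= size cells) ->
  hword (hwrite wr cells (pos (hw M))) (hmove mv pos) =
  newletter (wr, mv) [ffun=> false] (hletter cells pos 0) ::
  newl (wr, mv) [ffun j => pos j == 0] [seq hletter cells pos p.+1 | p <- iota 0 (size cells)].
Proof.
move=> hp hm; rewrite hword_cons newl_iota size_hwrite //; congr (_ :: _).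
  rewrite /newletter /=; congr pair; apply/ffunP => j; rewrite !ffunE /hmove.
  by case: (mv j) => l [] /=; rewrite ?addn1 ?addn0.
apply: eq_map => p; rewrite /hletter /newletter /=; congr pair.
  by rewrite rdc_hwrite // ffunE.
apply/ffunP => j; rewrite !ffunE /hmove.
by case: (mv j) => l [] /=; rewrite ?addn1 ?addn0.
Qed.

Lemma last_marks cells pos m :
  last [ffun j => pos j == 0] (map snd [seq hletter cells pos p.+1 | p <- iota 0 m])
  = [ffun j : I => pos j == m].
Proof.
rewrite -map_comp; case: m => [//|m]; rewrite -[m.+1]addn1 iotaD map_cat last_cat /=.
by rewrite addn1.
Qed.

(** A move advances by at most one cell, so a head leaves the word only by going right from the last
    position. This is detected when the start mark comes round again. *)
Lemma pendingP a (cells : seq C) pos : (forall i, pos i <= size cells) ->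
  reflect (forall i, hmove a.2 pos i <= size cells)
    (~~ pending a [ffun j => pos j == size cells]).
Proof.
move=> hp; rewrite negb_exists; apply: (iffP forallP) => h i; have := h i; rewrite /hmove ffunE.
  by have := hp (a.2 i).1; case: (a.2 i).2 => /=; lia.
by case: (a.2 i).2 => //=; lia.
Qed.

Lemma vok_view cells pos p : vok (view cells pos) (hletter cells pos p).
Proof.
apply/forallP => i; rewrite /= ffunE; apply/implyP => /eqP e.
by rewrite ffunE e.
Qed.

Lemma hacc_acc q cells pos : hacc q cells pos -> (forall i, pos i <= size cells) ->
  acc (qSt q) (hword cells pos).
Proof.
elim=> {q cells pos} q cells pos o oin hm _ IH hp; rewrite hword_cons.
set l0 := (None, _); set ls := map _ _.
apply: (@Accepts aqm_of _ _ _ ((qVf (view cells pos), l0) ::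
   [seq (qRn p.1 p.2 l0.2, newletter p.2 [ffun=> false] l0) | p <- o])).
  apply/flattenP; exists [seq (qVf (view cells pos), l0) ::
     [seq (qRn p.1 p.2 l0.2, newletter p.2 [ffun=> false] l0) | p <- o']
     | o' <- hdelta q (view cells pos)]; last exact: map_f oin.
  apply/mapP; exists (view cells pos) => //.
  by rewrite mem_filter mem_enum andbT; apply: (vok_view cells pos 0).
move=> q' x; rewrite inE => /orP[/eqP[-> ->]|].
  rewrite -cats1; apply/acc_verify; first exact: isc_tail.
  by apply/allP => l /mapP[p _ ->]; apply: vok_view.
case/mapP => -[q2 [wr mv]] oin2 [-> ->] /=.
rewrite -cats1; apply: acc_run; first exact: isc_tail.
rewrite last_marks; apply: acc_boundary.
  by apply/pendingP => //; apply: hm oin2.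
have := IH _ _ _ oin2; rewrite hword_next //; last exact: hm oin2.
apply=> i; rewrite size_hwrite //; exact: hm oin2 i.
Qed.

(** The verifying branch has to accept as well, and by [acc_verify] this identifies the guess with
    the actual view. *)
Lemma choices_hacc q cells pos o : (forall i, pos i <= size cells) ->
  o \in choices q (hletter cells pos 0) ->
  (forall q' x, (q', x) \in o ->
     acc q' (rcons [seq hletter cells pos p.+1 | p <- iota 0 (size cells)] x)) ->
  exists2 o', o' \in hdelta q (view cells pos) &
    forall p, p \in o' -> (qRn p.1 p.2 [ffun j => pos j == 0],
      newletter p.2 [ffun=> false] (hletter cells pos 0)) \in o.
Proof.
move=> hp /flattenP[os /mapP[v]]; rewrite mem_filter => /andP[v0 _] -> /mapP[o' o'in oe] H.
suff -> : view cells pos = v.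
  exists o' => // p pin; rewrite oe inE; apply/orP; right.
  by apply/mapP; exists p.
have := H (qVf v) (hletter cells pos 0); rewrite oe inE eqxx => /(_ isT).
rewrite -cats1 => /acc_verify - /(_ (isc_tail _ _)) /allP av.
apply/ffunP => i; rewrite ffunE; case e : (pos i) => [|p].
  by have /forallP/(_ i) := v0; rewrite /= ffunE e /= => /eqP.
have lt : p < size cells by rewrite -e.
have := av _ (map_f (fun p => hletter cells pos p.+1) (_ : p \in iota 0 (size cells))).
rewrite mem_iota lt => /(_ isT) /forallP /(_ i); rewrite /= ffunE e eqxx /=.
by move/eqP.
Qed.

(** The invariant for the induction on acceptance, which passes through words in the middle of a
    turn: [ls] is still to be rewritten, and once it is, the word read from the start mark has to be
    that of an accepted configuration. *)
Definition run_spec (s : qstate) (u : seq letter_t) : Prop :=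
  match s with
  | inl (inl q) => forall cells pos, (forall i, pos i <= size cells) ->
      u = hword cells pos -> hacc q cells pos
  | inl (inr v) => True
  | inr (q, a, prev) => forall ls m r, u = ls ++ (None, m) :: r -> all isc ls ->
      ~~ pending a (last prev (map snd ls)) /\
      forall cells pos, (forall i, pos i <= size cells) ->
        ((None, m) :: r) ++ newl a prev ls = hword cells pos -> hacc q cells pos
  end.

Lemma acc_spec s u : acc s u -> run_spec s u.
Proof.
elim=> {s u} s y u o oin A IH.
have step q cells pos : (forall i, pos i <= size cells) -> y :: u = hword cells pos ->
    o \in choices q y -> hacc q cells pos.
  move=> hp; rewrite hword_cons => -[ey eu] oin'; subst y u.
  have [o' o'in Ho] := choices_hacc hp oin' A.
  have hm q' wr mv : (q', (wr, mv)) \in o' -> forall i, hmove mv pos i <= size cells.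
    move=> pin; have := IH _ _ (Ho _ pin); rewrite -cats1 /=.
    case/(_ _ _ _ erefl (isc_tail _ _)); rewrite last_marks => np _.
    exact/(@pendingP (wr, mv)).
  apply: (Hacc o'in hm) => q' wr mv pin.
  have := IH _ _ (Ho _ pin); rewrite -cats1 /=.
  case/(_ _ _ _ erefl (isc_tail _ _)) => _; apply.
    by move=> i; rewrite size_hwrite //; apply: (hm _ _ _ pin).
  by rewrite hword_next //; apply: hm pin.
case: s oin => [[q|v]|[[q a] prev]] //= oin.
  by move=> cells pos hp e; apply: step e oin.
case=> [|l ls] m r /=.
  case=> ey eu _; subst y u; move: oin; rewrite /=; case: ifP => // np oin; split=> //.
  by move=> cells pos hp; rewrite cats0 => e; apply: step e oin.
case=> ey eu; subst y u; case: l oin step A IH => -[c|] mk //= oin _ A IH al.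
move: oin; rewrite inE => /eqP oe; subst o.
have := IH _ _ (mem_head _ _) ls m (rcons r (newletter a prev (Some c, mk))).
rewrite rcons_cat /= => /(_ erefl al) [np H]; split=> // cells pos hp e.
by apply: H => //; rewrite cat_rcons.
Qed.

Lemma hacc_accepts q cells pos : (forall i, pos i <= size cells) ->
  hacc q cells pos <-> acc (qSt q) (hword cells pos).
Proof.
move=> hp; split=> [h|/acc_spec]; first exact: hacc_acc.
exact.
Qed.

End HeadMachine.

End HeadMachines.

(** * An exponential time machine simulated in alternating linear space *)

Module Simulation.
Import ssralg ssrnum ssrint.
Import StackPrograms QueueMachines HeadMachines.

Section HaccRules.
Variable M : hmach.

Lemma haccE (q : hq M) cells pos : hacc q cells pos <->
  exists2 o, o \in hdelta q (view cells pos) &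
    forall q' wr mv, (q', (wr, mv)) \in o ->
      (forall i, hmove mv pos i <= size cells) /\
      hacc q' (hwrite wr cells (pos (hw M))) (hmove mv pos).
Proof.
split=> [[{}q {}cells {}pos o oin h1 h2]|[o oin h]].
  by exists o => // q' wr mv qin; split; [apply: h1 qin | apply: h2].
by apply: (Hacc oin) => q' wr mv /h[].
Qed.

Lemma hacc_det (q q' : hq M) cells pos wr mv :
  hdelta q (view cells pos) = [:: [:: (q', (wr, mv))]] ->
  (forall i, hmove mv pos i <= size cells) ->
  hacc q cells pos <-> hacc q' (hwrite wr cells (pos (hw M))) (hmove mv pos).
Proof.
move=> e r; rewrite haccE e; split=> [[o]|h].
  by rewrite inE => /eqP-> /(_ _ _ _ (mem_head _ _)) [].
exists [:: (q', (wr, mv))]; first exact: mem_head.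
by move=> q2 wr2 mv2; rewrite inE => /eqP[-> -> ->].
Qed.

Lemma hacc_true (q : hq M) cells pos :
  hdelta q (view cells pos) = [:: [::]] -> hacc q cells pos.
Proof. by move=> e; apply/haccE; rewrite e; exists [::]; rewrite ?inE. Qed.

Lemma hacc_false (q : hq M) cells pos :
  hdelta q (view cells pos) = [::] -> ~ hacc q cells pos.
Proof. by move=> e /haccE; rewrite e => -[]. Qed.

Lemma hacc_if (q : hq M) cells pos (b : bool) :
  hdelta q (view cells pos) = (if b then [:: [::]] else [::]) ->
  hacc q cells pos <-> b.
Proof.
case: b => e; first by split=> // _; exact: hacc_true.
by split=> // /(hacc_false e).
Qed.
End HaccRules.

Section Tapes.
Variable S : Type.
(** Cells are addressed relative to the head: a claim about the next time refers to the present one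
    with the offset changed by the move of the head, and absolute positions never occur. *)
Definition tget (t : tape S) (z : int) : option S :=
  match z with Posz n => nth None (tcur t :: tright t) n | Negz n => nth None (tleft t) n end.
Definition mz (m : move) : int := match m with MoveL => (-1)%R | MoveN => 0%R | MoveR => 1%R end.

Lemma tget_write s m t z : tget (write_move (s, m) t) z =
  if (z + mz m == 0)%R then s else tget t (z + mz m)%R.
Proof.
case: t => l c r; case: m; rewrite /mz /=.
- case: z => [[|[|n]]|n] //.
  have -> : (Negz n + -1)%R = Negz n.+1 by lia.
  by rewrite /=; case: l => //; case: n.
- rewrite GRing.addr0; case: z => [[|n]|n] //.
- case: z => [n|[|n]].
  + have -> : (Posz n + 1)%R = Posz n.+1 by lia.
    by rewrite /=; case: n => [|n] /=; case: r => //=; case: n.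
  + by [].
  + have -> : (Negz n.+1 + 1)%R = Negz n by lia.
    by [].
Qed.
End Tapes.

Section Simulation.
Variable N : TM.
Local Notation S := (tape_sym N).
Local Notation T := 'I_(extra_tapes N).+1.
Definition kst : finType := (state N * {ffun T -> option S})%type.
(** A bit of the time and a bit of the offset, least significant cell first, and possibly a letter
    of the input. *)
Definition dcell : finType := (bool * bool * option S)%type.
(** The claim to be made after a sweep: about the control, or about a cell, given by its tape, the
    symbol claimed and the symbol that the step writes, [None] if the machine has halted. *)
Definition cont : finType := (kst + T * option S * option (option S))%type.
(** [None] resets the offset to 0. Otherwise a carry is added to it: 1 for [Some true], -1 for
    [Some false], 0 for the inner [None]. *)
Definition jmode : finType := option (option bool).

(** The states are claims about the time [t] and the offset [z] stored in the cells. [FH k]: control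
    state and scanned symbols are [k]. [FC (x, a)]: tape [x] has [a] at offset [z]. [FU] is the
    sweep that passes to time [t - 1]; [FZ] checks that [t] is 0, and [FL] then looks up the
    input. *)
Definition fq : finType :=
  (unit + kst + (T * option S) + (bool * jmode * bool * cont) + (kst + T * option S)
   + (option S * bool * option S))%type.
Notation FI := (inl (inl (inl (inl (inl tt))))).
Notation FH k := (inl (inl (inl (inl (inr k))))).
Notation FC x := (inl (inl (inl (inr x)))).
Notation FU x := (inl (inl (inr x))).
Notation FZ x := (inl (inr x)).
Notation FL x := (inr x).

Definition stay : {ffun bool -> bool * bool} := [ffun i => (i, false)].
Definition right : {ffun bool -> bool * bool} := [ffun i => (i, i)].
Definition back : {ffun bool -> bool * bool} := [ffun=> (false, false)].

Definition next_state (k : kst) : state N :=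
  if halting k.1 then k.1 else (delta k.1 k.2).1.
Definition jcode (m : move) : option bool :=
  match m with MoveL => Some false | MoveN => None | MoveR => Some true end.
Definition jmove (k : kst) (x : T) : option bool :=
  if halting k.1 then None else jcode ((delta k.1 k.2).2 x).2.
Definition written (k : kst) (x : T) : option (option S) :=
  if halting k.1 then None else Some ((delta k.1 k.2).2 x).1.

Definition jadd (jc : option bool) (b : bool) : bool * option bool :=
  match jc with
  | None => (b, None)
  | Some true => (~~ b, if b then Some true else None)
  | Some false => (~~ b, if b then None else Some false)
  end.
Definition jstep (jm : jmode) (b : bool) : bool * jmode :=
  if jm is Some jc then let: (b', jc') := jadd jc b in (b', Some jc') else (false, None).
Definition ustep (bt : bool) (jm : jmode) (d : dcell) : dcell :=
  (d.1.1 (+) bt, (jstep jm d.1.2).1, d.2).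
Definition lstep (b : bool) (f : option S) (d : dcell) : dcell :=
  (d.1.1, d.1.2 (+) b, if f is None then None else d.2).

Definition go (q : fq) (wr : option (option dcell)) (mv : {ffun bool -> bool * bool}) :
  fq * (option (option dcell) * {ffun bool -> bool * bool}) := (q, (wr, mv)).

(** Only head [true] works; head [false] marks the place to return to. In [FU], [bt] is the borrow
    of the time and [z] records that all new offset bits are 0; if they are, the claimed symbol must
    be the one just written. A sweep of [FL] lowers the offset by 1 and erases the first letter left
    of the input, until the offset is 0 or no letter is left. *)
Definition fdelta (q : fq) (v : {ffun bool -> option (option dcell) * {ffun bool -> bool}}) :
    seq (seq (fq * (option (option dcell) * {ffun bool -> bool * bool}))) :=
  match q with
  | FI => [seq [:: go (FH k) None stay] | k <- [seq k <- enum kst | accepting k.1]]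
  | FH k => [:: go (FZ (inl k)) None stay] ::
      [seq go (FU (true, Some None, true, inl k0)) None stay ::
           [seq go (FU (true, Some (jmove k0 x), true, inr (x, k.2 x, written k0 x))) None stay
           | x <- enum T] | k0 <- [seq k0 <- enum kst | next_state k0 == k.1]]
  | FC x => [:: go (FZ (inr x)) None stay] ::
      [seq [:: go (FU (true, None, true, inl k0)) None stay;
               go (FU (true, Some (jmove k0 x.1), true, inr (x, written k0 x.1))) None stay]
      | k0 <- enum kst]
  | FU (bt, jm, z, ct) =>
      match (v true).1 with
      | None => [:: [:: go q None right]]
      | Some (Some d) =>
          [:: [:: go (FU (bt && ~~ d.1.1, (jstep jm d.1.2).2, z && ~~ (jstep jm d.1.2).1, ct))
                     (Some (Some (ustep bt jm d))) right]]
      | Some None =>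
          if bt then [::] else
          match ct with
          | inl k => [:: [:: go (FH k) None back]]
          | inr (x, os) =>
              if (if os is Some s then z else false)
              then if os == Some x.2 then [:: [::]] else [::]
              else [:: [:: go (FC x) None back]]
          end
      end
  | FZ x =>
      match (v true).1 with
      | None => [:: [:: go q None right]]
      | Some (Some d) => if d.1.1 then [::] else [:: [:: go q None right]]
      | Some None =>
          match x with
          | inl k => if (k.1 == start N) && [forall x, (x != ord0) ==> (k.2 x == None)]
                     then [:: [:: go (FL (k.2 ord0, true, None)) None back]] else [::]
          | inr (x, a) => if x == ord0 then [:: [:: go (FL (a, true, None)) None back]]
                          else if a == None then [:: [::]] else [::]
          end
      end
  | FL (a, b, f) =>
      match (v true).1 with
      | None => [:: [:: go q None right]]
      | Some (Some d) =>
          [:: [:: go (FL (a, b && ~~ d.1.2, if f is None then d.2 else f))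
                     (Some (Some (lstep b f d))) right]]
      | Some None =>
          if b || (f == None) then if a == f then [:: [::]] else [::]
          else [:: [:: go (FL (a, true, None)) None back]]
      end
  end.

Definition sim_mach : hmach := @HM fq (option dcell) bool true fdelta.
Local Notation acc := (@hacc sim_mach).
Definition cellsof (cs : seq dcell) : seq (option dcell) := map Some cs ++ [:: None].
Definition P (p : nat) (i : bool) : nat := if i then p else 0.

Lemma mv_right p : hmove (M := sim_mach) right (P p) = P p.+1.
Proof. by apply: functional_extensionality => -[]; rewrite /hmove ffunE //= addn1. Qed.
Lemma mv_stay p : hmove (M := sim_mach) stay (P p) = P p.
Proof. by apply: functional_extensionality => -[]; rewrite /hmove ffunE //= addn0. Qed.
Lemma mv_back p : hmove (M := sim_mach) back (P p) = P 0.
Proof. by apply: functional_extensionality => -[]; rewrite /hmove ffunE. Qed.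
Lemma P_le p n : p <= n -> forall i, P p i <= n.
Proof. by move=> le []. Qed.

Lemma size_cellsof cs : size (cellsof cs) = (size cs).+1.
Proof. by rewrite size_cat size_map addn1. Qed.

Lemma read0 cs : ((view (M := sim_mach) (cellsof cs) (P 0)) true).1 = None.
Proof. by rewrite ffunE. Qed.
Lemma read_mid ds d cs :
  ((view (M := sim_mach) (cellsof (ds ++ d :: cs)) (P (size ds).+1)) true).1 = Some (Some d).
Proof.
rewrite ffunE /= /rdc /= /cellsof !map_cat -map_comp /= -!catA nth_cat !size_map ltnn subnn.
by [].
Qed.
Lemma read_end ds :
  ((view (M := sim_mach) (cellsof ds) (P (size ds).+1)) true).1 = Some None.
Proof.
by rewrite ffunE /= /rdc /= /cellsof !map_cat nth_cat !size_map ltnn subnn.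
Qed.
Lemma write_mid ds d cs d' :
  hwrite (M := sim_mach) (Some (Some d')) (cellsof (ds ++ d :: cs)) (size ds).+1 =
  cellsof (ds ++ d' :: cs).
Proof.
rewrite /hwrite /cellsof !map_cat -!catA /=.
by elim: ds => //= c ds ->.
Qed.

Fixpoint urun (bt : bool) (jm : jmode) (cs : seq dcell) : seq dcell * bool * jmode * bool :=
  if cs is d :: cs' then
    let: (r, bt', jm', z) := urun (bt && ~~ d.1.1) (jstep jm d.1.2).2 cs' in
    (ustep bt jm d :: r, bt', jm', ~~ (jstep jm d.1.2).1 && z)
  else ([::], bt, jm, true).

Definition tval (cs : seq dcell) : nat := foldr (fun (d : dcell) n => d.1.1 + 2 * n) 0 cs.
Definition jval (cs : seq dcell) : nat := foldr (fun (d : dcell) n => d.1.2 + 2 * n) 0 cs.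
Definition rest (cs : seq dcell) : seq S := pmap snd cs.
Definition cz (jc : option bool) : int :=
  match jc with None => 0%R | Some true => 1%R | Some false => (-1)%R end.


Lemma step_start q cs :
  fdelta q (view (M := sim_mach) (cellsof cs) (P 0)) = [:: [:: go q None right]] ->
  acc q (cellsof cs) (P 0) <-> acc q (cellsof cs) (P 1).
Proof.
move=> e; rewrite (@hacc_det sim_mach _ _ _ _ _ _ e) mv_right //.
by apply: P_le; rewrite size_cellsof.
Qed.

Lemma step_back q q' cs :
  fdelta q (view (M := sim_mach) (cellsof cs) (P (size cs).+1)) = [:: [:: go q' None back]] ->
  acc q (cellsof cs) (P (size cs).+1) <-> acc q' (cellsof cs) (P 0).
Proof.
by move=> e; rewrite (@hacc_det sim_mach _ _ _ _ _ _ e) mv_back //; apply: P_le.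
Qed.

Lemma fu_run bt jm z ct ds cs : let: (cs', bt', jm', z') := urun bt jm cs in
  acc (FU (bt, jm, z, ct)) (cellsof (ds ++ cs)) (P (size ds).+1) <->
  acc (FU (bt', jm', z && z', ct)) (cellsof (ds ++ cs')) (P (size (ds ++ cs')).+1).
Proof.
elim: cs bt jm z ds => [|d cs IH] bt jm z ds /=; first by rewrite cats0 andbT.
have := IH (bt && ~~ d.1.1) (jstep jm d.1.2).2 (z && ~~ (jstep jm d.1.2).1)
  (rcons ds (ustep bt jm d)).
case: (urun _ _ cs) => [[[r bt'] jm'] z'].
rewrite !cat_rcons size_rcons -!andbA => <-.
rewrite (@hacc_det sim_mach _ _ _ _ _ _ (_ : fdelta _ _ = [:: [:: go _ _ right]])); last first.
- by move=> ?; rewrite mv_right; apply: P_le; rewrite size_cellsof size_cat /= addnS ltnS leq_addr.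
- by rewrite /fdelta read_mid.
by rewrite mv_right write_mid.
Qed.

Lemma urun_size bt jm cs : size (urun bt jm cs).1.1.1 = size cs.
Proof.
elim: cs bt jm => //= d cs IH bt jm.
by have := IH (bt && ~~ d.1.1) (jstep jm d.1.2).2; case: urun => [[[r ?] ?] ?] /= ->.
Qed.
Lemma urun_rest bt jm cs : rest (urun bt jm cs).1.1.1 = rest cs.
Proof.
elim: cs bt jm => //= d cs IH bt jm.
have := IH (bt && ~~ d.1.1) (jstep jm d.1.2).2; case: urun => [[[r ?] ?] ?] /= e.
by rewrite /rest /= /oapp; case: d.2 => [?|]; rewrite -/(rest _) e.
Qed.
Lemma urun_tval bt jm cs :
  tval (urun bt jm cs).1.1.1 + bt = tval cs + (urun bt jm cs).1.1.2 * 2 ^ size cs.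
Proof.
elim: cs bt jm => [|d cs IH] bt jm; first by rewrite /= muln1.
rewrite [urun bt jm (d :: cs)]/=; have := IH (bt && ~~ d.1.1) (jstep jm d.1.2).2.
case: urun => [[[r b'] ?] ?] /=; rewrite expnS mulnCA.
by case: d.1.1; case: bt => /=; lia.
Qed.
(** All that is lost is the signed carry out of the last bit: the offset is kept modulo
    [2 ^ size cs]. *)
Lemma urun_jval bt jc cs : exists2 jc', (urun bt (Some jc) cs).1.2 = Some jc' &
  (Posz (jval (urun bt (Some jc) cs).1.1.1) + Posz (2 ^ size cs)%N * cz jc' = Posz (jval cs) + cz jc)%R.
Proof.
elim: cs bt jc => [|d cs IH] bt jc; first by exists jc; rewrite //= expn0; lia.
rewrite [urun bt _ (d :: cs)]/=.
have -> : (jstep (Some jc) d.1.2).2 = Some (jadd jc d.1.2).2 by rewrite /=; case: jadd.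
have -> : (jstep (Some jc) d.1.2).1 = (jadd jc d.1.2).1 by rewrite /=; case: jadd.
have [jc'] := IH (bt && ~~ d.1.1) (jadd jc d.1.2).2.
case: urun => [[[r b'] jm'] z] /= -> e; exists jc' => //.
rewrite /= expnS; move: e; rewrite /ustep /=.
have -> : (jstep (Some jc) d.1.2).1 = (jadd jc d.1.2).1 by rewrite /=; case: jadd.
move: (2 ^ size cs)%N (jval r) (jval cs) => k x y.
by case: jc => [[]|]; case: d.1.2 => /=; case: jc' => [[]|] /=; lia.
Qed.
Lemma urun_reset bt cs : jval (urun bt None cs).1.1.1 = 0.
Proof.
elim: cs bt => //= d cs IH bt.
by have := IH (bt && ~~ d.1.1); case: urun => [[[r b'] jm'] z] /= ->.
Qed.
Lemma urun_zero bt jm cs : (urun bt jm cs).2 = (jval (urun bt jm cs).1.1.1 == 0).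
Proof.
elim: cs bt jm => //= d cs IH bt jm.
have := IH (bt && ~~ d.1.1) (jstep jm d.1.2).2; case: urun => [[[r ?] ?] z] /= ->.
by case: (jstep _ _).1 => //=; lia.
Qed.
Lemma tval_lt cs : tval cs < 2 ^ size cs.
Proof. by elim: cs => //= d cs IH; rewrite expnS; case: d.1.1; lia. Qed.
Lemma jval_lt cs : jval cs < 2 ^ size cs.
Proof. by elim: cs => //= d cs IH; rewrite expnS; case: d.1.2; lia. Qed.

(** The sweep rejects if a borrow is left at the end, which means that the time was already 0. *)
Lemma fu_spec jm ct cs : let cs' := (urun true jm cs).1.1.1 in
  acc (FU (true, jm, true, ct)) (cellsof cs) (P 0) <->
  0 < tval cs /\ match ct with
   | inl k => acc (FH k) (cellsof cs') (P 0)
   | inr (x, os) => if (if os is Some s then jval cs' == 0 else false) then os = Some x.2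
                    else acc (FC x) (cellsof cs') (P 0)
   end.
Proof.
move=> cs'; rewrite step_start; last by rewrite /fdelta read0.
have := fu_run true jm true ct [::] cs; have := urun_tval true jm cs.
have := urun_size true jm cs.
have := urun_zero true jm cs; rewrite /cs'; case: urun => [[[r bt'] jm'] z] /= -> es e ->.
have ebt : bt' = (tval cs == 0).
  by have := tval_lt r; have := tval_lt cs; rewrite es; case: bt' e => /=; lia.
rewrite {}ebt lt0n; case: eqP => [_|_] /=.
  by split=> [h|[]//]; case: (hacc_false (M := sim_mach) _ h); rewrite /= read_end.
case: ct => [k|[x os]].
  rewrite (@step_back _ (FH k)); first by split=> [|[]].
  by rewrite /fdelta read_end.
case: ifP => cz0.
  rewrite (@hacc_if sim_mach _ _ _ (os == Some x.2)); last by rewrite /= read_end cz0.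
  by split=> [/eqP|[_ ->]].
rewrite (@step_back _ (FC x)); first by split=> [|[]].
by rewrite /fdelta read_end cz0.
Qed.

Lemma fz_run x ds cs : acc (FZ x) (cellsof (ds ++ cs)) (P (size ds).+1) <->
  tval cs = 0 /\ acc (FZ x) (cellsof (ds ++ cs)) (P (size (ds ++ cs)).+1).
Proof.
elim: cs ds => [|d cs IH] ds; first by rewrite cats0; split=> [|[]].
have := IH (rcons ds d); rewrite cat_rcons size_rcons => {}IH.
case e : d.1.1.
  split=> [h|[/=]]; last by rewrite e.
  by case: (hacc_false (M := sim_mach) _ h); rewrite /= read_mid e.
rewrite (@hacc_det sim_mach _ (FZ x) _ _ None right).
- by rewrite mv_right /= IH e; split=> -[h1 h2]; split=> //; lia.
- by rewrite /= read_mid e.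
by move=> ?; rewrite mv_right; apply: P_le; rewrite size_cellsof size_cat /= addnS ltnS leq_addr.
Qed.

Lemma fz_spec x cs : acc (FZ x) (cellsof cs) (P 0) <-> tval cs = 0 /\
  match x with
  | inl k => [/\ k.1 = start N, (forall x, x != ord0 -> k.2 x = None)
               & acc (FL (k.2 ord0, true, None)) (cellsof cs) (P 0)]
  | inr (x, a) => if x == ord0 then acc (FL (a, true, None)) (cellsof cs) (P 0)
                  else a = None
  end.
Proof.
rewrite step_start; last by rewrite /fdelta read0.
have -> := fz_run x [::] cs; rewrite /=; split=> -[-> h]; split=> //; move: h.
  case: x => [k|[x a]] /haccE[o]; rewrite /= read_end.
    case: ifP => // /andP[/eqP e /forallP a0]; rewrite inE => /eqP-> /(_ _ _ _ (mem_head _ _))[_].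
    rewrite mv_back; split=> // x nx; apply/eqP.
    by move: (a0 x); rewrite nx.
  case: ifP => _; first by rewrite inE => /eqP-> /(_ _ _ _ (mem_head _ _))[_]; rewrite mv_back.
  by case: eqP.
case: x => [k [e a0 h]|[x a]].
  rewrite (@step_back _ (FL (k.2 ord0, true, None))) //.
  rewrite /fdelta read_end e eqxx /=; case: ifP => // /forallP[] x.
  by apply/implyP => /a0 ->.
case: ifP => [x0 h|x0 ->].
  rewrite (@step_back _ (FL (a, true, None))) //.
  by rewrite /fdelta read_end x0.
by apply: hacc_true; rewrite /= read_end x0.
Qed.

Fixpoint lrun (b : bool) (f : option S) (cs : seq dcell) : seq dcell * bool * option S :=
  if cs is d :: cs' then
    let: (r, b', f') := lrun (b && ~~ d.1.2) (if f is None then d.2 else f) cs' in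
    (lstep b f d :: r, b', f')
  else ([::], b, f).

Lemma fl_run a b f ds cs : let: (cs', b', f') := lrun b f cs in
  acc (FL (a, b, f)) (cellsof (ds ++ cs)) (P (size ds).+1) <->
  acc (FL (a, b', f')) (cellsof (ds ++ cs')) (P (size (ds ++ cs')).+1).
Proof.
elim: cs b f ds => [|d cs IH] b f ds /=; first by rewrite cats0.
have := IH (b && ~~ d.1.2) (if f is None then d.2 else f) (rcons ds (lstep b f d)).
case: (lrun _ _ cs) => [[r b'] f'].
rewrite !cat_rcons size_rcons => <-.
rewrite (@hacc_det sim_mach _ _ _ _ _ _ (_ : fdelta _ _ = [:: [:: go _ _ right]])); last first.
- by move=> ?; rewrite mv_right; apply: P_le; rewrite size_cellsof size_cat /= addnS ltnS leq_addr.
- by rewrite /fdelta read_mid.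
by rewrite mv_right write_mid.
Qed.

Lemma lrun_facts b f cs : let: (cs', b', f') := lrun b f cs in
  [/\ size cs' = size cs, jval cs' + b = jval cs + b' * 2 ^ size cs,
      f' = (if f is None then ohead (rest cs) else f)
    & rest cs' = (if f is None then behead (rest cs) else rest cs)].
Proof.
elim: cs b f => [|d cs IH] b f /=; first by rewrite muln1; case: f.
have := IH (b && ~~ d.1.2) (if f is None then d.2 else f).
case: lrun => [[r b'] f'] [h1 h2 h3 h4]; split=> /=.
- by rewrite h1.
- by rewrite expnS mulnCA; move: h2; case: d.1.2; case: b => /=; lia.
- by rewrite h3; case: f {h3 h4} => //; rewrite /rest /=; case: d.2.
rewrite /rest /= in h4 *; case: f {h3} h4 => [x|] h4 /=.
  by case: d.2 => [y|] /=; rewrite h4.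
by rewrite h4; case: d.2.
Qed.

(** Induction on the number of remaining letters: a sweep uses up one letter and one unit of the
    offset together. *)
Lemma fl_spec a cs : acc (FL (a, true, None)) (cellsof cs) (P 0) <->
  a = nth None (map Some (rest cs)) (jval cs).
Proof.
move n : (size (rest cs)) => n'; elim: n' cs n => [|n IH] cs sz.
all: rewrite step_start; last by rewrite /fdelta read0.
all: have := fl_run a true None [::] cs; have := lrun_facts true None cs.
all: case: lrun => [[r b] f] [h1 h2 h3 h4] /= ->.
  have fN : f = None by rewrite h3; case: (rest cs) sz.
  rewrite (@hacc_if sim_mach _ _ _ (a == f)); last by rewrite /= read_end fN orbT.
  by rewrite fN; case: (rest cs) sz => //= _; rewrite nth_nil; split=> /eqP.
case er : (rest cs) sz h3 h4 => [//|y ys] [sz] /= h3 h4.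
have jl := jval_lt cs; have jl' := jval_lt r; rewrite h1 in jl'.
case ej : (jval cs) => [|j].
  have -> : b = true by case: b h2; rewrite // ej; lia.
  rewrite (@hacc_if sim_mach _ _ _ (a == f)); last by rewrite /= read_end.
  by rewrite h3 /=; split=> /eqP.
have eb : b = false by case: b h2; rewrite // ej; lia.
rewrite (@step_back _ (FL (a, true, None))); last by rewrite /fdelta read_end eb h3.
rewrite IH ?h4 //= (_ : jval r = j) //.
by move: h2; rewrite eb ej /=; lia.
Qed.

Variables (w : seq S) (m : nat).
Definition conf (t : nat) : config N := iter t (@step N) (@init N w).
Definition info (t : nat) : kst := (cstate (conf t), [ffun x => tcur (ctape (conf t) x)]).

Lemma info_next t : (info t.+1).1 = next_state (info t).
Proof.
rewrite /info /conf /= /step /next_state /=; case: ifP => //= _.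
by case: delta.
Qed.

Lemma tget_next t x z : tget (ctape (conf t.+1) x) z =
  if (if written (info t) x is Some s then (z + cz (jmove (info t) x) == 0)%R else false)
  then odflt None (written (info t) x) else tget (ctape (conf t) x) (z + cz (jmove (info t) x))%R.
Proof.
rewrite /conf iterS -/(conf t) /written /jmove /info /step /=; case: ifP => h.
  by rewrite GRing.addr0.
case: delta => q act /=; case e : (act x) => [s mv] /=; rewrite tget_write.
by have -> : mz mv = cz (jcode mv) by case: mv {e}.
Qed.

(* j holds the offset z modulo [2 ^ size cs]. *)
Definition good_cells (t : nat) (z : int) (cs : seq dcell) : Prop :=
  [/\ tval cs = t, Posz (jval cs) = z \/ (Posz (jval cs) = z + Posz (2 ^ size cs)%N)%R,
      rest cs = w, size w <= 2 ^ m & size cs = m.+1 /\ (`|z| + t < 2 ^ m)%N].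

(** The offset changes by at most 1 while the time drops by 1, so [|z| + t < 2 ^ m] is preserved.
    With [m + 1] bits this keeps different offsets apart; in particular the test for offset 0 is
    exact. *)
Lemma good_urun t z cs jc : good_cells t.+1 z cs ->
  good_cells t (z + cz jc)%R (urun true (Some jc) cs).1.1.1 /\
  (jval (urun true (Some jc) cs).1.1.1 == 0) = (z + cz jc == 0)%R.
Proof.
case=> et ej er ew [es ez]; have := urun_tval true (Some jc) cs.
have [jc' _ jv] := urun_jval true jc cs.
have := tval_lt (urun true (Some jc) cs).1.1.1; have := jval_lt (urun true (Some jc) cs).1.1.1.
rewrite urun_size et es expnS; set cs' := (urun _ _ _).1.1.1 in jv *; move: jv ej.
rewrite es expnS => jv ej h1 h2 h3.
have e' : tval cs' = t by case: (urun _ _ _).1.1.2 h3 => /=; lia.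
have ej' : Posz (jval cs') = (z + cz jc)%R \/
   Posz (jval cs') = (z + cz jc + Posz (2 * 2 ^ m)%N)%R.
  move: jv ez h1 ej; move: (jval cs') (jval cs) (2 ^ m)%N; clear => x y K.
  by case: jc' => [[]|] /=; case: jc => [[]|] /=; lia.
have ez' : absz (z + cz jc)%R + t < 2 ^ m by move: ez; case: (jc) => [[]|] /=; lia.
split; last by apply/eqP/eqP; lia.
by split=> //; [rewrite urun_size es expnS | rewrite urun_rest | rewrite urun_size].
Qed.

Lemma good_reset t z cs : good_cells t.+1 z cs ->
  good_cells t 0 (urun true None cs).1.1.1.
Proof.
case=> et ej er ew [es ez]; have := urun_tval true None cs.
have := tval_lt (urun true None cs).1.1.1.
rewrite et urun_size es expnS => h1 h2.
have e' : tval (urun true None cs).1.1.1 = t.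
  by move: h1 h2; move: (tval _) (2 ^ m)%N => x K; case: (urun _ _ _).1.1.2 => /=; lia.
split=> //.
- by left; rewrite urun_reset.
- by rewrite urun_rest.
by rewrite urun_size es; split=> //; lia.
Qed.

(** Both kinds of claims are treated in one induction on the time. The simulated machine is
    deterministic, so its own claim forces the guessed predecessor [k0] to be [info t]. *)
Lemma sim_spec t :
  (forall k cs, good_cells t 0 cs -> acc (FH k) (cellsof cs) (P 0) <-> k = info t) /\
  (forall x a z cs, good_cells t z cs ->
     acc (FC (x, a)) (cellsof cs) (P 0) <-> a = tget (ctape (conf t) x) z).
Proof.
have stayE q (cells : seq (option dcell)) : forall q' wr mv, (q', (wr, mv)) = go q None stay ->
   ((forall i, hmove (M := sim_mach) mv (P 0) i <= size cells) /\
      hacc (M := sim_mach) q' (hwrite (M := sim_mach) wr cells (P 0 true)) (hmove (M := sim_mach) mv (P 0))) <-> acc q cells (P 0).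
  move=> q' wr mv [-> -> ->]; rewrite mv_stay; split=> [[]//|h]; split=> //.
  exact: P_le.
elim: t => [|t [IHH IHC]].
  have look a z cs : good_cells 0 z cs ->
      acc (FL (a, true, None)) (cellsof cs) (P 0) <-> a = tget (ctape (conf 0) ord0) z.
    case=> _ ej er ew [es ez]; rewrite fl_spec er.
    suff -> : nth None (map Some w) (jval cs) = tget (ctape (conf 0) ord0) z by [].
    have jl := jval_lt cs; rewrite es expnS in jl.
    rewrite /conf /= /tget; move: ej; rewrite es expnS; case: z ez => [n|n] ez [] ej; try lia.
    - have -> : jval cs = n by lia.
      by case: (w) => [|y s]; case: n {ez ej} => [|[|n]].
    (* A negative offset is stored as a number above [2 ^ m], hence beyond the input, where the
       lookup gives a blank. *)
    - rewrite nth_default ?nth_nil // size_map; lia.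
  split=> [k|x a z] cs g.
    rewrite haccE; split=> [[o]|->].
      rewrite inE => /orP[/eqP->|/mapP[k0 _ ->]] /(_ _ _ _ (mem_head _ _)).
        move/(stayE _ _ _ _ _ erefl)/fz_spec => [_ [e1 e2 /(look _ _ _ g) e3]].
        rewrite [k]surjective_pairing; congr pair; first exact: e1.
        apply/ffunP => x; rewrite ffunE; have [->|/[dup] nx /e2 ->] := eqVneq x ord0.
          exact: e3.
        by rewrite /conf /= (negPf nx).
      by move/(stayE _ _ _ _ _ erefl)/fu_spec => []; case: g => ->.
    exists [:: go (FZ (inl (info 0))) None stay]; first exact: mem_head.
    move=> q' wr mv; rewrite inE => /eqP/stayE ->; apply/fz_spec; case: (g) => -> _ _ _ _.
    split=> //; split=> // [x nx|]; first by rewrite ffunE /conf /= (negPf nx).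
    by apply/(look _ _ _ g); rewrite ffunE.
  rewrite haccE; split=> [[o]|e].
    rewrite inE => /orP[/eqP->|/mapP[k0 _ ->]] /(_ _ _ _ (mem_head _ _)).
      move/(stayE _ _ _ _ _ erefl)/fz_spec => [_]; case: eqP => [->|/eqP nx]; first by move/(look _ _ _ g).
      by move=> ->; rewrite /conf /= (negPf nx); case: z {g} => [[|[]]|[]].
    by move/(stayE _ _ _ _ _ erefl)/fu_spec => []; case: g => ->.
  exists [:: go (FZ (inr (x, a))) None stay]; first exact: mem_head.
  move=> q' wr mv; rewrite inE => /eqP/stayE ->; apply/fz_spec; case: (g) => -> _ _ _ _.
  split=> //; case: eqP e => [->|/eqP nx]; first by move=> /(look _ _ _ g).
  by move=> ->; rewrite /conf /= (negPf nx); case: z {g} => [[|[]]|[]].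
have sub x a z cs : good_cells t.+1 z cs ->
  acc (FU (true, Some (jmove (info t) x), true, inr (x, a, written (info t) x))) (cellsof cs) (P 0)
  <-> a = tget (ctape (conf t.+1) x) z.
  move=> g; rewrite fu_spec tget_next; have [g' ->] := good_urun (jmove (info t) x) g.
  case: (g) => -> _ _ _ _; have H := IHC _ a _ _ g'.
  case: written => [s|] /=; last by split=> [[_ /H]|/H].
  by case: ifP => _; split=> [[_]|]; [case|move->|move/H|move/H].
split=> [k|x a z] cs g.
  rewrite haccE; split=> [[o]|->].
    rewrite inE => /orP[/eqP->|/mapP[k0]].
      move/(_ _ _ _ (mem_head _ _))/(stayE _ _ _ _ _ erefl)/fz_spec => [].
      by case: g => ->.
    rewrite mem_filter => /andP[/eqP e0 _] -> H.
    have := H _ _ _ (mem_head _ _).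
    move/(stayE _ _ _ _ _ erefl)/fu_spec => [_].
    have [g' _] := good_urun None g; rewrite GRing.addr0 in g'; move/(IHH _ _ g') => k0E; subst k0.
    rewrite [k]surjective_pairing -e0 -info_next; congr pair.
    apply/ffunP => x; rewrite ffunE -[tcur _]/(tget _ 0); apply/(sub _ _ _ _ g).
    apply/(stayE _ _ _ _ _ erefl); apply: H; rewrite inE; apply/orP; right.
    by apply/mapP; exists x; rewrite ?mem_enum.
  exists (go (FU (true, Some None, true, inl (info t))) None stay ::
           [seq go (FU (true, Some (jmove (info t) x), true,
                        inr (x, (info t.+1).2 x, written (info t) x))) None stay
           | x <- enum T]).
    rewrite inE; apply/orP; right; apply/mapP; exists (info t) => //.
    by rewrite mem_filter mem_enum info_next eqxx.
  move=> q' wr mv; rewrite inE => /orP[/eqP/stayE ->|/mapP[x _ /stayE ->]].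
    apply/fu_spec; have [g' _] := good_urun None g; rewrite GRing.addr0 in g'.
    by case: (g) => -> _ _ _ _; split=> //; apply/(IHH _ _ g').
  by apply/(sub _ _ _ _ g); rewrite ffunE.
rewrite haccE; split=> [[o]|e].
  rewrite inE => /orP[/eqP->|/mapP[k0 _ ->]] H.
    move: (H _ _ _ (mem_head _ _)) => /(stayE _ _ _ _ _ erefl)/fz_spec[].
    by case: g => ->.
  have := H _ _ _ (mem_head _ _).
  move/(stayE _ _ _ _ _ erefl)/fu_spec => [_ /(IHH _ _ (good_reset g)) k0E]; subst k0.
  apply/(sub _ _ _ _ g); apply/(stayE _ _ _ _ _ erefl); apply: H.
  by rewrite inE mem_head orbT.
exists [:: go (FU (true, None, true, inl (info t))) None stay;
               go (FU (true, Some (jmove (info t) x), true, inr (x, a, written (info t) x))) None stay].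
  by rewrite inE; apply/orP; right; apply/mapP; exists (info t); rewrite ?mem_enum.
move=> q' wr mv; rewrite !inE => /orP[/eqP/stayE ->|/eqP/stayE ->].
  apply/fu_spec; case: (g) => -> _ _ _ _; split=> //.
  by apply/(IHH _ _ (good_reset g)).
exact/(sub _ _ _ _ g).
Qed.
End Simulation.

Definition pad_cell (N : TM) : dcell N := (true, false, None).
(** The time bits are 1 except in the last cell, so the time is [2 ^ (size w + r) - 1]; the
    additional last bit makes room for negative offsets. *)
Definition icells (N : TM) (w : seq (tape_sym N)) (r : nat) : seq (dcell N) :=
  [seq (true, false, Some x) | x <- w] ++ nseq r (pad_cell N) ++ [:: (false, false, None)].

Lemma icells_good (N : TM) (w : seq (tape_sym N)) r :
  good_cells w (size w + r) (2 ^ (size w + r) - 1) 0 (icells w r).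
Proof.
have p0 k : 0 < 2 ^ k by rewrite expn_gt0.
have tn k : tval (nseq k (pad_cell N) ++ [:: (false, false, None)]) = 2 ^ k - 1.
  by elim: k => //= k ->; rewrite expnS; have := p0 k; lia.
split.
- rewrite /icells; elim: w => [|x w IH]; first exact: tn.
  by rewrite [tval _]/= IH [size _]/= (addSn (size w)) expnS; have := p0 (size w + r); lia.
- left; congr Posz; rewrite /icells; elim: w => [|x w IH] /=; last by rewrite IH.
  by elim: r => //= r ->.
- rewrite /icells; elim: w => [|x w IH]; last by rewrite /rest /= -/(rest _) IH.
  by elim: r.
- by apply: leq_trans (leq_addr r _) _; exact/ltnW/ltn_expl.
rewrite !size_cat size_map size_nseq addn1 addnS; split=> //.
by have := p0 (size w + r); rewrite /=; lia.
Qed.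

(** This allows the simulation to start from a fixed bound in place of the unknown halting time. *)
Lemma conf_halt (N : TM) (w : seq (tape_sym N)) t t' : t <= t' ->
  halting (cstate (conf w t)) -> conf w t' = conf w t.
Proof.
move=> /subnK <- h; elim: (t' - t) => //= k IH.
by rewrite IH /step h.
Qed.

Lemma sim_accept (N : TM) (w : seq (tape_sym N)) r :
  @hacc (sim_mach N) (inl (inl (inl (inl (inl tt))))) (cellsof (icells w r)) (P 0) <->
  accepting (cstate (conf w (2 ^ (size w + r) - 1))).
Proof.
have [spec _] := sim_spec w (size w + r) (2 ^ (size w + r) - 1).
have {}spec k := spec k _ (icells_good w r).
rewrite haccE; split=> [[o]|a].
  case/mapP => k; rewrite mem_filter => /andP[ak _] -> /(_ _ _ _ (mem_head _ _)) [_].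
  by rewrite mv_stay => /spec ek; rewrite ek in ak.
set k := info w (2 ^ (size w + r) - 1).
exists [:: go (inl (inl (inl (inl (inr k))))) None stay].
  by apply/mapP; exists k; rewrite // mem_filter mem_enum andbT.
move=> q' wr mv; rewrite inE => /eqP[-> -> ->]; rewrite mv_stay; split; first exact: P_le.
exact/spec.
Qed.

End Simulation.

(** * Equations over the free inverse monoid as equations between finite sets *)

Module SetEquations.

Local Open Scope fset_scope.
Local Open Scope group_scope.

Section Lang.
Variables (A : invAlphabet) (Omega : eqType).
Implicit Types (W : eqn_word A Omega) (s t : FG A) (X : Omega -> FG A -> bool).

(* The set component of the value of W when the idempotent variable Z has the set X Z. *)
Fixpoint lang X W s : bool :=
  match W with
  | [::] => s == 1
  | inl a :: W' => (s == 1) || lang X W' ((FG_letter a)^-1 * s)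
  | inr Z :: W' => X Z s || lang X W' s
  end.

Fixpoint grp W : FG A :=
  match W with
  | [::] => 1
  | inl a :: W' => FG_letter a * grp W'
  | inr _ :: W' => grp W'
  end.

Lemma lang_1 X W : lang X W 1.
Proof. by elim: W => [|[a|Z] W IH] //=; rewrite IH orbT. Qed.

Lemma grp_cat W1 W2 : grp (W1 ++ W2) = grp W1 * grp W2.
Proof. by elim: W1 => [|[a|Z] W IH] /=; rewrite ?mul1g // IH mulgA. Qed.

Lemma lang_cat X W1 W2 s :
  lang X (W1 ++ W2) s = lang X W1 s || lang X W2 ((grp W1)^-1 * s).
Proof.
elim: W1 s => [|[a|Z] W IH] s /=.
- rewrite invg1 mul1g; case: eqP => //= ->; exact: lang_1.
- by rewrite IH invgM mulgA orbA.
by rewrite IH orbA.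
Qed.

Lemma mulVg_eq (g s t : FG A) : (g^-1 * s == t) = (s == g * t).
Proof. by apply/eqP/eqP => [<-|->]; rewrite mulgA ?mulgV ?mulVg mul1g. Qed.

Lemma grp_cons a W s : (s == grp (inl a :: W)) = ((FG_letter a)^-1 * s == grp W).
Proof. by rewrite mulVg_eq. Qed.

Lemma FIM_set1 (x : FIM A) : 1 \in x.1.
Proof.
case: x => -[P g] /= /andP[/prefix_closedP clP Pg].
by apply: clP Pg _; apply: prefix0s.
Qed.

Lemma psi_cat (u v : seq A) : psi (u ++ v) = psi u * psi v.
Proof. by rewrite /psi big_cat. Qed.

Lemma psi_cons (a : A) v : psi (a :: v) = FIM_letter a * psi v.
Proof. by rewrite /psi big_cons. Qed.

Lemma mem_imfset_mul (g s : FG A) (P : {fset FG A}) :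
  (s \in [fset g * h | h in P]) = (g^-1 * s \in P).
Proof.
apply/imfsetP/idP => [[/= h hP ->]|hP]; first by rewrite mulgA mulVg mul1g.
by exists (g^-1 * s); rewrite //= mulgA mulgV mul1g.
Qed.

Lemma idem_grp (x : FIM A) : x * x = x -> x.2 = 1.
Proof.
move=> e; have e2 : x.2 * x.2 = x.2 by rewrite -{3}e.
by rewrite -[LHS]mul1g -(mulVg x.2) -mulgA e2.
Qed.

Lemma psi_letter_mem (a : A) v s :
  (s \in (psi (a :: v)).1) = (s == 1) || ((FG_letter a)^-1 * s \in (psi v).1).
Proof.
rewrite psi_cons /= in_fsetU mem_imfset_mul in_fset2.
case: (s == 1) => //=; case: eqP => //= ->.
by rewrite mulVg FIM_set1.
Qed.

Lemma psi_extend (sigma : Omega -> seq A) W :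
  (forall Z, psi (sigma Z) * psi (sigma Z) = psi (sigma Z)) ->
  (forall s, (s \in (psi (extend sigma W)).1) =
     lang (fun Z s => s \in (psi (sigma Z)).1) W s) /\
  (psi (extend sigma W)).2 = grp W.
Proof.
move=> id; elim: W => [|[a|Z] W [IH1 IH2]]; rewrite /extend /=.
- by rewrite /psi big_nil; split=> // s; rewrite in_fset1.
- by split=> [s|]; [rewrite psi_letter_mem IH1 | rewrite psi_cons /= IH2].
rewrite psi_cat /= (idem_grp (id Z)) mul1g; split=> // s.
by rewrite in_fsetU mem_imfset_mul invg1 mul1g IH1.
Qed.

Definition pref (s t : FG A) : bool := prefix (s : seq A) (t : seq A).

Lemma pref1 s : pref 1 s.
Proof. exact: prefix0s. Qed.

Lemma pref_refl s : pref s s.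
Proof. exact: prefix_refl. Qed.

Lemma val_mul (a : A) s : FG_letter a * s = cons_red a s :> seq A.
Proof. by []. Qed.

Lemma val_mulV (a : A) s : (FG_letter a)^-1 * s = cons_red (bar a) s :> seq A.
Proof. by []. Qed.

(** The exception comes from cancellation: [s = 1] while [t] begins with the inverse of [a]. *)
Lemma pref_mul (a : A) s t : pref s t -> pref (FG_letter a * s) (FG_letter a * t) || (s == 1) && ~~ pref (FG_letter a) (FG_letter a * t).
Proof.
rewrite /pref !val_mul; case: s t => [[|b s] rs] [[|c t] rt] //=.
  by rewrite eqxx.
- by move=> _; rewrite orbN.
- case/andP => /eqP <- st; case: (b == bar a) => //=; first by rewrite st.
  by rewrite !eqxx st.
Qed.

(** A translation by a letter breaks prefixes only at 1 and at the letter itself, and [lang]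
    contains both in any case. So closing the variables under prefixes closes the value of every
    word. *)
Lemma lang_closure X X' W s :
  (forall Z s, X' Z s <-> s = 1 \/ exists2 t, X Z t & pref s t) ->
  lang X' W s <-> exists2 t, lang X W t & pref s t.
Proof.
move=> HX; elim: W s => [|[a|Z] W IH] s /=.
- split=> [/eqP->|[t /eqP->]]; first by exists 1; rewrite ?pref1.
  by rewrite /pref prefixs0 => /eqP e; apply/eqP/val_inj.
- split=> [/orP[/eqP->|/IH[t Lt st]]|[t /orP[/eqP->|Lt] st]].
  + by exists 1; rewrite ?eqxx ?pref1.
  + have := pref_mul a st; rewrite mulgA mulgV mul1g => /orP[h|].
      by exists (FG_letter a * t) => //; rewrite mulgA mulVg mul1g Lt orbT.
    case/andP => /eqP e _; exists (FG_letter a); first by rewrite mulVg lang_1 orbT.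
    by move/eqP: e; rewrite mulVg_eq mulg1 => /eqP->; apply: pref_refl.
  + by move: st; rewrite /pref prefixs0 => /eqP e; apply/orP; left; apply/eqP/val_inj.
  have e : t = FG_letter a * ((FG_letter a)^-1 * t) by rewrite mulgA mulgV mul1g.
  move: st; rewrite /pref e => st.
  have [h|[v pv e2]] := prefix_cat_red (FG_wordP (FG_letter a)) (FG_wordP _) st.
    have [->|->] : s = 1 \/ s = FG_letter a.
      case: s h {st} => -[|b [|c s]] rs //=; first by left; apply: val_inj.
        by rewrite andbT => /eqP eb; right; apply: val_inj; rewrite /= eb.
      by rewrite andbF.
    - by rewrite eqxx.
    - by rewrite mulVg lang_1 orbT.
  have rv : reduced v.
    by move: pv; rewrite prefixE => /eqP<-; apply/take_reduced/FG_wordP.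
  have -> : s = FG_letter a * MkFG rv by apply: val_inj.
  rewrite mulgA mulVg mul1g; apply/orP; right; apply/IH.
  by exists ((FG_letter a)^-1 * t).
split=> [/orP[/HX[->|[t Xt st]]|/IH[t Lt st]]|[t /orP[Xt|Lt] st]].
- by exists 1; rewrite ?pref1 // lang_1 orbT.
- by exists t; rewrite // Xt.
- by exists t; rewrite // Lt orbT.
- by apply/orP; left; apply/HX; right; exists t.
by apply/orP; right; apply/IH; exists t.
Qed.

(** Conjugation by [w] translates the set of [W] and keeps the group element trivial; concatenating
    such words yields unions of translates. *)
Definition conj (w : seq A) W : eqn_word A Omega :=
  map inl w ++ W ++ map inl (bar_word w).

Lemma grp_conj w W : grp W = 1 -> grp (conj w W) = 1.
Proof.
rewrite /conj; elim: w W => [|a w IH] W gW /=; first by rewrite cats0.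
rewrite /bar_word /= rev_cons map_rcons -cats1 !catA -(catA (map inl w)) grp_cat IH //= mul1g mulg1.
by apply: val_inj; rewrite /= eqxx.
Qed.

(** As [W] returns to its starting point, the way back along [bar_word w] visits only elements met
    on the way out. *)
Lemma lang_conj X w W s : grp W = 1 -> lang X (conj w W) s = lang X (map inl w ++ W) s.
Proof.
rewrite /conj => gW; elim: w s => [|a w IH] s /=; first by rewrite cats0.
rewrite /bar_word /= rev_cons map_rcons -cats1 !catA -(catA (map inl w)) lang_cat.
have := grp_conj w gW; rewrite /conj /bar_word => ->; rewrite IH invg1 mul1g /= orbA.
rewrite mulVg_eq mulg1.
have -> : (FG_letter (bar a))^-1 * ((FG_letter a)^-1 * s) = s.
  rewrite mulgA -invgM (_ : FG_letter a * FG_letter (bar a) = 1) ?invg1 ?mul1g //.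
  by apply: val_inj; rewrite /= eqxx.
case: (s == 1); rewrite ?orbT //= orbF orbC; case: eqP => //= ->.
by rewrite mulVg lang_1.
Qed.

Lemma lang_word X (w : FG A) W s :
  lang X (map inl (w : seq A) ++ W) s = pref s w || lang X W (w^-1 * s).
Proof.
case: w => w rw; rewrite /pref /=; elim: w rw s => [|a w IH] rw s /=.
  rewrite (_ : MkFG rw = 1); last exact: val_inj.
  rewrite invg1 mul1g; case: s => -[|b s] rs //=.
  by rewrite (_ : MkFG rs = 1) ?lang_1 //; apply: val_inj.
rewrite (IH (reduced_behead rw)).
have -> : (MkFG rw)^-1 * s = (MkFG (reduced_behead rw))^-1 * ((FG_letter a)^-1 * s).
  rewrite mulgA -invgM; congr (_^-1 * _); apply: val_inj => /=.
  by rewrite cons_red_id.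
rewrite orbA; congr (_ || _).
rewrite val_mulV; case: s => -[|b s] rs //=.
rewrite barK; case: eqP => [_|ne] //=.
case: w rw {IH} => //= c w; rewrite /reduced /= => /andP[/negPf nc _].
by rewrite eq_sym nc.
Qed.

(** A product of words [u u^-1], one for each element of [P]; its value is the idempotent given by
    the prefix closure of [P]. *)
Definition word_of (P : {fset FG A}) : seq A :=
  flatten [seq (u : seq A) ++ bar_word u | u : FG A <- enum_fset P].

Lemma psi_word_of (P : {fset FG A}) s :
  s \in (psi (word_of P)).1 <-> s = 1 \/ exists2 t, t \in P & pref s t.
Proof.
pose X0 (Z : Omega) (_ : FG A) := false.
have E (v : seq A) : (forall s, (s \in (psi v).1) = lang X0 (map inl v) s) /\ (psi v).2 = grp (map inl v).
  elim: v => [|a v [IH1 IH2]] /=.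
    by rewrite /psi big_nil; split=> // u; rewrite in_fset1.
  by split=> [u|]; [rewrite psi_letter_mem IH1 | rewrite psi_cons /= IH2].
rewrite (E _).1 /word_of.
have -> : (exists2 t, t \in P & pref s t) <-> (exists2 t, t \in enum_fset P & pref s t) by [].
elim: (enum_fset P) s => [|u us IH] s /=.
  by split=> [/eqP|[/eqP|[]]//]; left.
have g1 : grp (map inl ((u : seq A) ++ bar_word u)) = 1.
  by have := @grp_conj u [::] erefl; rewrite /conj map_cat.
rewrite map_cat lang_cat g1 invg1 mul1g.
have -> : lang X0 (map inl ((u : seq A) ++ bar_word u)) s = pref s u.
  have := @lang_conj X0 u [::] s erefl; rewrite /conj map_cat => ->.
  rewrite (lang_word _ u [::]) /= mulVg_eq mulg1.
  by case: (eqVneq s u) => [->|]; rewrite ?orbF ?orbT ?pref_refl.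
split=> [/orP[h|/IH[->|[t tin st]]]|[->|[t]]].
- by right; exists u; rewrite ?mem_head.
- by left.
- by right; exists t; rewrite // inE tin orbT.
- by rewrite pref1.
rewrite inE => /orP[/eqP->|tin] st; first by rewrite st.
by apply/orP; right; apply/IH; right; exists t.
Qed.

Lemma psi_word_of2 (P : {fset FG A}) : (psi (word_of P)).2 = 1.
Proof.
have E (v : seq A) : (psi v).2 = grp (map inl v).
  elim: v => [|a v IH] /=; first by rewrite /psi big_nil.
  by rewrite psi_cons /= IH.
rewrite E /word_of; elim: (enum_fset P) => //= u us IH.
have := @grp_conj u [::] erefl; rewrite /conj /= -map_cat => g1.
by rewrite map_cat grp_cat g1 IH mul1g.
Qed.

Lemma solvable_lang (S : seq (equation A Omega)) : solvable S ->
  exists X : Omega -> {fset FG A}, (forall Z, 1 \in X Z) /\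
    forall U V, (U, V) \in S ->
    (forall s, lang (fun Z s => s \in X Z) U s = lang (fun Z s => s \in X Z) V s)
    /\ grp U = grp V.
Proof.
case=> sigma [id eqs]; exists (fun Z => (psi (sigma Z)).1).
split=> [Z|U V /eqs e]; first exact: FIM_set1.
have [u1 u2] := psi_extend U id; have [v1 v2] := psi_extend V id.
by split=> [s|]; [rewrite -u1 -v1 e | rewrite -u2 -v2 e].
Qed.

(* The prefix closure of a finite solution of the underlying language equations is
   again a solution, so X need not be prefix closed. *)
Lemma lang_solvable (S : seq (equation A Omega)) (X : Omega -> {fset FG A}) :
  (forall U V, (U, V) \in S ->
    (forall s, lang (fun Z s => s \in X Z) U s = lang (fun Z s => s \in X Z) V s)
    /\ grp U = grp V) -> solvable S.
Proof.
move=> HX; pose sigma Z := word_of (X Z).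
have id Z : psi (sigma Z) * psi (sigma Z) = psi (sigma Z).
  apply: val_inj => /=; rewrite /sigma psi_word_of2 mulg1.
  rewrite [RHS]surjective_pairing psi_word_of2; congr pair; apply/fsetP => s.
  by rewrite in_fsetU mem_imfset_mul invg1 mul1g orbb.
exists sigma; split=> // U V /HX[e1 e2]; apply: val_inj.
have [u1 u2] := psi_extend U id; have [v1 v2] := psi_extend V id.
rewrite [LHS]surjective_pairing [RHS]surjective_pairing u2 v2 e2; congr pair.
apply/fsetP => s; rewrite u1 v1.
have cl W := @lang_closure (fun Z s => s \in X Z) _ W s (fun Z s => psi_word_of (X Z) s).
apply/idP/idP => /cl[t Lt st]; apply/cl; exists t => //; first by rewrite -e1.
by rewrite e1.
Qed.
End Lang.

End SetEquations.

(** * From a queue automaton to a system of two equations *)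

Module QueueSystems.
Import StackPrograms QueueMachines SetEquations.

Local Open Scope fset_scope.
Local Open Scope group_scope.

Section Inclusions.
Variables (A : invAlphabet) (al be : A).
Hypothesis Hu : uniq [:: al; bar al; be; bar be].

Definition lt (b : bool) : A := if b then al else be.

Lemma lt_bar b b' : lt b != bar (lt b').
Proof.
move: Hu; rewrite /= !inE.
by case: b; case: b' => /=; apply: contraTneq => e; rewrite -e !eqxx ?orbT ?andbF.
Qed.

Lemma lt_inj : injective lt.
Proof.
by case; case => //= e; move: Hu; rewrite /= !inE e eqxx ?orbT.
Qed.

Lemma pw_reduced v : reduced (map lt v).
Proof. by rewrite /reduced; case: v => //= b v; elim: v b => //= b v IH c; rewrite lt_bar IH. Qed.

(** Bit strings as positive words in [al] and [be]. By [lt_bar] no two of these letters cancel, so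
    concatenation is the group product. *)
Definition pos (v : seq bool) : FG A := MkFG (pw_reduced v).

Lemma pos_inj : injective pos.
Proof. by move=> u v /(congr1 (@FG_word A)) /= /(inj_map lt_inj). Qed.

Lemma pos_cat u v : pos (u ++ v) = pos u * pos v.
Proof.
apply: val_inj => /=; elim: u => //= b u ->.
case: u => [|c u] /=; first by case: v => //= c v; rewrite (negPf (lt_bar _ _)).
have [w ->] : exists w, cons_red (lt c) (cat_red (map lt u) (map lt v)) = lt c :: w.
  elim: u c => [|d u IH] c /=.
    by case: v => [|d v] /=; [exists [::] | rewrite (negPf (lt_bar _ _)); eexists].
  by have [w ->] := IH d; rewrite /= (negPf (lt_bar _ _)); eexists.
by rewrite /= (negPf (lt_bar _ _)).
Qed.

Lemma pos_catV u v : (pos u)^-1 * pos (u ++ v) = pos v.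
Proof. by rewrite pos_cat mulgA mulVg mul1g. Qed.

Lemma pref_pos u v : pref (pos u) (pos v) = prefix u v.
Proof. 
rewrite /pref /=; elim: u v => [|b u IH] [|c v] //=.
by rewrite IH (inj_eq lt_inj).
Qed.

Lemma pref_pos_inv s v : pref s (pos v) -> exists2 u, s = pos u & prefix u v.
Proof.
rewrite /pref prefixE => /eqP e; exists (take (size s) v); last exact: prefix_take.
by apply: val_inj; rewrite /= map_take e.
Qed.

Lemma size_mul (g h : FG A) : size (g * h : FG A) <= size g + size h.
Proof.
case: g => g rg; rewrite /= ; elim: g {rg} => //= a g IH.
rewrite /cat_red /= -/(cat_red g h); case: (cat_red g h) IH => //= b w IH.
by case: ifP => _ /=; lia.
Qed.

Lemma size_inv (g : FG A) : size (g^-1 : FG A) = size g.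
Proof. by rewrite /= size_rev size_map. Qed.

(* A finite P contained in 1, aP and bP consists of positive words: otherwise
   removing leading letters for ever would produce arbitrarily long elements. *)
Lemma positive_words (P : {fset FG A}) :
  (forall s, s \in P -> s = 1 \/ exists b, (FG_letter (lt b))^-1 * s \in P) ->
  forall s, s \in P -> exists v, s = pos v.
Proof.
move=> H s sP.
have step k : (exists v, s = pos v) \/
    exists2 v, size v = k & (pos v)^-1 * s \in P.
  elim: k => [|k [h|[v sv hv]]]; [right | by left |].
    by exists [::]; rewrite // (_ : pos [::] = 1) ?invg1 ?mul1g //; apply: val_inj.
  case: (H _ hv) => [e|[b hb]].
    by left; exists v; apply/eqP; rewrite -[X in _ == X]mulg1 -mulVg_eq e.
  right; exists (rcons v b); first by rewrite size_rcons sv.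
  rewrite -cats1 pos_cat invgM -mulgA (_ : pos [:: b] = FG_letter (lt b)) //.
  exact: val_inj.
pose N := (\max_(t <- enum_fset P) size (t : FG A))%N.
(* Removing more than [N + size s] letters from [s] leaves an element longer than all those of
   [P]. *)
have [//|[v sv hv]] := step (N + size s).+1.
have le : size ((pos v)^-1 * s : FG A) <= N.
  by rewrite /N; apply: (@leq_bigmax_seq _ _ xpredT (fun t : FG A => size t)).
have e : pos v = s * ((pos v)^-1 * s)^-1 by rewrite invgM invgK mulgA mulgV mul1g.
have := size_mul s ((pos v)^-1 * s)^-1; rewrite -e size_inv {1}/pos /= size_map sv.
by move: le => /=; lia.
Qed.

(** [(v, Some Z)] stands for the translate of [Z] by [v], and [(v, None)] for the prefixes of [v].
    An inclusion consists of an identifier, a left side and a right side. *)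
Definition bterm : Type := (seq bool * option var)%type.
Definition incl : Type := (seq bool * seq bterm * seq bterm)%type.

Definition term_word (t : bterm) : eqn_word A var :=
  conj (map lt t.1) (if t.2 is Some Z then [:: inr Z] else [::]).
Definition side (ts : seq bterm) : eqn_word A var := flatten (map term_word ts).

Lemma grp_side ts : grp (side ts) = 1.
Proof.
elim: ts => //= t ts IH; rewrite /side /= grp_cat -/(side ts) IH mulg1.
by apply: grp_conj; case: t.2.
Qed.

Lemma lang_side X ts s : lang X (side ts) s <-> s = 1 \/ exists2 t, t \in ts &
  pref s (pos t.1) \/ exists2 Z, t.2 = Some Z & X Z ((pos t.1)^-1 * s).
Proof.
elim: ts => [|t ts IH] /=; first by split=> [/eqP|[->|[]]] //; left.
rewrite /side /= lang_cat -/(side ts).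
have gt : grp (if t.2 is Some Z then [:: inr Z] else [::] : eqn_word A var) = 1 by case: t.2.
rewrite (grp_conj _ gt) invg1 mul1g lang_conj // (lang_word _ (pos t.1)).
split=> [/orP[/orP[h|h]|/IH[->|[t' tin h]]]|[->|[t']]].
- by right; exists t; rewrite ?mem_head //; left.
- case e : t.2 h => [Z|] /=; last first.
    by rewrite mulVg_eq mulg1 => /eqP->; right; exists t; rewrite ?mem_head //; left; rewrite pref_refl.
  case/orP => [h|]; first by right; exists t; rewrite ?mem_head //; right; exists Z.
  by rewrite mulVg_eq mulg1 => /eqP->; right; exists t; rewrite ?mem_head //; left; rewrite pref_refl.
- by left.
- by right; exists t'; rewrite // inE tin orbT.
- by rewrite pref1.
rewrite inE => /orP[/eqP->|tin] h; last first.
  by apply/orP; right; apply/IH; right; exists t'.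
case: h => [->//|[Z -> /= ->]].
by rewrite orbT.
Qed.

Variables (Ev : var) (vars : seq var) (incs : seq incl).

Definition shift (id : seq bool) (ts : seq bterm) : seq bterm :=
  [seq (id ++ t.1, t.2) | t <- ts].
(** The first equation puts every variable, [Ev] included, into the union of 1 and the translates of
    [Ev] by the two letters; [positive_words] applies to [Ev] first. *)
Definition eq1L : seq bterm :=
  [seq ([::], Some Z) | Z <- vars] ++
  [:: ([::], Some Ev); ([:: true], Some Ev); ([:: false], Some Ev)].
Definition eq1R : seq bterm := [:: ([:: true], Some Ev); ([:: false], Some Ev)].
(** An inclusion of [L] in [R] is the equation between the union of both and [R]; translated by
    their identifiers, all of these are united into one. *)
Definition eq2L : seq bterm := flatten [seq shift i.1.1 (i.1.2 ++ i.2) | i <- incs].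
Definition eq2R : seq bterm := flatten [seq shift i.1.1 i.2 | i <- incs].
Definition incl_system : system A :=
  [:: (side eq1L, side eq1R); (side eq2L, side eq2R)].

Hypothesis ids_code : forall i j u v, i \in incs -> j \in incs ->
  i.1.1 ++ u = j.1.1 ++ v -> i = j.
Hypothesis ids0 : forall i, i \in incs -> i.1.1 != [::].
Hypothesis vars_in : forall i t Z, i \in incs -> t \in i.1.2 ++ i.2 ->
  t.2 = Some Z -> Z \in vars.
Hypothesis Ev_notin : Ev \notin vars.
(** The proper prefixes of an identifier occur in the translated left side; a term on the right has
    to supply them too. *)
Hypothesis R0 : forall i, i \in incs -> i.2 != [::].

Definition inT (Y : var -> seq bool -> Prop) (ts : seq bterm) (v : seq bool) : Prop :=
  exists2 t, t \in ts & prefix v t.1 \/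
    exists Z v', [/\ t.2 = Some Z, v = t.1 ++ v' & Y Z v'].

Lemma cat_prefix2 (T : eqType) (a b c : seq T) : prefix (a ++ b) (a ++ c) = prefix b c.
Proof. by elim: a => //= x a ->; rewrite eqxx. Qed.

(** Identifiers form a prefix code, so a word behind one of them can only be matched behind the same
    one: the second equation splits into the separate inclusions. Finiteness of the solution becomes
    a bound on lengths. *)
Lemma incl_system_sound : solvable incl_system ->
  exists Y n, (forall Z v, Y Z v -> size v <= n) /\
    forall i v, i \in incs -> inT Y i.1.2 v -> inT Y i.2 v.
Proof.
case/solvable_lang => X [X1 HX].
have [e1 _] := HX _ _ (mem_head _ _).
have in2 : (side eq2L, side eq2R) \in incl_system by rewrite !inE eqxx orbT.
have [e2 _] := HX _ _ in2.
have in1 Z s : Z \in Ev :: vars -> s \in X Z -> s = 1 \/ exists b, (FG_letter (lt b))^-1 * s \in X Ev.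
  move=> Zin sE.
  have : lang (fun Z s => s \in X Z) (side eq1R) s.
    rewrite -e1; apply/lang_side; right; exists ([::], Some Z).
      move: Zin; rewrite inE mem_cat => /orP[/eqP->|Zin]; first by rewrite mem_head orbT.
      by apply/orP; left; apply/mapP; exists Z.
    by right; exists Z; rewrite // (_ : pos _ = 1) ?invg1 ?mul1g //; apply: val_inj.
  case/lang_side => [->|[t]]; first by left.
  rewrite !inE => tin H; have {tin} [b eb] : exists b, t = ([:: b], Some Ev).
    by case/orP: tin => /eqP->; [exists true | exists false].
  rewrite {}eb /= in H; have eL : pos [:: b] = FG_letter (lt b) by apply: val_inj.
  case: H => [/pref_pos_inv[u -> pu]|[_ [<-]]]; last by rewrite eL; right; exists b.
  case: u pu => [|c u]; first by left; apply: val_inj.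
  rewrite prefix_cons prefixs0 => /andP[/eqP-> /eqP->]; right; exists b.
  by rewrite eL mulVg.
have posE s : s \in X Ev -> exists v, s = pos v.
  by apply: positive_words => {}s; apply: in1; rewrite mem_head.
have posZ Z s : Z \in vars -> s \in X Z -> exists v, s = pos v.
  move=> Zin /in1; rewrite inE Zin orbT => /(_ isT) [->|[b /posE[v e]]].
    by exists [::]; apply: val_inj.
  exists (b :: v); rewrite -cat1s pos_cat -e (_ : pos [:: b] = FG_letter (lt b)).
    by rewrite mulgA mulgV mul1g.
  exact: val_inj.
exists (fun Z v => Z \in vars /\ pos v \in X Z).
exists (\max_(Z <- vars) \max_(t <- enum_fset (X Z)) size (t : FG A))%N.
split=> [Z v [Zin vX]|i v iin [t tin H]].
  apply: leq_trans (@leq_bigmax_seq _ vars xpredT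
    (fun Z => \max_(t <- enum_fset (X Z)) size (t : FG A))%N Z Zin isT).
  have := @leq_bigmax_seq _ (enum_fset (X Z)) xpredT (fun t : FG A => size t) (pos v) vX isT.
  by rewrite {1}/pos /= size_map.
have : lang (fun Z s => s \in X Z) (side eq2R) (pos (i.1.1 ++ v)).
  rewrite -e2; apply/lang_side; right; exists (i.1.1 ++ t.1, t.2).
    apply/flattenP; exists (shift i.1.1 (i.1.2 ++ i.2)); first exact: map_f.
    by apply: (map_f (fun t : bterm => (i.1.1 ++ t.1, t.2))); rewrite mem_cat tin.
  case: H => [pv|[Z [v' [et ev [Zin vX]]]]].
    by left; rewrite pref_pos /= cat_prefix2.
  right; exists Z => //=.
  by rewrite ev catA pos_catV.
case/lang_side => [e|[t2 /flattenP[ts /mapP[j jin ->] /mapP[t3 t3in ->]]] /= H2].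
  have /pos_inj : pos (i.1.1 ++ v) = pos [::] by rewrite e; apply: val_inj.
  by move: (ids0 iin); case: i.1.1.
case: H2 => [|[Z et3 hX]].
  rewrite pref_pos => /prefixP[u e]; have ij : i = j.
    by apply: (ids_code (u := v ++ u) (v := t3.1)) => //; rewrite catA.
  subst j; exists t3 => //; left; move/eqP: e; rewrite -catA eqseq_cat // => /andP[_ /eqP->].
  exact: prefix_prefix.
have Zin : Z \in vars by apply: (vars_in jin _ et3); rewrite mem_cat t3in orbT.
have [v' ev'] := posZ _ _ Zin hX.
have /pos_inj e : pos (i.1.1 ++ v) = pos ((j.1.1 ++ t3.1) ++ v').
  by apply/eqP; rewrite (pos_cat (j.1.1 ++ t3.1)) -mulVg_eq ev'.
have ij : i = j by apply: (@ids_code i j v (t3.1 ++ v')) => //; rewrite e -catA.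
subst j; exists t3 => //; right; exists Z, v'; split=> //.
  by move/eqP: e; rewrite -catA eqseq_cat // => /andP[_ /eqP].
by rewrite -ev'.
Qed.

Fixpoint bwords (n : nat) : seq (seq bool) :=
  if n is n'.+1 then [::] :: flatten [seq map (cons b) (bwords n') | b <- [:: true; false]]
  else [:: [::]].

Lemma mem_bwords n v : (v \in bwords n) = (size v <= n).
Proof.
elim: n v => [|n IH] [|b v] //=; rewrite inE /= cats0 mem_cat ltnS -IH.
apply/orP/idP => [[]/mapP[x xin [_ ->]]//|vin].
by case: b; [left | right]; apply/mapP; exists v.
Qed.

(** The first equation holds because [Ev] receives all words of length at most [n]. As [Y] is an
    arbitrary predicate, the finite sets are formed with excluded middle. *)
Lemma incl_system_complete (Y : var -> seq bool -> Prop) n :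
  (forall Z v, Y Z v -> size v <= n) ->
  (forall i v, i \in incs -> inT Y i.1.2 v -> inT Y i.2 v) -> solvable incl_system.
Proof.
move=> Yn HY.
pose dY Z v : bool := if ClassicalDescription.excluded_middle_informative (Y Z v) then true else false.
have dYP Z v : reflect (Y Z v) (dY Z v).
  by rewrite /dY; case: ClassicalDescription.excluded_middle_informative => ?; constructor.
pose X Z : {fset FG A} := if Z == Ev then seq_fset tt (map pos (bwords n))
  else seq_fset tt (map pos [seq v <- bwords n | dY Z v]).
have XE s : s \in X Ev <-> exists2 v, s = pos v & size v <= n.
  rewrite /X eqxx seq_fsetE; split=> [/mapP[v]|[v -> sv]].
    by rewrite mem_bwords => sv ->; exists v.
  by apply: map_f; rewrite mem_bwords.
have XY Z s : Z != Ev -> s \in X Z <-> exists2 v, s = pos v & Y Z v.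
  move=> /negPf ne; rewrite /X ne seq_fsetE; split=> [/mapP[v]|[v -> yv]].
    by rewrite mem_filter => /andP[/dYP yv _] ->; exists v.
  by apply: map_f; rewrite mem_filter mem_bwords (Yn _ _ yv) andbT; apply/dYP.
have vE Z : Z \in vars -> Z != Ev by apply: contraTneq => ->.
apply: (@lang_solvable _ _ _ X) => U V; rewrite !inE => /orP[]/eqP[-> ->];
  (split; last by rewrite !grp_side) => s; apply/idP/idP.
- case/lang_side => [->|[t]]; first exact: lang_1.
  rewrite mem_cat inE => /orP[/mapP[Z Zin ->]|/orP[/eqP->|tin]] H; last first.
  + by apply/lang_side; right; exists t.
  + have [v -> sv] : exists2 v, s = pos v & size v <= n.
      case: H => [/pref_pos_inv[u ->]|[_ [<-]]].
        by rewrite prefixs0 => /eqP->; exists [::].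
      by rewrite (_ : pos _ = 1) ?invg1 ?mul1g; [move/XE | apply: val_inj].
    apply/lang_side; case: v sv => [|b v] sv; first by left; apply: val_inj.
    right; exists ([:: b], Some Ev); first by case: (b); rewrite !inE eqxx ?orbT.
    right; exists Ev => //=; rewrite (pos_catV [:: b] v).
    by apply/XE; exists v => //; apply: ltnW.
  have [v -> sv] : exists2 v, s = pos v & size v <= n.
    case: H => [/pref_pos_inv[u ->]|[_ [<-]]].
      by rewrite prefixs0 => /eqP->; exists [::].
    rewrite (_ : pos _ = 1) ?invg1 ?mul1g; last exact: val_inj.
    by move/(XY _ _ (vE _ Zin)) => [v -> yv]; exists v => //; apply: Yn yv.
  apply/lang_side; case: v sv => [|b v] sv; first by left; apply: val_inj.
  right; exists ([:: b], Some Ev); first by case: (b); rewrite !inE eqxx ?orbT.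
  right; exists Ev => //=; rewrite (pos_catV [:: b] v).
  by apply/XE; exists v => //; apply: ltnW.
- case/lang_side => [->|[t tin H]]; first exact: lang_1.
  by apply/lang_side; right; exists t => //; rewrite mem_cat inE tin !orbT.
- case/lang_side => [->|[t]]; first exact: lang_1.
  case/flattenP => ts /mapP[i iin ->] /mapP[t' t'in ->] /= H.
  have inR' v : inT Y i.2 v -> lang (fun Z s => s \in X Z) (side eq2R) (pos (i.1.1 ++ v)).
    case=> t2 t2in H2; apply/lang_side; right; exists (i.1.1 ++ t2.1, t2.2).
      apply/flattenP; exists (shift i.1.1 i.2); first exact: map_f.
      exact: (map_f (fun t : bterm => (i.1.1 ++ t.1, t.2))).
    case: H2 => [pv|[Z [v' [et ev yv]]]]; first by left; rewrite pref_pos /= cat_prefix2.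
    right; exists Z => //=; rewrite ev catA pos_catV.
    apply/XY; last by exists v'.
    by apply/vE/(vars_in iin (t := t2)); rewrite // mem_cat t2in orbT.
  have inL v : inT Y (i.1.2 ++ i.2) v -> lang (fun Z s => s \in X Z) (side eq2R) (pos (i.1.1 ++ v)).
    case=> t2; rewrite mem_cat => /orP[t2in|t2in] H2; apply: inR'.
      by apply: HY iin _; exists t2.
    by exists t2.
  case: H => [/pref_pos_inv[u -> pu]|[Z et hX]].
    have [lt_u|ge_u] := ltnP (size u) (size i.1.1).
      case er : i.2 (R0 iin) => [//|t2 r] _; apply/lang_side; right.
      exists (i.1.1 ++ t2.1, t2.2).
        apply/flattenP; exists (shift i.1.1 i.2); first exact: map_f.
        by apply: (map_f (fun t : bterm => (i.1.1 ++ t.1, t.2))); rewrite er mem_head.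
      left; rewrite pref_pos /=; move: pu; rewrite !prefixE !take_cat lt_u.
      by [].
    have [v eu] : exists v, u = i.1.1 ++ v.
      exists (drop (size i.1.1) u); rewrite -{1}(cat_take_drop (size i.1.1) u); congr (_ ++ _).
      move: pu; rewrite prefixE => /eqP<-; rewrite take_takel //.
      by rewrite take_size_cat.
    rewrite eu; apply: inL; exists t' => //; left.
    by move: pu; rewrite eu cat_prefix2.
  have Zin : Z \in vars by apply: (vars_in iin t'in et).
  move: hX; rewrite (XY _ _ (vE _ Zin)) => -[v ev yv].
  have -> : s = pos (i.1.1 ++ (t'.1 ++ v)).
    by apply/eqP; rewrite catA pos_cat -mulVg_eq ev.
  by apply: inL; exists t' => //; right; exists Z, v.
case/lang_side => [->|[t]]; first exact: lang_1.
case/flattenP => ts /mapP[i iin ->] /mapP[t' t'in ->] /= H.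
apply/lang_side; right; exists (i.1.1 ++ t'.1, t'.2) => //.
apply/flattenP; exists (shift i.1.1 (i.1.2 ++ i.2)); first exact: map_f.
by apply: (map_f (fun t : bterm => (i.1.1 ++ t.1, t.2))); rewrite mem_cat t'in orbT.
Qed.
End Inclusions.

Local Open Scope nat_scope.

(** * Acceptance of a queue as closure properties of sets of stacks *)

Section QueueSystem.
Variables (M : aqm) (q0 : aq_state M) (y0 : aq_sym M).
Local Notation Q := (aq_state M).
Local Notation G := (aq_sym M).

Definition omax : nat := \max_(p : Q * G) size (aq_delta p.1 p.2).
(** Families of variables, each with a numerical index. [cE]: positive words; [cN]: unfinished
    prefixes; [cI] at [k]: the initial stack after [k] input letters; [cD y] at [k]: stacks with [y]
    at depth [k]; [cT]: remainders without condition; [cQ q]: stacks accepted from [q]; [cO x]: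
    those accepted by the option [x]. *)
Definition cls : finType := (bool * bool + G + Q + Q * G * 'I_omax)%type.
Notation cE := (inl (inl (inl (false, false)))).
Notation cN := (inl (inl (inl (false, true)))).
Notation cT := (inl (inl (inl (true, false)))).
Notation cI := (inl (inl (inl (true, true)))).
Notation cD y := (inl (inl (inr y))).
Notation cQ q := (inl (inr q)).
Notation cO x := (inr x).

(** The index is written in unary, so that the text of the system is made of fixed strings and of
    strings repeated [k] times. *)
Definition nm (c : cls) (k : nat) : var := nseq (enum_rank c) true ++ false :: nseq k true.
(** Two unary numbers, each ended by [false], hence a prefix code. The first is 0 for the rules that
    occur once; the second numbers those rules, and is the loop counter for the others. *)
Definition idw (c k : nat) : seq bool := nseq c true ++ false :: nseq k true ++ [:: false].
Definition code (y : G) : seq bool := nseq (enum_rank y).+1 true ++ [:: false].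
Definition enc (s : seq G) : seq bool := flatten (map code s).
(* The stack s is represented by the word [dl s]; no word of this form is a proper
   prefix of a code, which separates the stacks from the prefix closure. *)
Definition dl (s : seq G) : seq bool := enc s ++ [:: false].
Definition sterm : Type := (seq G * cls * nat)%type.
Definition rule : Type := (sterm * seq sterm)%type.
Definition tm (t : sterm) : bterm := (enc t.1.1, Some (nm t.1.2 t.2)).
Definition tN : bterm := tm ([::], cN, 0).

Definition opts (q : Q) : seq (Q * G * 'I_omax) :=
  [seq x : Q * G * 'I_omax <- enum {: Q * G * 'I_omax} | (x.1.1 == q) && (x.2 < size (aq_delta x.1.1 x.1.2))].
Definition branches (x : Q * G * 'I_omax) : seq (Q * G) :=
  nth [::] (aq_delta x.1.1 x.1.2) x.2.

Definition rule_I (x : G) (k : nat) : rule := (([:: x], cI, k), [:: ([::], cI, k.+1)]).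
(** An inclusion cannot remove the top letter of a stack, so that letter is guessed in the union on
    the right. *)
Definition rule_D (y : G) (k : nat) : rule :=
  (([::], cD y, k.+1), [seq ([:: g], cD y, k) | g <- enum G]).
Definition loop_rules (x : G) (k : nat) : seq (nat * rule) :=
  (1, rule_I x k) :: [seq ((enum_rank y).+2 : nat, rule_D y k) | y <- enum G].
(** One round of the automaton: a stack accepted from [q] uses some option [x]; the letter at depth
    [B] is the one that [x] reads; and prepending what a branch of [x] appends to the queue gives a
    stack accepted from the state of that branch. *)
Definition const_rules (B : nat) : seq rule :=
  (([::], cI, B), [:: ([::], cQ q0, 0)]) ::
  [seq (([::], cD y, 0), [:: ([:: y], cT, 0)]) | y <- enum G] ++
  [seq (([::], cQ q, 0), [seq ([::], cO x, 0) | x <- opts q]) | q <- enum Q] ++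
  [seq (([::], cO x, 0), [:: ([::], cD x.1.2, B)]) | x <- enum {: Q * G * 'I_omax}] ++
  flatten [seq [seq (([:: p.2], cO x, 0), [:: ([::], cQ p.1, 0)]) | p <- branches x]
          | x <- enum {: Q * G * 'I_omax}].

Definition number (T : Type) (s : seq T) : seq (nat * T) := zip (iota 0 (size s)) s.
Definition inc_of (id : seq bool) (r : rule) : incl :=
  (id, [:: tm r.1], rcons (map tm r.2) tN).
Definition loop_incs (x : G) (k : nat) : seq incl :=
  [seq inc_of (idw p.1 k) p.2 | p <- loop_rules x k].
(** The first inclusion keeps delimited stacks out of [cN]: their letters would have to be split off
    one by one, and the end marker alone has no such splitting. The second puts the stack of the
    first letter [y0] into [cI]. *)
Definition const_incs (B : nat) : seq incl :=
  (idw 0 0, [:: tN], [seq tm ([:: y], cN, 0) | y <- enum G]) ::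
  (idw 0 1, [:: (dl [:: y0], None)], [:: tm ([::], cI, 0); tN]) ::
  [seq inc_of (idw 0 p.1.+2) p.2 | p <- number (const_rules B)].

Definition sys_incs (u : seq G) : seq incl :=
  flatten [seq loop_incs p.2 p.1 | p <- number u] ++ const_incs (size u).
Definition sys_rules (u : seq G) : seq rule :=
  flatten [seq map snd (loop_rules p.2 p.1) | p <- number u] ++ const_rules (size u).

Definition loop_vars (k : nat) : seq var := nm cI k :: [seq nm (cD y) k | y <- enum G].
Definition const_vars : seq var :=
  [:: nm cN 0; nm cT 0] ++ [seq nm (cQ q) 0 | q <- enum Q] ++
  [seq nm (cO x) 0 | x <- enum {: Q * G * 'I_omax}].
Definition sys_vars (B : nat) : seq var :=
  flatten [seq loop_vars k | k <- iota 0 B] ++ loop_vars B ++ const_vars.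

Lemma nm_inj c k c' k' : nm c k = nm c' k' -> c = c' /\ k = k'.
Proof.
rewrite /nm => e.
have H n m (x y : seq bool) : nseq n true ++ false :: x = nseq m true ++ false :: y -> n = m /\ x = y.
  elim: n m => [|n IH] [|m] //=; first by case.
  by case=> /IH[-> ->].
have [er /(congr1 size)] := H _ _ _ _ e; rewrite !size_nseq => ->.
by split=> //; apply/enum_rank_inj/val_inj.
Qed.

Lemma idw_code c k c' k' u v : idw c k ++ u = idw c' k' ++ v -> (c, k) = (c', k').
Proof.
have H n m (x y : seq bool) : nseq n true ++ false :: x = nseq m true ++ false :: y -> n = m /\ x = y.
  elim: n m => [|n IH] [|m] //=; first by case.
  by case=> /IH[-> ->].
by rewrite /idw -!catA /= -!catA => /H[-> /H[-> _]].
Qed.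

Lemma dl_code s y v : dl s = code y ++ v -> exists2 s', s = y :: s' & v = dl s'.
Proof.
have H n m (x z : seq bool) : nseq n true ++ false :: x = nseq m true ++ false :: z -> n = m /\ x = z.
  elim: n m => [|n IH] [|m] //=; first by case.
  by case=> /IH[-> ->].
case: s => [|z s] //; rewrite /dl /enc /= /code -!catA /= => -[] /H[e <-].
by exists s => //; congr (_ :: _); apply/enum_rank_inj/val_inj.
Qed.

Lemma dl_prefix s y : prefix (dl s) (code y) = false.
Proof.
apply/negP => /prefixP[v]; case: s => [|z s] //.
have H n m (x t : seq bool) : nseq n true ++ false :: x = nseq m true ++ false :: t -> n = m /\ x = t.
  elim: n m => [|n IH] [|m] //=; first by case.
  by case=> /IH[-> ->].
rewrite /dl /enc /= {1}/code -!catA /= {1}/code /= => -[] /H[_ /esym].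
by case: (flatten _).
Qed.

Lemma mem_number (T : eqType) (t : seq T) k x :
  (k, x) \in number t -> k < size t /\ forall y, nth y t k = x.
Proof.
move=> /(nthP (0, x))[i]; rewrite size_zip size_iota minnn => lt.
rewrite nth_zip ?size_iota // nth_iota // add0n => -[<- e].
by split=> // y; rewrite (set_nth_default x).
Qed.

Lemma number_mem (T : eqType) (t : seq T) k y : k < size t -> (k, nth y t k) \in number t.
Proof.
move=> lt; apply/(nthP (0, y)); exists k; first by rewrite size_zip size_iota minnn.
by rewrite nth_zip ?size_iota // nth_iota.
Qed.

Lemma number_inj (T : eqType) (t : seq T) k x y :
  (k, x) \in number t -> (k, y) \in number t -> x = y.
Proof. by move=> /mem_number[_ /(_ x) <-] /mem_number[_ /(_ x) <-]. Qed.

Lemma mem_sys_incs u i : i \in sys_incs u ->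
  (exists k x c r, [/\ (k, x) \in number u, (c, r) \in loop_rules x k & i = inc_of (idw c k) r]) \/
  (exists j, [/\ i.1.1 = idw 0 j,
     j = 0 -> i = (idw 0 0, [:: tN], [seq tm ([:: y], cN, 0) | y <- enum G]),
     j = 1 -> i = (idw 0 1, [:: (dl [:: y0], None)], [:: tm ([::], cI, 0); tN])
   & forall j', j = j'.+2 -> exists2 r, (j', r) \in number (const_rules (size u)) & i = inc_of (idw 0 j) r]).
Proof.
rewrite mem_cat => /orP[/flattenP[is_ /mapP[[k x] kx ->] /mapP[[c r] cr ->]]|].
  by left; exists k, x, c, r.
rewrite /const_incs in_cons in_cons => /or3P[/eqP->|/eqP->|/mapP[[j r] jr ->]]; right.
- by exists 0.
- by exists 1.
by exists j.+2; split=> // j' [<-]; exists r.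
Qed.

Lemma loop_rules_inj x k c r r' :
  (c, r) \in loop_rules x k -> (c, r') \in loop_rules x k -> c != 0 /\ r = r'.
Proof.
rewrite !inE => /orP[/eqP[-> ->]|/mapP[y _ [-> ->]]] /orP[/eqP[]|/mapP[z _ []]] //.
by move=> e ->; split=> //; congr rule_D; apply/enum_rank_inj/val_inj.
Qed.

Lemma sys_ids_code u i j a b : i \in sys_incs u -> j \in sys_incs u ->
  i.1.1 ++ a = j.1.1 ++ b -> i = j.
Proof.
move=> /mem_sys_incs[[k [x [c [r [kx cr ->]]]]]|[m [em m0 m1 m2]]].
  move=> /mem_sys_incs[[k' [x' [c' [r' [kx' cr' ->]]]]]|[m [em _ _ _]]].
    move/idw_code => [ec ek]; subst c' k'.
    have ex := number_inj kx kx'; subst x'.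
    by have [_ ->] := loop_rules_inj cr cr'.
  rewrite em => /idw_code[ec _]; have [c0 _] := loop_rules_inj cr cr.
  by rewrite ec in c0.
move=> /mem_sys_incs[[k' [x' [c' [r' [kx' cr' ->]]]]]|[m' [em' m0' m1' m2']]].
  rewrite em => /idw_code[ec _]; have [c0 _] := loop_rules_inj cr' cr'.
  by rewrite -ec in c0.
rewrite em em' => /idw_code[e]; subst m'.
case: m em em' m0 m1 m2 m0' m1' m2' => [|[|m]] em em' m0 m1 m2 m0' m1' m2'.
- by rewrite m0 // m0'.
- by rewrite m1 // m1'.
have [r r1 ->] := m2 _ erefl; have [r' r2 ->] := m2' _ erefl.
by rewrite (number_inj r1 r2).
Qed.

Lemma sys_ids0 u i : i \in sys_incs u -> i.1.1 != [::].
Proof.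
have H c k : idw c k != [::] by rewrite /idw; case: c.
by move/mem_sys_incs => [[k [x [c [r [_ _ ->]]]]]|[m [-> _ _ _]]]; apply: H.
Qed.

Lemma sys_R0 u i : i \in sys_incs u -> i.2 != [::].
Proof.
have H (r : seq bterm) t : rcons r t != [::] by case: r.
move/mem_sys_incs => [[k [x [c [r [_ _ ->]]]]]|[[|[|m]] [_ m0 m1 m2]]].
- exact: H.
- rewrite m0 //=; have : y0 \in enum G by rewrite mem_enum.
  by case: (enum G).
- by rewrite m1.
by have [r _ ->] := m2 _ erefl; apply: H.
Qed.

Lemma mem_loop_vars k B : k <= B -> {subset loop_vars k <= sys_vars B}.
Proof.
rewrite leq_eqVlt => /orP[/eqP->|lt] Z Zin; rewrite !mem_cat ?Zin ?orbT //.
apply/orP; left; apply/flattenP; exists (loop_vars k) => //.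
by apply: map_f; rewrite mem_iota.
Qed.

Lemma vI k B : k <= B -> nm cI k \in sys_vars B.
Proof. by move=> le; apply: mem_loop_vars le _ _; rewrite mem_head. Qed.
Lemma vD y k B : k <= B -> nm (cD y) k \in sys_vars B.
Proof.
move=> le; apply: mem_loop_vars le _ _; rewrite inE; apply/orP; right.
by apply/mapP; exists y; rewrite ?mem_enum.
Qed.
Lemma vN B : nm cN 0 \in sys_vars B.
Proof. by rewrite 2!mem_cat /const_vars mem_cat !inE eqxx !orbT. Qed.
Lemma vT B : nm cT 0 \in sys_vars B.
Proof. by rewrite 2!mem_cat /const_vars mem_cat !inE eqxx !orbT. Qed.
Lemma vQ q B : nm (cQ q) 0 \in sys_vars B.
Proof. by rewrite 2!mem_cat /const_vars 2!mem_cat [X in _ || (_ || (_ || (X || _)))]map_f ?mem_enum ?orbT. Qed.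
Lemma vO x B : nm (cO x) 0 \in sys_vars B.
Proof. by rewrite 2!mem_cat /const_vars 2!mem_cat [X in _ || (_ || (_ || (_ || X)))]map_f ?mem_enum ?orbT. Qed.

Lemma const_rulesP B r : r \in const_rules B ->
  r = (([::], cI, B), [:: ([::], cQ q0, 0)]) \/
  ((exists y, r = (([::], cD y, 0), [:: ([:: y], cT, 0)])) \/
   (exists q, r = (([::], cQ q, 0), [seq ([::], cO x, 0) | x <- opts q]))) \/
  ((exists x : Q * G * 'I_omax, r = (([::], cO x, 0), [:: ([::], cD x.1.2, B)])) \/
   (exists x, exists2 p, p \in branches x &
      r = (([:: p.2], cO x, 0), [:: ([::], cQ p.1, 0)]))).
Proof.
rewrite /const_rules in_cons !mem_cat => /orP[/eqP->|]; first by left.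
case/or4P => [/mapP[y _ ->]|/mapP[q _ ->]|/mapP[x _ ->]|/flattenP[rs /mapP[x _ ->] /mapP[p pin ->]]].
- by right; left; left; exists y.
- by right; left; right; exists q.
- by right; right; left; exists x.
by right; right; right; exists x, p.
Qed.

Lemma rule_vars u r t : r \in sys_rules u -> t \in r.1 :: r.2 -> nm t.1.2 t.2 \in sys_vars (size u).
Proof.
rewrite mem_cat => /orP[/flattenP[rs /mapP[[k x] /mem_number[lt _] ->]]|].
  case/mapP => -[c r'] crin ->; move: crin; rewrite /loop_rules /= !inE => /orP[/eqP[_ ->]|].
    by rewrite /rule_I /= !inE => /orP[]/eqP-> /=; apply: vI => //; apply: ltnW.
  case/mapP => y _ [_ ->] /= /orP[/eqP->|/mapP[g _ ->]]; apply: vD => //.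
  exact: ltnW.
case/const_rulesP => [->|[[[y ->]|[q ->]]|[[x ->]|[x [p _ ->]]]]] /=.
- by rewrite !inE => /orP[]/eqP->; [apply: vI | apply: vQ].
- by rewrite !inE => /orP[]/eqP->; [apply: vD | apply: vT].
- by rewrite inE => /orP[/eqP->|/mapP[x _ ->]]; [apply: vQ | apply: vO].
- by rewrite !inE => /orP[]/eqP->; [apply: vO | apply: vD].
by rewrite !inE => /orP[]/eqP->; [apply: vO | apply: vQ].
Qed.

Lemma loop_sys_rules u k x c r : (k, x) \in number u -> (c, r) \in loop_rules x k -> r \in sys_rules u.
Proof.
move=> kx cr; rewrite mem_cat; apply/orP; left; apply/flattenP.
exists (map snd (loop_rules x k)); first exact: (map_f (fun p : nat * G => map snd (loop_rules p.2 p.1)) kx).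
exact: (map_f snd cr).
Qed.

Lemma const_sys_rules u k r : (k, r) \in number (const_rules (size u)) -> r \in sys_rules u.
Proof.
by move=> /mem_number[lt /(_ r) e]; rewrite mem_cat -e mem_nth ?orbT.
Qed.

Lemma sys_vars_in u i t Z : i \in sys_incs u -> t \in i.1.2 ++ i.2 ->
  t.2 = Some Z -> Z \in sys_vars (size u).
Proof.
have H r : r \in sys_rules u -> t \in tm r.1 :: rcons (map tm r.2) tN -> t.2 = Some Z -> Z \in sys_vars (size u).
  move=> rin; rewrite inE mem_rcons inE => /or3P[/eqP->|/eqP->|/mapP[t' t'in ->]] [<-].
  - by apply: (rule_vars rin); rewrite mem_head.
  - exact: vN.
  by apply: (rule_vars rin); rewrite inE t'in orbT.
move/mem_sys_incs => [[k [x [c [r [kx cr ->]]]]]|[[|[|m]] [_ m0 m1 m2]]].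
- exact/H/(loop_sys_rules kx cr).
- rewrite m0 //= inE => /orP[/eqP->|/mapP[y _ ->]] [<-]; exact: vN.
- by rewrite m1 //= !inE => /or3P[]/eqP-> //= [<-]; [apply: vI | apply: vN].
have [r rin ->] := m2 _ erefl; exact/H/(const_sys_rules rin).
Qed.

Lemma sys_Ev B : nm cE 0 \notin sys_vars B.
Proof.
have lv k : nm cE 0 \notin loop_vars k.
  rewrite inE negb_or; apply/andP; split; first by apply/eqP => /nm_inj[].
  by apply/mapP => -[y _ /nm_inj[]].
apply/negP; rewrite /sys_vars /const_vars !mem_cat.
case/or3P => [/flattenP[s /mapP[k _ ->]]||/or3P[|/mapP[q _ /nm_inj[]]|/mapP[x _ /nm_inj[]]]] //.
- exact/negP.
- exact/negP.
by rewrite !inE => /orP[]/eqP/nm_inj[].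
Qed.

Definition rule_ok (st : cls -> nat -> seq G -> Prop) (r : rule) : Prop :=
  forall s, st r.1.1.2 r.1.2 s -> exists t s',
    [/\ t \in r.2, r.1.1.1 ++ s = t.1.1 ++ s' & st t.1.2 t.2 s'].

Lemma short_terms u r t : r \in sys_rules u -> t \in r.1 :: r.2 ->
  t.1.2 <> cN /\ size t.1.1 <= 1.
Proof.
rewrite mem_cat => /orP[/flattenP[rs /mapP[[k x] _ ->]]|].
  case/mapP => -[c r'] crin ->; move: crin; rewrite /loop_rules /= !inE => /orP[/eqP[_ ->]|].
    by rewrite /rule_I /= !inE => /orP[]/eqP->.
  by case/mapP => y _ [_ ->] /= /orP[/eqP->|/mapP[g _ ->]].
case/const_rulesP => [->|[[[y ->]|[q ->]]|[[x ->]|[x [p _ ->]]]]] /=.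
- by rewrite !inE => /orP[]/eqP->.
- by rewrite !inE => /orP[]/eqP->.
- by rewrite inE => /orP[/eqP->|/mapP[x _ ->]].
- by rewrite !inE => /orP[]/eqP->.
by rewrite !inE => /orP[]/eqP->.
Qed.

Lemma enc1 g : enc [:: g] = code g.
Proof. by rewrite /enc /= cats0. Qed.

Lemma dl_enc s g v : size g <= 1 -> dl s = enc g ++ v -> exists2 s', s = g ++ s' & v = dl s'.
Proof.
case: g => [|y [|]] // _; first by exists s.
by rewrite enc1 => /dl_code.
Qed.

Lemma dl_prefix_enc s g : size g <= 1 -> prefix (dl s) (enc g) = false.
Proof.
case: g => [|y [|]] // _; last by rewrite enc1 dl_prefix.
by rewrite prefixs0 /dl; case: enc.
Qed.

Lemma loop_rule_inc u r : r \in sys_rules u ->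
  exists id, (id, [:: tm r.1], rcons (map tm r.2) tN) \in sys_incs u.
Proof.
rewrite mem_cat => /orP[/flattenP[rs /mapP[[k x] kx ->] /mapP[[c r'] cr ->]]|rin].
  exists (idw c k); rewrite mem_cat; apply/orP; left; apply/flattenP.
  exists (loop_incs x k); first exact: (map_f (fun p : nat * G => loop_incs p.2 p.1) kx).
  exact: (map_f (fun p : nat * rule => inc_of (idw p.1 k) p.2) cr).
have lt : index r (const_rules (size u)) < size (const_rules (size u)) by rewrite index_mem.
have := number_mem r lt; rewrite nth_index // => h.
exists (idw 0 (index r (const_rules (size u))).+2).
rewrite mem_cat !inE; apply/orP; right; apply/or3P; constructor 3.
exact: (map_f (fun p : nat * rule => inc_of (idw 0 p.1.+2) p.2) h).
Qed.

Section Reduction.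
Variables (A : invAlphabet) (al be : A).
Hypothesis Hu : uniq [:: al; bar al; be; bar be].
Definition red_system (u : seq G) : system A :=
  incl_system al be (nm cE 0) (sys_vars (size u)) (sys_incs u).

(** In one direction only delimited words are considered, and [cN] contains none. In the other, [cN]
    consists of all prefixes of codes of letters; this is enough, since by [short_terms] a rule
    shifts by at most one letter. *)
Lemma solvable_rules u : solvable (red_system u) <->
  exists st n, [/\ forall c k s, st c k s -> size s <= n, st cI 0 [:: y0] &
    forall r, r \in sys_rules u -> rule_ok st r].
Proof.
split.
  case/(incl_system_sound Hu (@sys_ids_code u) (@sys_ids0 u) (@sys_vars_in u)) => Y [n [Yn HY]].
  pose st c k s := Y (nm c k) (dl s).
  have inN : (idw 0 0, [:: tN], [seq tm ([:: y], cN, 0) | y <- enum G]) \in sys_incs u.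
    by rewrite mem_cat in_cons eqxx orbT.
  have noN s : ~ st cN 0 s.
    elim: s => [|y s IH] ys.
      have [|t /mapP[y _ ->]] := HY _ (dl [::]) inN.
        by exists tN; rewrite ?mem_head //; right; exists (nm cN 0), (dl [::]).
      case=> [|[Z [v' [_ e _]]]]; first by rewrite (@dl_prefix_enc [::] [:: y]).
      by have [] := @dl_enc [::] [:: y] v' isT e.
    have [|t /mapP[z _ ->]] := HY _ (dl (y :: s)) inN.
      by exists tN; rewrite ?mem_head //; right; exists (nm cN 0), (dl (y :: s)).
    case=> [|[Z [v' [[<-] e h]]]]; first by rewrite (@dl_prefix_enc _ [:: z]).
    by have [s' [_ es] ev] := @dl_enc _ [:: z] v' isT e; apply: IH; rewrite /st es -ev.
  exists st, n; split.
  - move=> c k s /Yn; apply: leq_trans; rewrite /dl size_cat /=.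
    elim: s => // y s IH; rewrite /enc /= -/(enc s) !size_cat /=; lia.
  - have in1 : (idw 0 1, [:: (dl [:: y0], None)], [:: tm ([::], cI, 0); tN]) \in sys_incs u.
      by rewrite mem_cat in_cons in_cons eqxx !orbT.
    have [|t] := HY _ (dl [:: y0]) in1.
      by exists (dl [:: y0], None); rewrite ?mem_head //; left; rewrite prefix_refl.
    rewrite !inE => /orP[]/eqP-> [|[Z [v' [[<-] e h]]]].
    + by rewrite (@dl_prefix_enc _ [::]).
    + by rewrite /st e.
    + by rewrite (@dl_prefix_enc _ [::]).
    by case: (noN [:: y0]); rewrite /st e.
  move=> r rin s sr; have [id iin] := loop_rule_inc rin.
  have [_ s1] := short_terms rin (mem_head _ _).
  have dlc g : dl (g ++ s) = enc g ++ dl s by rewrite /dl /enc map_cat flatten_cat catA.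
  have [|t] := HY _ (dl (r.1.1.1 ++ s)) iin.
    by exists (tm r.1); rewrite ?mem_head //; right; exists (nm r.1.1.2 r.1.2), (dl s).
  rewrite [X in _ \in X]/= mem_rcons in_cons => /orP[/eqP->|/mapP[t' t'in ->]] H.
    case: H => [|[Z [v' [[<-] e h]]]]; first by rewrite (@dl_prefix_enc _ [::]).
    by case: (noN (r.1.1.1 ++ s)); rewrite /st e.
  have t'in2 : t' \in r.1 :: r.2 by rewrite inE t'in orbT.
  have [_ s2] := short_terms rin t'in2.
  case: H => [|[Z [v' [[<-] e h]]]]; first by rewrite (@dl_prefix_enc _ t'.1.1).
  by have [s' es ev] := @dl_enc _ t'.1.1 v' s2 e; exists t', s'; split=> //; rewrite /st -ev.
case=> st [n [stn st0 rules]].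
pose Y Z v := (exists c k s, [/\ Z = nm c k, v = dl s, st c k s & c <> cN]) \/
              (Z = nm cN 0 /\ exists x, prefix v (code x)).
(* A code has length at most [#|G| + 2]; the bound covers [n] codes with the end marker as well as
   the prefixes of one code. *)
pose n' := (n * (#|G| + 2) + #|G| + 5)%N.
apply: (@incl_system_complete _ _ _ Hu _ _ _ (@sys_vars_in u) (sys_Ev _) (@sys_R0 u) Y n').
  have sc x : size (code x) <= #|G| + 2.
    have lt : (enum_rank x : nat) < #|G| := ltn_ord _.
    have -> : size (code x) = (enum_rank x).+2 by rewrite /code size_cat size_nseq addn1.
    by rewrite addn2 !ltnS; apply: ltnW.
  move=> Z v [[c [k [s [_ -> /stn sn _]]]]|[_ [x /size_prefix]]].
    suff : size (dl s) <= size s * (#|G| + 2) + 1 by rewrite /n'; nia.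
    rewrite /dl size_cat leq_add2r; elim: s {sn} => // y s IH.
    by rewrite -[enc (y :: s)]/(code y ++ enc s) size_cat (mulSn (size s)) leq_add.
  by move=> h; apply: leq_trans h (leq_trans (sc x) _); rewrite /n'; lia.
have NY v x : prefix v (code x) -> forall R : seq bterm, inT Y (rcons R tN) v.
  move=> pv R; exists tN; first by rewrite mem_rcons mem_head.
  by right; exists (nm cN 0), v; split=> //; right; split=> //; exists x.
have ruleY r v id : r \in sys_rules u -> inT Y (inc_of id r).1.2 v -> inT Y (inc_of id r).2 v.
  move=> rin [t]; rewrite inE => /eqP-> H.
  have [nN s1] := short_terms rin (mem_head _ _).
  case: H => [pv|[Z [v' [[<-] -> [[c [k [s [/nm_inj[ec ek] -> h _]]]]|[/nm_inj[]//]]]]]].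
    have [x px] : exists x, prefix v (code x).
      move: pv; rewrite /tm [(_, _).1]/=; case: (r.1.1.1) s1 => [|x [|]] // _.
        by case: (v) => // _; exists y0.
      by rewrite enc1 => pv; exists x.
    exact: NY px _.
  rewrite -{}ec -{}ek in h; have [t' [s' [t'in es h']]] := rules _ rin _ h.
  have t'in2 : t' \in r.1 :: r.2 by rewrite inE t'in orbT.
  have [nN' _] := short_terms rin t'in2.
  exists (tm t'); first by rewrite mem_rcons in_cons map_f ?orbT.
  right; exists (nm t'.1.2 t'.2), (dl s'); split=> //; last by left; exists t'.1.2, t'.2, s'.
  have dlc g s1' : dl (g ++ s1') = enc g ++ dl s1' by rewrite /dl /enc map_cat flatten_cat catA.
  by rewrite /tm /= -!dlc es.
move=> i v /mem_sys_incs[[k [x [c [r [kx cr ->]]]]]|[[|[|m]] [_ m0 m1 m2]]].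
- exact/ruleY/(loop_sys_rules kx cr).
- rewrite m0 // => -[t]; rewrite inE => /eqP-> H.
  have [x px] : exists x, prefix v (code x).
    case: H => [|[Z [v' [[<-] -> [[c [k [s [/nm_inj[<- _] _ _]]]]//|[_ [x px]]]]]]]; last by exists x.
    by case: (v) => // _; exists y0.
  exists (tm ([:: x], cN, 0)); first by apply: map_f; rewrite mem_enum.
  by left; suff -> : (tm ([:: x], cN, 0)).1 = code x by []; exact: enc1.
- rewrite m1 // => -[t]; rewrite inE => /eqP-> [|[Z [v' []]]//].
  move=> /prefixP[z]; case: (lastP z) => [|z' b]; rewrite ?cats0.
    move=> e; exists (tm ([::], cI, 0)); first exact: mem_head.
    right; exists (nm cI 0), (dl [:: y0]); split=> //.
    by left; exists cI, 0, [:: y0].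
  rewrite -rcons_cat {1}/dl enc1 cats1 => /rcons_inj[e _].
  by apply: (NY v y0 _ [:: tm ([::], cI, 0)]); rewrite e prefix_prefix.
have [r rin ->] := m2 _ erefl; exact/ruleY/(const_sys_rules rin).
Qed.

Lemma iter_I st u s : (forall r, r \in sys_rules u -> rule_ok st r) ->
  forall k, k <= size u -> st cI 0 s -> st cI k (catrev (take k u) s).
Proof.
move=> ok; elim=> [|k IH] lt h; first by rewrite take0.
have {IH} h := IH (ltnW lt) h.
have rin : rule_I (nth y0 u k) k \in sys_rules u.
  by apply: (loop_sys_rules (c := 1) (number_mem y0 lt)); rewrite mem_head.
have [t [s' []]] := ok _ rin _ h; rewrite inE => /eqP-> /= e h'.
by rewrite (take_nth y0) // -cats1 catrev_catl /= e.
Qed.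

Lemma iter_D st u y : (forall r, r \in sys_rules u -> rule_ok st r) ->
  forall k s, k <= size u -> st (cD y) k s -> k < size s /\ nth y0 s k = y.
Proof.
move=> ok; elim=> [|k IH] s lt h.
  have rin : (([::], cD y, 0), [:: ([:: y], cT, 0)]) \in sys_rules u.
    rewrite mem_cat in_cons !mem_cat; apply/orP; right; apply/orP; right; apply/orP; left.
    exact: (map_f (fun y => (([::], cD y, 0), [:: ([:: y], cT, 0)]) : rule) (mem_enum _ _)).
  by have [t [s' []]] := ok _ rin _ h; rewrite inE => /eqP-> /= -> _.
have rin : rule_D y k \in sys_rules u.
  apply: (loop_sys_rules (c := (enum_rank y).+2) (number_mem y0 lt)).
  rewrite inE; apply/orP; right; apply/mapP; exists y => //; exact: mem_enum.
have [t [s' []]] := ok _ rin _ h; case/mapP => g _ -> /= -> h'.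
by have [lt' <-] := IH _ (ltnW lt) h'.
Qed.

(** Induction on [n - size s]: every branch of the chosen option lengthens the stack, so at the
    bound the option has no branches. *)
Lemma rules_accepts st n u : (forall c k s, st c k s -> size s <= n) ->
  (forall r, r \in sys_rules u -> rule_ok st r) ->
  forall q s, size u < size s -> st (cQ q) 0 s -> accepts q (rev (take (size u).+1 s)).
Proof.
move=> stn ok q s; move m : (n - size s) => d; elim: d q s m => [|d IH] q s m szs h.
all: have rin : (([::], cQ q, 0), [seq ([::], cO x, 0) | x <- opts q]) \in sys_rules u;
  first by rewrite mem_cat in_cons !mem_cat; apply/orP; right; apply/or4P; constructor 3;
    exact: (map_f (fun q => (([::], cQ q, 0), [seq ([::], cO x, 0) | x <- opts q]) : rule) (mem_enum _ _)).
all: have [t [s' []]] := ok _ rin _ h; case/mapP => x; rewrite mem_filter => /andP[/andP[/eqP xq xo] _] -> /= <- {s'} hO.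
all: have rin2 : (([::], cO x, 0), [:: ([::], cD x.1.2, size u)]) \in sys_rules u;
  first by rewrite mem_cat in_cons !mem_cat; apply/orP; right; apply/orP; right; apply/or4P; constructor 3;
    exact: (map_f (fun x : Q * G * 'I_omax => (([::], cO x, 0), [:: ([::], cD x.1.2, size u)]) : rule) (mem_enum _ _)).
all: have [t2 [s2 []]] := ok _ rin2 _ hO; rewrite inE => /eqP-> /= <- {s2} /(iter_D ok (leqnn _))[_ yE].
all: have br p : p \in branches x -> st (cQ p.1) 0 (p.2 :: s).
1,3: move=> pin; have rin3 : (([:: p.2], cO x, 0), [:: ([::], cQ p.1, 0)]) \in sys_rules u;
  [rewrite mem_cat in_cons !mem_cat; apply/orP; right; apply/orP; right; apply/or4P; constructor 4;
   apply/flattenP; exists [seq (([:: p.2], cO x, 0), [:: ([::], cQ p.1, 0)]) : rule | p <- branches x];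
   [exact: (map_f (fun x : Q * G * 'I_omax => [seq (([:: p.2], cO x, 0), [:: ([::], cQ p.1, 0)]) : rule | p <- branches x]) (mem_enum _ _))
   | exact: (map_f (fun p : Q * G => (([:: p.2], cO x, 0), [:: ([::], cQ p.1, 0)]) : rule) pin)]
  | by have [t3 [s3 []]] := ok _ rin3 _ hO; rewrite inE => /eqP-> /= <-].
all: rewrite (take_nth y0) // rev_rcons yE; apply: (Accepts (o := branches x));
  [by rewrite -xq; apply: mem_nth | move=> q' x' /br h'].
  by have := stn _ _ _ h'; rewrite /=; lia.
have -> : rcons (rev (take (size u) s)) x' = rev (take (size u).+1 (x' :: s)) by rewrite /= rev_cons.
by apply: IH => //=; lia.
Qed.

(* A stack is the history of the queue, latest letter first; the queue is made of its
   first B.+1 letters, so that the letter read is the one at index B. *)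
Definition closedL (B : nat) (LQ : seq (Q * seq G)) (LO : seq (Q * G * 'I_omax * seq G)) : Prop :=
  (forall q s, (q, s) \in LQ -> exists2 x, (x, s) \in LO & x \in opts q) /\
  (forall x s, (x, s) \in LO -> [/\ B < size s, nth y0 s B = x.1.2 &
      forall p, p \in branches x -> (p.1, p.2 :: s) \in LQ]).

(** An accepting derivation is a finite tree, because options have finitely many branches; its
    stacks are gathered in two lists. *)
Lemma accepts_closed q v B : accepts q v -> size v = B.+1 ->
  forall s, B < size s -> rev (take B.+1 s) = v ->
  exists LQ LO, (q, s) \in LQ /\ closedL B LQ LO.
Proof.
elim=> {q v} q y v o oin _ IH szv s lt e.
have yE : nth y0 s B = y by move: e; rewrite (take_nth y0) // rev_rcons => -[].
have vE : v = rev (take B s) by move: e; rewrite (take_nth y0) // rev_rcons => -[].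
have lt_o : index o (aq_delta q y) < omax.
  apply: leq_trans (@leq_bigmax _ (fun p : Q * G => size (aq_delta p.1 p.2)) (q, y)).
  by rewrite index_mem.
pose x : Q * G * 'I_omax := (q, y, Ordinal lt_o).
have brE : branches x = o by rewrite /branches /= nth_index.
have [LQ [LO [inQ clo]]] : exists LQ LO,
    (forall p, p \in o -> (p.1, p.2 :: s) \in LQ) /\ closedL B LQ LO.
  have : {subset o <= o} by [].
  elim: {1 3}o => [|p o' IHo] sub.
    by exists [::], [::]; split=> //; split.
  have [|LQ [LO [h1 [h2 h3]]]] := IHo; first by move=> z zin; apply: sub; rewrite inE zin orbT.
  have pin : (p.1, p.2) \in o by rewrite -surjective_pairing; apply: sub; rewrite mem_head.
  have [] := IH _ _ pin _ (p.2 :: s).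
  - by rewrite size_rcons -szv.
  - exact: ltnW.
  - by rewrite /= rev_cons vE.
  move=> LQ' [LO' [g1 [g2 g3]]]; exists (LQ' ++ LQ), (LO' ++ LO); split.
    move=> z; rewrite inE mem_cat => /orP[/eqP->|/h1->]; last by rewrite orbT.
    by rewrite g1.
  split=> [q1 s1|x1 s1]; rewrite mem_cat => /orP[].
  - by case/g2 => x1 xin xo; exists x1; rewrite // mem_cat xin.
  - by case/h2 => x1 xin xo; exists x1; rewrite // mem_cat xin orbT.
  - by case/g3 => a b c; split=> // z /c; rewrite mem_cat => ->.
  by case/h3 => a b c; split=> // z /c; rewrite mem_cat => ->; rewrite orbT.
exists ((q, s) :: LQ), ((x, s) :: LO); split; first exact: mem_head.
case: clo => h2 h3; split=> [q1 s1|x1 s1]; rewrite inE => /orP[].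
- case/eqP => -> ->; exists x; first exact: mem_head.
  by rewrite mem_filter mem_enum eqxx /= index_mem oin.
- by case/h2 => x1 xin xo; exists x1; rewrite // inE xin orbT.
- by case/eqP => -> ->; split=> // p; rewrite brE => /inQ h; rewrite inE h orbT.
by case/h3 => a b c; split=> // z /c h; rewrite inE h orbT.
Qed.

Lemma red_systemP u : solvable (red_system u) <-> accepts q0 (y0 :: u).
Proof.
rewrite solvable_rules; split.
  case=> st [n [stn st0 ok]].
  have := iter_I ok (leqnn _) st0; rewrite take_size => hI.
  have rin : (([::], cI, size u), [:: ([::], cQ q0, 0)]) \in sys_rules u.
    by rewrite mem_cat in_cons eqxx !orbT.
  have [t [s' []]] := ok _ rin _ hI; rewrite inE => /eqP-> /= <- hQ.
  have := rules_accepts stn ok (s := catrev u [:: y0]) _ hQ.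
  rewrite catrevE size_cat size_rev addn1 leqnn take_oversize; last by rewrite size_cat size_rev addn1.
  by rewrite rev_cat revK; apply.
move=> acc; pose s0 := rev (y0 :: u).
have szs0 : size s0 = (size u).+1 by rewrite size_rev.
have [|||LQ [LO [in0 [h2 h3]]]] := accepts_closed acc (B := size u) _ (s := s0).
- by [].
- by rewrite szs0.
- by rewrite take_oversize ?szs0 // revK.
(* The intended solution. [cD y] and [cT] contain only the remainders met while the letter at depth
   [size u] of a used stack is being reached. *)
pose st (c : cls) (k : nat) (s : seq G) : Prop := match c with
  | inl (inl (inl (false, _))) => False
  | inl (inl (inl (true, false))) => exists x s', (x, s') \in LO /\ s = drop (size u).+1 s'
  | inl (inl (inl (true, true))) => s = rev (y0 :: take k u)
  | inl (inl (inr y)) => k <= size u /\ exists x s',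
       [/\ (x, s') \in LO, x.1.2 = y & s = drop (size u - k) s']
  | inl (inr q) => (q, s) \in LQ
  | inr x => (x, s) \in LO
  end.
pose mxQ := \max_(p <- LQ) size p.2; pose mxO := \max_(p <- LO) size p.2.
exists st, (mxQ + mxO + (size u).+1).
have mQ q s : (q, s) \in LQ -> size s <= mxQ.
  by move=> h; apply: (@leq_bigmax_seq _ LQ xpredT (fun p => size p.2) _ h).
have mO x s : (x, s) \in LO -> size s <= mxO.
  by move=> h; apply: (@leq_bigmax_seq _ LO xpredT (fun p => size p.2) _ h).
split=> //.
- move=> [[[[[] []]|y]|q]|x] k s //=.
  + by move=> ->; rewrite size_rev /= size_take_min; lia.
  + by case=> x [s' [/mO h ->]]; rewrite size_drop; apply: leq_trans (leq_subr _ _) (leq_trans h _); lia.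
  + by case=> _ [x [s' [/mO h _ ->]]]; rewrite size_drop; apply: leq_trans (leq_subr _ _) (leq_trans h _); lia.
  + by move/mQ => h; apply: leq_trans h _; lia.
  by move/mO => h; apply: leq_trans h _; lia.
- by rewrite /st /= take0.
move=> r; rewrite mem_cat => /orP[/flattenP[rs /mapP[[k x] kx ->]]|].
  have [lt xE] := mem_number kx.
  case/mapP => -[c r']; rewrite inE => /orP[/eqP[_ ->]|/mapP[y _ [_ ->]]] -> s /=.
    move=> ->; eexists; eexists; split; [exact: mem_head | by [] |].
    by rewrite /= (take_nth y0) // xE -rcons_cons rev_rcons.
  case=> lt' [x' [s' [xin ey ->]]]; have [a b _] := h3 _ _ xin.
  exists ([:: nth y0 s' (size u - k.+1)], cD y, k), (drop (size u - k) s'); split=> //.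
  - by apply: map_f; rewrite mem_enum.
  - have -> : size u - k = (size u - k.+1).+1 by lia.
    by rewrite [RHS]/= -drop_nth //; apply: leq_ltn_trans (leq_subr _ _) a.
  by split; [apply: ltnW | exists x', s'].
case/const_rulesP => [->|[[[y ->]|[q ->]]|[[x ->]|[x [p pin ->]]]]] s /=.
- by move=> ->; eexists; eexists; split; [exact: mem_head | by [] |]; rewrite /= take_size.
- case=> _ [x [s' [xin ey ->]]]; have [a b _] := h3 _ _ xin.
  exists ([:: y], cT, 0), (drop (size u).+1 s'); split; first exact: mem_head.
    by rewrite subn0 (drop_nth y0) // b ey.
  by exists x, s'.
- case/h2 => x xin xo; exists ([::], cO x, 0), s; split=> //.
  exact: (map_f (fun x => ([::], cO x, 0) : sterm)).
- move=> xin; have [a b c] := h3 _ _ xin.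
  exists ([::], cD x.1.2, size u), s; split; [exact: mem_head | by [] |].
  by split=> //; exists x, s; rewrite subnn drop0.
move=> xin; have [a b c] := h3 _ _ xin.
exists ([::], cQ p.1, 0), (p.2 :: s); split; [exact: mem_head | by [] |].
exact: c.
Qed.
End Reduction.
End QueueSystem.

End QueueSystems.

(** * The text of the system is computable in polynomial time *)

Module Generator.
Import StackPrograms QueueMachines SetEquations QueueSystems.

Local Open Scope nat_scope.

Section Templates.
Variables (Sigma G : finType) (D : finType).
Definition psym : finType := (Sigma + D + G)%type.
Definition pS (a : Sigma) : psym := inl (inl a).
Definition pD (a : D) : psym := inl (inr a).
Definition pG (a : G) : psym := inr a.
Variable dm : psym.

(* A piece (s, b) denotes s, repeated k times if b, where k is the loop counter. *)
Definition piece : Type := (seq D * bool)%type.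
Definition peval (k : nat) (p : piece) : seq D :=
  if p.2 then flatten (nseq k p.1) else p.1.
Definition eval (k : nat) (ps : seq piece) : seq D := flatten (map (peval k) ps).

(** R3 holds the loop counter in unary and is restored from R4; R5 collects the output in
    reverse. *)
Definition emit1 (p : piece) : cmd psym :=
  if p.2 then Seq (Loop R3 (fun a => Seq (Pushes R5 (map pD p.1)) (Push R4 a))) (Mv _ R4 R3)
  else Pushes R5 (map pD p.1).
Definition emit (ps : seq piece) : cmd psym := foldr (fun p c => Seq (emit1 p) c) (Skip _) ps.
Definition cost1 (p : piece) : nat := 2 * size p.1 + 20.
Definition cost (ps : seq piece) : nat := (\sum_(p <- ps) cost1 p) + 1.

Lemma ex_rep s k l a b c o f g :
  ex (Loop R3 (fun x => Seq (Pushes R5 (map pD s)) (Push R4 x)))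
     (St a b c (nseq k dm) l o f g)
     (St a b c [::] (catrev (nseq k dm) l) (catrev (map pD (flatten (nseq k s))) o) f g)
     (k * (2 * size s + 6) + 1).
Proof.
elim: k l o => [|k IH] l o; first exact: ex_while0.
apply: (@ex_le _ _ _ _ (((2 * size s + 1) + 2) + (k * (2 * size s + 6) + 1) + 3)); last by lia.
apply: ex_loop => //=.
  by apply: ex_seq; [apply: ex_le (ex_pushes erefl) _; rewrite size_map | exact: ex_push].
by rewrite map_cat catrev_catl; apply: IH.
Qed.

Lemma catrev_nseq T m (x : T) n : catrev (nseq m x) (nseq n x) = nseq (m + n) x.
Proof. by rewrite catrevE rev_nseq nseqD. Qed.

Lemma ex_emit1 p k a b c o f g :
  ex (emit1 p) (St a b c (nseq k dm) [::] o f g)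
     (St a b c (nseq k dm) [::] (catrev (map pD (peval k p)) o) f g)
     (cost1 p * (k + 1)).
Proof.
case: p => s [] /=; rewrite /emit1 /peval /cost1 /=; last first.
  by apply: ex_le (ex_pushes erefl) _; rewrite size_map; lia.
apply: (@ex_le _ _ _ _ ((k * (2 * size s + 6) + 1) + (6 * k + 1))); last by nia.
apply: ex_seq (ex_rep _ _ _ _ _ _ _ _ _) _.
rewrite (catrev_nseq k dm 0) addn0.
have := @ex_mv _ R4 R3 (St a b c [::] (nseq k dm) (catrev (map pD (flatten (nseq k s))) o) f g) _ erefl erefl.
by rewrite /= size_nseq (catrev_nseq k dm 0) addn0.
Qed.

Lemma ex_emit ps k a b c o f g :
  ex (emit ps) (St a b c (nseq k dm) [::] o f g)
     (St a b c (nseq k dm) [::] (catrev (map pD (eval k ps)) o) f g)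
     (cost ps * (k + 1)).
Proof.
elim: ps o => [|p ps IH] o.
  by apply: ex_le (ex_skip _) _; rewrite /cost big_nil; lia.
apply: (@ex_le _ _ _ _ (cost1 p * (k + 1) + cost ps * (k + 1))); last first.
  by rewrite /cost big_cons; lia.
apply: ex_seq (ex_emit1 _ _ _ _ _ _ _ _) _.
by rewrite /eval /= map_cat catrev_catl; apply: IH.
Qed.

Variables (T : G -> seq piece) (F : seq piece).
(** A scan of the queue in which the counter grows with each letter; [F] is then printed with the
    counter equal to the length of the queue. Each part of the text that depends on the input has
    this shape. *)
Definition section_cmd : cmd psym :=
  Seq (Loop R1 (fun x => if x is inr x then
                 Seq (emit (T x)) (Seq (Push R3 dm) (Push R2 (pG x))) else Skip _))
  (Seq (emit F) (Seq (Mv _ R2 R1) (Tr R3 R4 (fun=> [::])))).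

Fixpoint loop_text (k : nat) (u : seq G) : seq D :=
  if u is x :: u' then eval k (T x) ++ loop_text k.+1 u' else [::].
Definition section_text (u : seq G) : seq D := loop_text 0 u ++ eval (size u) F.

Definition tcost : nat := \max_x cost (T x).

Lemma ex_section_loop u k a c o f g :
  ex (Loop R1 (fun x => if x is inr x then
                 Seq (emit (T x)) (Seq (Push R3 dm) (Push R2 (pG x))) else Skip _))
     (St a (map pG u) c (nseq k dm) [::] o f g)
     (St a [::] (catrev (map pG u) c) (nseq (size u + k) dm) [::]
         (catrev (map pD (loop_text k u)) o) f g)
     (size u * ((tcost + 7) * (k + size u + 1)) + 1).
Proof.
elim: u k c o => [|x u IH] k c o; first exact: ex_while0.
have cl : cost (T x) <= tcost by apply: (leq_bigmax x).
apply: (@ex_le _ _ _ _ ((cost (T x) * (k + 1) + (2 + 2)) +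
   (size u * ((tcost + 7) * (k.+1 + size u + 1)) + 1) + 3)); last first.
  rewrite /=; have -> : k.+1 + size u + 1 = k + (size u).+1 + 1 by lia.
  by rewrite (mulSn (size u)); move: (size u * _) => z; nia.
apply: ex_loop => //=.
  apply: ex_seq (ex_emit _ _ _ _ _ _ _ _) _.
  by apply: ex_seq; apply: ex_push.
rewrite map_cat catrev_catl.
by have := IH k.+1 (pG x :: c) (catrev (map pD (eval k (T x))) o); rewrite addnS.
Qed.

Lemma ex_section u a o f g :
  ex section_cmd (St a (map pG u) [::] [::] [::] o f g)
     (St a (map pG u) [::] [::] [::] (catrev (map pD (section_text u)) o) f g)
     ((tcost + cost F + 20) * ((size u + 1) * (size u + 1))).
Proof.
apply: (@ex_le _ _ _ _ ((size u * ((tcost + 7) * (0 + size u + 1)) + 1) +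
  (cost F * (size u + 1) + ((6 * size u + 1) + ((2 * 0 + 4) * size u + 1))))); last by nia.
apply: ex_seq (ex_section_loop _ 0 _ _ _ _ _) _; rewrite addn0.
apply: ex_seq (ex_emit _ _ _ _ _ _ _ _) _.
rewrite -catrev_catl -map_cat -/(section_text u).
apply: ex_seq.
  have := @ex_mv _ R2 R1 (St a [::] (catrev (map pG u) [::]) (nseq (size u) dm) [::]
     (catrev (map pD (section_text u)) o) f g) _ erefl erefl.
  rewrite /= [catrev (map pG u) _]catrevE cats0 size_rev size_map (catrevE (rev _)) revK cats0.
  exact.
have := @ex_tr _ R3 R4 (fun=> [::]) 0 (St a (map pG u) [::] (nseq (size u) dm) [::]
     (catrev (map pD (section_text u)) o) f g) _ erefl (fun=> leqnn 0) erefl.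
rewrite /= size_nseq (_ : flatten _ = [::]) //.
by elim: (nseq _ _).
Qed.
End Templates.

Section SystemText.
Variables (M : aqm) (q0 : aq_state M) (y0 : aq_sym M).
Variables (A : invAlphabet) (al be : A).
Local Notation Q := (aq_state M).
Local Notation G := (aq_sym M).
Local Notation cE := (inl (inl (inl (false, false)))).
Local Notation cN := (inl (inl (inl (false, true)))).
Local Notation cT := (inl (inl (inl (true, false)))).
Local Notation cI := (inl (inl (inl (true, true)))).
Local Notation cD y := (inl (inl (inr y))).
Local Notation cQ q := (inl (inr q)).
Local Notation cO x := (inr x).
Local Notation lt := (lt al be).

(** A term as a function of the counter [k]: two constant words, with [k] bits between them if the
    flag is set, and a variable whose index is a constant, possibly increased by [k]. *)
Definition ptm : Type := (seq bool * bool * seq bool * option (cls M * bool * nat))%type.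
Definition pval (k : nat) (p : ptm) : bterm :=
  (p.1.1.1 ++ nseq (p.1.1.2 * k) true ++ p.1.2,
   omap (fun c : cls M * bool * nat => nm c.1.1 (c.1.2 * k + c.2)) p.2).

Definition el (v : seq bool) : seq symbol := flatten [seq enc_letter (lt b) | b <- v].
Definition el' (v : seq bool) : seq symbol := flatten [seq enc_letter (bar (lt b)) | b <- rev v].
Definition var_pieces (o : option (cls M * bool * nat)) : seq (piece symbol) :=
  if o is Some (c, ik, e) then
    (VarMark :: map Bit (nseq (enum_rank c) true ++ [:: false]), false) ::
    nseq ik ([:: Bit true], true) ++ [:: (nseq e (Bit true), false)]
  else [::].
Definition pieces (p : ptm) : seq (piece symbol) :=
  (el p.1.1.1, false) :: nseq p.1.1.2 (el [:: true], true) ++ (el p.1.2, false) ::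
  var_pieces p.2 ++ (el' p.1.2, false) :: nseq p.1.1.2 (el' [:: true], true) ++
  [:: (el' p.1.1.1, false)].

Lemma el_cat u v : el (u ++ v) = el u ++ el v.
Proof. by rewrite /el map_cat flatten_cat. Qed.
Lemma el'_cat u v : el' (u ++ v) = el' v ++ el' u.
Proof. by rewrite /el' rev_cat map_cat flatten_cat. Qed.
Lemma el_nseq k : el (nseq k true) = flatten (nseq k (el [:: true])).
Proof. by elim: k => //= k IH; rewrite -cat1s el_cat IH. Qed.
Lemma el'_nseq k : el' (nseq k true) = flatten (nseq k (el' [:: true])).
Proof.
elim: k => // k IH; rewrite -[k.+1]addn1 nseqD el'_cat IH -[LHS]cat0s.
by rewrite addn1 /= .
Qed.
Lemma eval_cons k (p : piece symbol) ps : eval k (p :: ps) = peval k p ++ eval k ps.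
Proof. by []. Qed.
Lemma eval_cat k (ps qs : seq (piece symbol)) : eval k (ps ++ qs) = eval k ps ++ eval k qs.
Proof. by rewrite /eval map_cat flatten_cat. Qed.
Lemma eval_rep k (b : bool) (s : seq symbol) :
  eval k (nseq b (s, true)) = flatten (nseq (b * k) s).
Proof. by case: b; rewrite /eval /= ?mul1n ?cats0. Qed.

Lemma enc_word_cat (U V : eqn_word A var) : enc_word (U ++ V) = enc_word U ++ enc_word V.
Proof. by rewrite /enc_word map_cat flatten_cat. Qed.
Lemma enc_word_inl (w : seq A) : @enc_word A (map inl w) = flatten (map (@enc_letter A) w).
Proof. by rewrite /enc_word -map_comp. Qed.

(** A conjugate spells its word forwards and, with barred letters, backwards, so the pieces of the
    word recur in reverse order behind the variable. *)
Lemma eval_pieces k p : eval k (pieces p) = enc_word (term_word al be (pval k p)).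
Proof.
case: p => [[[w1 b] w2] o].
rewrite /pieces /= !(eval_cons, eval_cat) !eval_rep /peval /= cats0.
rewrite /term_word /conj /pval /= !enc_word_cat !enc_word_inl.
have e1 v : flatten (map (@enc_letter A) (map lt v)) = el v by rewrite /el -map_comp.
have e2 v : flatten (map (@enc_letter A) (bar_word (map lt v))) = el' v.
  by rewrite /bar_word /el' map_rev -!map_comp -map_rev.
rewrite e1 e2 !el_cat !el'_cat el_nseq el'_nseq -!catA; do 3 congr (_ ++ _).
congr (_ ++ _); case: o => [[[c ik] e]|] //=.
rewrite !(eval_cons, eval_cat) eval_rep /peval /= !cats0 /enc_word /= cats0 /enc_var /nm.
rewrite map_cat /= -catA /= map_cat /= nseqD map_cat !map_nseq.
congr (_ :: (_ ++ (_ :: (_ ++ _)))).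
by elim: (ik * k) => //= n ->.
Qed.

Lemma eval_terms k ps :
  eval k (flatten (map pieces ps)) = enc_word (side al be (map (pval k) ps)).
Proof.
elim: ps => [//|p ps IH]; rewrite -[flatten (map pieces (p :: ps))]/(pieces p ++ flatten (map pieces ps)).
rewrite eval_cat IH eval_pieces.
by rewrite /side /= enc_word_cat.
Qed.

Lemma loop_terms (TT : G -> seq ptm) k u :
  loop_text (fun x => flatten (map pieces (TT x))) k u =
  enc_word (side al be (flatten [seq map (pval p.1) (TT p.2) | p <- zip (iota k (size u)) u])).
Proof.
elim: u k => //= x u IH k; rewrite IH eval_terms /side map_cat flatten_cat.
by rewrite enc_word_cat.
Qed.

Definition pst : Type := (seq G * cls M * bool * nat)%type.
Definition inst (k : nat) (t : pst) : sterm M := (t.1.1.1, t.1.1.2, t.1.2 * k + t.2).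
Definition instr (k : nat) (r : pst * seq pst) : rule M := (inst k r.1, map (inst k) r.2).
Definition pN : pst := ([::], cN, false, 0).

Definition ploop (x : G) : seq (nat * (pst * seq pst)) :=
  (1, (([:: x], cI, true, 0), [:: ([::], cI, true, 1)])) ::
  [seq ((enum_rank y).+2 : nat, (([::], cD y, true, 1), [seq ([:: g], cD y, true, 0) | g <- enum G]))
  | y <- enum G].
Definition pconst : seq (pst * seq pst) :=
  (([::], cI, true, 0), [:: ([::], cQ q0, false, 0)]) ::
  [seq (([::], cD y, false, 0), [:: ([:: y], cT, false, 0)]) | y <- enum G] ++
  [seq (([::], cQ q, false, 0), [seq ([::], cO x, false, 0) | x <- opts q]) | q <- enum Q] ++
  [seq (([::], cO x, false, 0), [:: ([::], cD x.1.2, true, 0)]) | x <- enum {: Q * G * 'I_(omax M)}] ++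
  flatten [seq [seq (([:: p.2], cO x, false, 0), [:: ([::], cQ p.1, false, 0)]) | p <- branches x]
          | x <- enum {: Q * G * 'I_(omax M)}].

Lemma ploopE x k : loop_rules x k = [seq (p.1, instr k p.2) | p <- ploop x].
Proof.
rewrite /loop_rules /ploop /= /instr /inst /= !mul1n addn0 addn1; congr (_ :: _).
rewrite -[RHS]map_comp; apply: eq_map => y /=; rewrite /rule_D addn1 mul1n; congr (_, (_, _)).
by rewrite -[RHS]map_comp; apply: eq_map => g /=; rewrite mul1n addn0.
Qed.

Lemma pconstE B : const_rules q0 B = map (instr B) pconst.
Proof.
rewrite /const_rules /pconst /= /instr /inst /= !mul1n addn0; congr (_ :: _).
rewrite !map_cat -!map_comp; congr (_ ++ (_ ++ (_ ++ _))).
- by apply: eq_map => q /=; rewrite -map_comp.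
- by apply: eq_map => x /=; rewrite !mul1n !addn0.
by rewrite map_flatten -map_comp; congr flatten; apply: eq_map => x /=; rewrite -map_comp.
Qed.

Definition pid (c : nat) (t : pst) : ptm :=
  (nseq c true ++ [:: false], true, false :: enc t.1.1.1, Some (t.1.1.2, t.1.2, t.2)).
Definition pid0 (j : nat) (t : pst) : ptm :=
  (idw 0 j ++ enc t.1.1.1, false, [::], Some (t.1.1.2, t.1.2, t.2)).

Lemma pval_pid c k t : pval k (pid c t) = (idw c k ++ (tm (inst k t)).1, (tm (inst k t)).2).
Proof. by rewrite /pval /pid /tm /inst /= mul1n /idw -!catA /= -!catA. Qed.
Lemma pval_pid0 j k t : pval k (pid0 j t) = (idw 0 j ++ (tm (inst k t)).1, (tm (inst k t)).2).
Proof. by rewrite /pval /pid0 /tm /inst /= cats0. Qed.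

Lemma instN k : inst k pN = ([::], cN, 0).
Proof. by []. Qed.

Lemma shift_pid (pd : pst -> ptm) id k ts :
  (forall t, pval k (pd t) = (id ++ (tm (inst k t)).1, (tm (inst k t)).2)) ->
  shift id (map (@tm M) (map (inst k) ts)) = map (pval k) (map pd ts).
Proof. by move=> H; rewrite /shift -!map_comp; apply: eq_map => t /=; rewrite H. Qed.

Definition pvar (c : cls M) (ik : bool) : ptm := ([::], false, [::], Some (c, ik, 0)).
(** [T1] and [F1] are the templates of the left side of the first equation. [T2 b] and [F2 b] belong
    to the second equation, to its left side for [b = true] and to its right side for
    [b = false]. *)
Definition T1 (x : G) : seq ptm := pvar cI true :: [seq pvar (cD y) true | y <- enum G].
Definition F1 : seq ptm :=
  T1 y0 ++ ([:: pvar cN false; pvar cT false] ++ [seq pvar (cQ q) false | q <- enum Q] ++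
  [seq pvar (cO x) false | x <- enum {: Q * G * 'I_(omax M)}]) ++
  [:: pvar cE false; ([:: true], false, [::], Some (cE, false, 0));
      ([:: false], false, [::], Some (cE, false, 0))].
Definition T2 (b : bool) (x : G) : seq ptm :=
  flatten [seq [seq pid p.1 t | t <- nseq b p.2.1 ++ rcons p.2.2 pN] | p <- ploop x].
Definition F2 (b : bool) : seq ptm :=
  [seq pid0 0 t | t <- nseq b pN ++ [seq ([:: y], cN, false, 0) | y <- enum G]] ++
  (nseq b (idw 0 1 ++ dl [:: y0], false, [::], None) ++ [seq pid0 1 t | t <- [:: ([::], cI, false, 0); pN]]) ++
  flatten [seq [seq pid0 p.1.+2 t | t <- nseq b p.2.1 ++ rcons p.2.2 pN] | p <- number pconst].

Lemma number_map (S T : Type) (f : S -> T) s : number (map f s) = [seq (p.1, f p.2) | p <- number s].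
Proof.
rewrite /number size_map; elim: s 0 => //= x s IH n.
by rewrite IH.
Qed.

Lemma eq1L_text u :
  enc_word (side al be (eq1L (nm (cE : cls M) 0) (sys_vars M (size u)))) =
  section_text (fun x => flatten (map pieces (T1 x))) (flatten (map pieces F1)) u.
Proof.
rewrite /section_text loop_terms eval_terms -enc_word_cat /side -flatten_cat -map_cat.
congr enc_word; congr flatten; congr map.
have lv k x : [seq ([::], Some Z) : bterm | Z <- loop_vars M k] = map (pval k) (T1 x).
  rewrite /loop_vars /T1 /= /pval /= mul1n addn0; congr (_ :: _).
  by rewrite -!map_comp; apply: eq_map => y /=; rewrite mul1n addn0.
rewrite /eq1L /sys_vars /F1 !map_cat (lv _ y0) -!map_comp -!catA; congr (_ ++ _).
rewrite map_flatten -map_comp; congr flatten.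
have : [seq p.1 | p <- zip (iota 0 (size u)) u] = iota 0 (size u).
  by rewrite -/(unzip1 _) unzip1_zip ?size_iota.
by move=> e0; rewrite -{1}e0 -map_comp; apply: eq_map => p; apply: lv.
Qed.

Lemma flatten_flatten (T U : Type) (h : T -> seq (seq U)) s :
  flatten (flatten (map h s)) = flatten [seq flatten (h x) | x <- s].
Proof. by elim: s => //= x s <-; rewrite flatten_cat. Qed.

Lemma enc_instance2 (a b c d : eqn_word A var) : enc_instance [:: (a, b); (c, d)] =
  enc_alphabet A ++ EqnMark :: enc_word a ++ EqualMark :: enc_word b ++
  EqnMark :: enc_word c ++ EqualMark :: enc_word d.
Proof. by rewrite /enc_instance /= cats0 -!catA. Qed.

Lemma eq2_text (b : bool) u :
  enc_word (side al be (flatten [seq shift i.1.1 ((if b then i.1.2 else [::]) ++ i.2) | i <- sys_incs q0 y0 u])) =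
  section_text (fun x => flatten (map pieces (T2 b x))) (flatten (map pieces (F2 b))) u.
Proof.
rewrite /section_text loop_terms eval_terms -enc_word_cat /side -flatten_cat -map_cat.
congr enc_word; congr flatten; congr map.
have rl (pd : pst -> ptm) id k (r : pst * seq pst) :
  (forall t, pval k (pd t) = (id ++ (tm (inst k t)).1, (tm (inst k t)).2)) ->
  shift id ((if b then (inc_of id (instr k r)).1.2 else [::]) ++ (inc_of id (instr k r)).2) =
  map (pval k) (map pd (nseq b r.1 ++ rcons r.2 pN)).
  move=> H; rewrite -(shift_pid _ H) /inc_of /= !map_cat !map_rcons instN.
  by case: b.
rewrite /sys_incs map_cat flatten_cat; congr (_ ++ _).
  rewrite map_flatten -map_comp -/(number u).
  rewrite flatten_flatten; congr flatten; apply: eq_map => -[k x].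
  rewrite /T2 map_flatten -map_comp /comp /loop_incs ploopE -!map_comp; congr flatten.
  by apply: eq_map => p; apply: rl => t; apply: pval_pid.
have fl2 (h : incl -> seq bterm) (x y : incl) s :
    flatten (map h (x :: y :: s)) = h x ++ (h y ++ flatten (map h s)) by [].
rewrite /const_incs pconstE number_map fl2 /F2 [RHS]map_cat; congr (_ ++ _); last rewrite [RHS]map_cat; last congr (_ ++ _).
- rewrite -(shift_pid (id := idw 0 0)); last by move=> t; apply: pval_pid0.
  congr shift; rewrite !map_cat; congr (_ ++ _); first by case: (b).
  by rewrite -!map_comp; apply: eq_map => y.
- rewrite /shift map_cat [RHS]map_cat; congr (_ ++ _).
  have e : idw 0 1 ++ dl [:: y0] = (idw 0 1 ++ dl [:: y0]) ++ [::] by rewrite cats0.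
  by case: (b) => //; exact: (congr1 (fun z => [:: (z, None)]) e).
rewrite [RHS]map_flatten; move: (number pconst) => z; elim: z => // r z IHz.
have fl T (x : seq T) s : flatten (x :: s) = x ++ flatten s by [].
rewrite !map_cons !fl -IHz; congr (_ ++ _).
by apply: rl => t; apply: pval_pid0.
Qed.

Lemma red_text u : enc_instance (red_system q0 y0 al be u) =
  (enc_alphabet A ++ [:: EqnMark]) ++
  section_text (fun x => flatten (map pieces (T1 x)))
    (flatten (map pieces F1) ++
     [:: (EqualMark :: enc_word (side al be (eq1R (nm (cE : cls M) 0))) ++ [:: EqnMark], false)]) u ++
  section_text (fun x => flatten (map pieces (T2 true x)))
    (flatten (map pieces (F2 true)) ++ [:: ([:: EqualMark], false)]) u ++
  section_text (fun x => flatten (map pieces (T2 false x))) (flatten (map pieces (F2 false))) u.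
Proof.
have st T F (s : seq symbol) : section_text T (F ++ [:: (s, false)]) u = section_text T F u ++ s.
  by rewrite /section_text eval_cat catA; congr (_ ++ _); rewrite /eval /= cats0.
rewrite !st -eq1L_text -!eq2_text /red_system /incl_system enc_instance2.
move: (enc_word (side al be (eq1R _))) (enc_word (side al be (eq1L _ _))) => z z'.
rewrite /eq2L /eq2R /=; move: (enc_word (side _ _ (flatten [seq shift i.1.1 (i.1.2 ++ _) | i <- _]))) => z1.
by rewrite -!catA /= -!catA.
Qed.
End SystemText.

(** * Padding the input and assembling the reduction *)

Section Generator.
Variables (M : aqm) (q0 : aq_state M) (y0 : aq_sym M) (A : invAlphabet) (al be : A).
Variables (Sigma : finType) (lw : Sigma -> aq_sym M) (lpad : aq_sym M) (tail : seq (aq_sym M)).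
Variables (c d : nat).
Local Notation G := (aq_sym M).
Local Notation ps := (psym Sigma G symbol).
Local Notation inW := (@pS Sigma G symbol).
Local Notation inQ := (@pG Sigma G symbol).
Local Notation inO := (@pD Sigma G symbol).
Definition dm0 : ps := inQ lpad.

Definition npad (n : nat) : nat := c * n ^ d + c.
Definition gen_word (w : seq Sigma) : seq G :=
  map lw w ++ nseq (npad (size w)) lpad ++ tail.

(** Multiplies the unary number on R7 by the one on R3, which is kept; [d] repetitions starting from
    1 produce the power needed in [npad]. *)
Definition mult : cmd ps :=
  Seq (Loop R7 (fun _ => Seq (Loop R3 (fun a => Seq (Push R2 a) (Push R4 a))) (Mv _ R4 R3)))
      (Mv _ R2 R7).
Definition input_cmd : cmd ps :=
  Loop R0 (fun a => if a is inl (inl a) then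
             Seq (Push R6 (inQ (lw a))) (Push R3 dm0) else Skip _).
Definition pad_cmd : cmd ps :=
  Seq (Push R7 dm0) (Seq (iter d (fun k => Seq mult k) (Skip _))
  (Seq (Tr R7 R2 (fun a => nseq c a)) (Pushes R2 (nseq c dm0)))).
Definition build_cmd : cmd ps :=
  Seq (Pushes R1 (map inQ (rev tail)))
  (Seq (Mv _ R2 R1) (Seq (Mv _ R6 R1) (Tr R3 R4 (fun=> [::])))).

Definition sec1 := section_cmd dm0 (fun x => flatten (map (pieces al be) (T1 x)))
    (flatten (map (pieces al be) (F1 y0)) ++
     [:: (EqualMark :: enc_word (side al be (eq1R (nm (inl (inl (inl (false, false))) : cls M) 0))) ++ [:: EqnMark], false)]).
Definition sec2 := section_cmd dm0 (fun x => flatten (map (pieces al be) (T2 true x)))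
    (flatten (map (pieces al be) (F2 q0 y0 true)) ++ [:: ([:: EqualMark], false)]).
Definition sec3 := section_cmd dm0 (fun x => flatten (map (pieces al be) (T2 false x)))
    (flatten (map (pieces al be) (F2 q0 y0 false))).
Definition gen_cmd : cmd ps :=
  Seq (Seq input_cmd (Seq pad_cmd build_cmd))
  (Seq (Pushes R5 (map inO (enc_alphabet A ++ [:: EqnMark])))
  (Seq sec1 (Seq sec2 (Seq sec3 (Mv _ R5 R0))))).

Lemma ex_input_cmd w f k :
  ex input_cmd (St (map inW w) [::] [::] (nseq k dm0) [::] [::] f [::])
     (St [::] [::] [::] (nseq (size w + k) dm0) [::] [::] (catrev (map inQ (map lw w)) f) [::])
     (7 * size w + 1).
Proof.
elim: w f k => [|a w IH] f k; first exact: ex_while0.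
apply: (@ex_le _ _ _ _ ((2 + 2) + (7 * size w + 1) + 3)); last by rewrite /=; lia.
apply: ex_loop => //=; first by apply: ex_seq; apply: ex_push.
by have := IH (inQ (lw a) :: f) k.+1; rewrite addnS.
Qed.

Lemma ex_mult m n f :
  ex mult (St [::] [::] [::] (nseq n dm0) [::] [::] f (nseq m dm0))
     (St [::] [::] [::] (nseq n dm0) [::] [::] f (nseq (m * n) dm0))
     (m * (19 * n + 5) + 2).
Proof.
have E1 k z y g : ex (Loop R3 (fun a => Seq (Push R2 a) (Push R4 a)))
     (St [::] [::] (nseq z dm0) (nseq k dm0) (nseq y dm0) [::] f g)
     (St [::] [::] (nseq (k + z) dm0) [::] (nseq (k + y) dm0) [::] f g)
     (7 * k + 1).
  elim: k z y => [|k IH] z y; first exact: ex_while0.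
  apply: (@ex_le _ _ _ _ ((2 + 2) + (7 * k + 1) + 3)); last by lia.
  apply: ex_loop => //=; first by apply: ex_seq; apply: ex_push.
  by have := IH z.+1 y.+1; rewrite !addnS.
have E2 z : ex (Loop R7 (fun _ => Seq (Loop R3 (fun a => Seq (Push R2 a) (Push R4 a))) (Mv _ R4 R3)))
     (St [::] [::] (nseq z dm0) (nseq n dm0) [::] [::] f (nseq m dm0))
     (St [::] [::] (nseq (m * n + z) dm0) (nseq n dm0) [::] [::] f [::])
     (m * (13 * n + 5) + 1).
  elim: m z => [|m IH] z; first exact: ex_while0.
  apply: (@ex_le _ _ _ _ (((7 * n + 1) + (6 * n + 1)) + (m * (13 * n + 5) + 1) + 3)); last by lia.
  apply: ex_loop => //=.
    apply: ex_seq (E1 _ _ 0 _) _; rewrite addn0.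
    have := @ex_mv _ R4 R3 (St [::] [::] (nseq (n + z) dm0) [::] (nseq n dm0) [::] f (nseq m dm0)) _ erefl erefl.
    by rewrite /= size_nseq (catrev_nseq n dm0 0) addn0; apply.
  have -> : m.+1 * n + z = m * n + (n + z) by lia.
  exact: IH.
apply: (@ex_le _ _ _ _ ((m * (13 * n + 5) + 1) + (6 * (m * n) + 1))); last by nia.
apply: ex_seq (E2 0) _; rewrite addn0.
have := @ex_mv _ R2 R7 (St [::] [::] (nseq (m * n) dm0) (nseq n dm0) [::] [::] f [::]) _ erefl erefl.
by rewrite /= size_nseq (catrev_nseq (m * n) dm0 0) addn0; apply.
Qed.

Lemma ex_pow n f k m :
  ex (iter k (fun r => Seq mult r) (Skip _))
     (St [::] [::] [::] (nseq n dm0) [::] [::] f (nseq m dm0))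
     (St [::] [::] [::] (nseq n dm0) [::] [::] f (nseq (m * n ^ k) dm0))
     (k * (m * (n + 1) ^ k * (19 * n + 5) + 2) + 1).
Proof.
elim: k m => [|k IH] m; first by rewrite expn0 muln1; apply: ex_skip.
have p0 : 0 < (n + 1) ^ k by rewrite expn_gt0 addn1.
apply: (@ex_le _ _ _ _ ((m * (19 * n + 5) + 2) + (k * (m * n * (n + 1) ^ k * (19 * n + 5) + 2) + 1))).
  by apply: ex_seq (ex_mult _ _ _) _; rewrite expnS mulnA; apply: IH.
rewrite expnS; set x := (n + 1) ^ k in p0 *; set y := 19 * n + 5.
have le1 : m * y <= m * ((n + 1) * x) * y.
  by rewrite leq_mul2r leq_pmulr ?orbT // muln_gt0 p0 addn1.
have le2 : m * n * x * y <= m * ((n + 1) * x) * y.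
  by rewrite leq_mul2r -mulnA leq_mul2l leq_mul2r addn1 leqnSn !orbT.
rewrite (mulSn k); move: (m * y) (m * n * x * y) (m * ((n + 1) * x) * y) le1 le2 => a b e; nia.
Qed.

Definition gen_time (n : nat) : nat :=
  let B := n + npad n + size tail in
  (7 * n + 1) + (2 + (d * ((n + 1) ^ d * (19 * n + 5) + 2) + 1) + ((2 * c + 4) * n ^ d + 1)
   + (2 * c + 1)) + ((2 * size tail + 1) + (6 * npad n + 1) + (6 * n + 1) + (4 * n + 1)).

Lemma ex_build_all w :
  ex (Seq input_cmd (Seq pad_cmd build_cmd))
     (St (map inW w) [::] [::] [::] [::] [::] [::] [::])
     (St [::] (map inQ (gen_word w)) [::] [::] [::] [::] [::] [::])
     (gen_time (size w)).
Proof.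
set n := size w; set rw := catrev (map inQ (map lw w)) [::].
apply: (@ex_le _ _ _ _ ((7 * n + 1) + ((2 + ((d * (1 * (n + 1) ^ d * (19 * n + 5) + 2) + 1) +
   (((2 * c + 4) * n ^ d + 1) + (2 * c + 1)))) +
   ((2 * size tail + 1) + ((6 * npad n + 1) + ((6 * n + 1) + ((2 * 0 + 4) * n + 1))))))); last first.
  by rewrite /gen_time mul1n; lia.
apply: (ex_seq (ex_input_cmd w [::] 0)); rewrite addn0 -/n -/rw.
apply: (ex_seq (s' := St [::] [::] (nseq (npad n) dm0) (nseq n dm0) [::] [::] rw [::])).
  apply: ex_seq; first exact: ex_push.
  apply: ex_seq (ex_pow n _ _ 1) _; rewrite mul1n.
  apply: ex_seq.
    have := @ex_tr _ R7 R2 (fun a => nseq c a) c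
      (St [::] [::] [::] (nseq n dm0) [::] [::] rw (nseq (n ^ d) dm0)) _ erefl _ erefl.
    rewrite /= size_nseq; apply => a; by rewrite size_nseq.
  apply: ex_le (ex_pushes _) _; last by rewrite size_nseq.
  rewrite /= /npad; congr St.
  have -> : flatten [seq nseq c a | a <- nseq (n ^ d) dm0] = nseq (c * n ^ d) dm0.
    by elim: (n ^ d) => [|k IH] /=; rewrite ?muln0 // IH mulnS nseqD.
  by rewrite (catrev_nseq _ dm0 0) addn0 catrev_nseq addnC.
apply: ex_seq; first by apply: ex_le (ex_pushes erefl) _; rewrite size_map size_rev.
rewrite map_rev catrevE revK /= cats0.
apply: ex_seq.
  have := @ex_mv _ R2 R1 (St [::] (map inQ tail) (nseq (npad n) dm0) (nseq n dm0) [::] [::] rw [::]) _ erefl erefl.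
  rewrite /= size_nseq; exact.
have szr : size rw = n by rewrite /rw catrevE cats0 size_rev !size_map.
apply: ex_seq.
  have := @ex_mv _ R6 R1 (St [::] (catrev (nseq (npad n) dm0) (map inQ tail)) [::] (nseq n dm0) [::] [::] rw [::]) _ erefl erefl.
  by rewrite /= szr; apply.
have := @ex_tr _ R3 R4 (fun=> [::]) 0 (St [::] (catrev rw (catrev (nseq (npad n) dm0) (map inQ tail))) [::] (nseq n dm0) [::] [::] [::] [::]) _ erefl (fun=> leqnn 0) erefl.
rewrite /= size_nseq (_ : flatten _ = [::]); last by elim: (nseq _ _).
suff -> : catrev rw (catrev (nseq (npad n) dm0) (map inQ tail)) = map inQ (gen_word w) by [].
rewrite /rw !catrevE cats0 revK rev_nseq /gen_word !map_cat map_nseq.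
by [].
Qed.

Lemma size_eval (D : finType) k (l : seq (piece D)) : size (eval k l) <= cost l * (k + 1).
Proof.
elim: l => [|p l IH]; first by [].
rewrite /eval /= size_cat /cost big_cons; have le : size (peval k p) <= cost1 p * (k + 1).
  rewrite /peval /cost1; case: p.2; last by nia.
  rewrite size_flatten /shape map_nseq sumnE big_nseq iter_addn addn0; nia.
by move: IH; rewrite /cost /eval; lia.
Qed.

Lemma size_section (H D : finType) (T : H -> seq (piece D)) F u :
  size (section_text T F u) <= (tcost T + cost F + 20) * ((size u + 1) * (size u + 1)).
Proof.
have le k v : size (loop_text T k v) <= size v * (tcost T * (k + size v + 1)).
  elim: v k => [//|x v IH] k /=; rewrite size_cat.
  have cl : cost (T x) <= tcost T by apply: (leq_bigmax x).
  have := IH k.+1; have := size_eval k (T x).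
  have -> : k.+1 + size v + 1 = k + (size v).+1 + 1 by lia.
  rewrite (mulSn (size v)); move: (size v * _) => z; nia.
rewrite /section_text size_cat; have := le 0 u; have := size_eval (size u) F; nia.
Qed.

Lemma gen_poly_time :
  poly_time (fun w => enc_instance (red_system q0 y0 al be (gen_word w))).
Proof.
pose c0 := size (enc_alphabet A ++ [:: EqnMark]).
pose K1 := tcost (fun x => flatten (map (pieces al be) (T1 (M := M) x))) +
  cost (flatten (map (pieces al be) (F1 y0)) ++
     [:: (EqualMark :: enc_word (side al be (eq1R (nm (inl (inl (inl (false, false))) : cls M) 0))) ++ [:: EqnMark], false)]) + 20.
pose K2 := tcost (fun x => flatten (map (pieces al be) (T2 (M := M) true x))) +
  cost (flatten (map (pieces al be) (F2 q0 y0 true)) ++ [:: ([:: EqualMark], false)]) + 20.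
pose K3 := tcost (fun x => flatten (map (pieces al be) (T2 (M := M) false x))) +
  cost (flatten (map (pieces al be) (F2 q0 y0 false))) + 20.
pose K := K1 + K2 + K3.
pose B n := n + npad n + size tail.
(* The text is no longer than [c0] plus the time bounds of the three sections, and its final
   transfer costs 6 steps per letter: 1 + 6 for the sections, 2 + 6 for the constant beginning. *)
exists (fun n => gen_time n + (8 * c0 + 3) + 7 * K * ((B n + 1) * (B n + 1)) + 1).
  rewrite /gen_time /B /npad.
  by do !first [exact: poly_bounded_const | exact: poly_bounded_id | apply: poly_boundedD
     | apply: poly_boundedM | apply: poly_boundedX].
apply: (stack_computes (c := gen_cmd) (i := inW) (o := inO)); [by move=> ? ? [] | by move=> ? ? [] |].
move=> w; set u := gen_word w; have szu : size u = B (size w).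
  by rewrite /u /gen_word !size_cat size_map size_nseq /B addnA.
set txt := enc_instance _.
pose t1 := K1 * ((size u + 1) * (size u + 1)); pose t2 := K2 * ((size u + 1) * (size u + 1)).
pose t3 := K3 * ((size u + 1) * (size u + 1)).
have szt : size txt <= c0 + (t1 + (t2 + t3)).
  rewrite /txt red_text size_cat; apply: leq_add; first exact: leqnn.
  rewrite size_cat; apply: leq_add; first exact: size_section.
  by rewrite size_cat; apply: leq_add; exact: size_section.
have [t lt E] : ex gen_cmd (St (map inW w) [::] [::] [::] [::] [::] [::] [::])
    (St (map inO txt) (map inQ u) [::] [::] [::] [::] [::] [::])
    (gen_time (size w) + ((2 * c0 + 1) + (t1 + (t2 + (t3 + (6 * size txt + 1)))))).
  apply: ex_seq (ex_build_all w) _; rewrite -/u.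
  apply: ex_seq; first by apply: ex_le (ex_pushes erefl) _; rewrite size_map.
  apply: ex_seq (ex_section _ _ _ _ _ _ _ _) _; rewrite -catrev_catl -map_cat.
  apply: ex_seq (ex_section _ _ _ _ _ _ _ _) _; rewrite -catrev_catl -map_cat.
  apply: ex_seq (ex_section _ _ _ _ _ _ _ _) _; rewrite -catrev_catl -map_cat.
  rewrite -2!catA -(red_text q0 y0 al be u) -/txt.
  have := @ex_mv _ R5 R0 (St [::] (map inQ u) [::] [::] [::] (catrev (map inO txt) [::]) [::] [::]) _ erefl erefl.
  rewrite /= [catrev (map inO txt) [::]]catrevE cats0 size_rev size_map (catrevE (rev _)) revK cats0.
  exact.
eexists; exists t; split; [exact: E | | by []].
apply: leq_ltn_trans lt _; rewrite -szu.
have -> : 7 * K * ((size u + 1) * (size u + 1)) = 7 * (t1 + t2 + t3).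
  by rewrite /t1 /t2 /t3 /K -2!mulnDl [RHS]mulnA.
by lia.
Qed.
End Generator.

End Generator.

(** * Which texts encode an instance *)

Module InstanceTexts.

Local Open Scope nat_scope.

Definition tok : Type := (nat + var + bool)%type.
Definition tL (k : nat) : tok := inl (inl k).
Definition tEqn : tok := inr false.
Definition tEqual : tok := inr true.
Definition enc_tok (t : tok) : seq symbol :=
  match t with
  | inl (inl k) => LetterMark :: map Bit (nseq k true)
  | inl (inr Z) => VarMark :: map Bit Z
  | inr false => [:: EqnMark]
  | inr true => [:: EqualMark]
  end.
Definition enc_toks (ts : seq tok) : seq symbol := flatten (map enc_tok ts).

Definition rword : Type := seq (nat + var).
Definition eqn_toks (e : rword * rword) : seq tok :=
  tEqn :: map inl e.1 ++ tEqual :: map inl e.2.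
Definition eqns_toks (es : seq (rword * rword)) : seq tok := flatten (map eqn_toks es).
Definition toks_of (tb : seq nat) (es : seq (rword * rword)) : seq tok :=
  map tL tb ++ eqns_toks es.

Lemma enc_toks_cat ts us : enc_toks (ts ++ us) = enc_toks ts ++ enc_toks us.
Proof. by rewrite /enc_toks map_cat flatten_cat. Qed.
Lemma enc_toks_cons t ts : enc_toks (t :: ts) = enc_tok t ++ enc_toks ts.
Proof. by []. Qed.

(** * Reading a text *)

Definition sym (T : seq symbol) (i : nat) : option symbol := nth None (map Some T) i.
Fixpoint bits (r : seq symbol) : seq bool := if r is Bit b :: r' then b :: bits r' else [::].
Definition cont (T : seq symbol) (i : nat) : seq bool := bits (drop i.+1 T).
Definition rank (T : seq symbol) (i : nat) : nat := count_mem LetterMark (take i T).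
(** The letter marks in front of the first equation are the entries of the table of the involution,
    and [rank] is then the index of the entry. *)
Definition entry (T : seq symbol) (i : nat) : bool :=
  (sym T i == Some LetterMark) && (EqnMark \notin take i T).

Lemma sym_lt T i x : sym T i = Some x -> i < size T.
Proof.
by rewrite /sym => h; rewrite ltnNge; apply/negP => le; move: h; rewrite nth_default ?size_map.
Qed.
Lemma sym_size T i : size T <= i -> sym T i = None.
Proof. by move=> le; rewrite /sym nth_default ?size_map. Qed.
Lemma sym_some T i : i < size T -> exists x, sym T i = Some x.
Proof. by case: T => // y T lt; exists (nth y (y :: T) i); rewrite /sym (nth_map y). Qed.
Lemma sym_drop T i : sym T i = ohead (drop i T).
Proof. by elim: T i => [|x T IH] [|i] //=; apply: IH. Qed.
Lemma drop_sym T i x : sym T i = Some x -> drop i T = x :: drop i.+1 T.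
Proof.
elim: T i => [|y T IH] [|i] //=; first by case=> ->; rewrite drop0.
exact: IH.
Qed.
Lemma sym_cat T U i : sym (T ++ U) i = if i < size T then sym T i else sym U (i - size T).
Proof. by rewrite /sym map_cat nth_cat size_map. Qed.
Lemma cont_cat T U i : size T <= i -> cont (T ++ U) i = cont U (i - size T).
Proof. by move=> le; rewrite /cont drop_cat ltnNge (leqW le) /= subSn. Qed.
Lemma bits_toks ts : bits (enc_toks ts) = [::].
Proof. by case: ts => [|[[k|Z]|[]] ts]. Qed.
Lemma bits_cat bs r : bits (map Bit bs ++ r) = bs ++ bits r.
Proof. by elim: bs => //= b bs ->. Qed.

Lemma sym_tok t i x : sym (enc_tok t) i.+1 = Some x -> exists b, x = Bit b.
Proof.
have E s j y : sym (map Bit s) j = Some y -> exists b, y = Bit b.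
  elim: s j => [|b s IH] [|j] //=; first by case=> <-; exists b.
  exact: IH.
case: t => [[k|Z]|[]]; [exact: E | exact: E | |]; by case: i.
Qed.

Lemma letter_tok ts i : sym (enc_toks ts) i = Some LetterMark ->
  exists2 k, tL k \in ts & cont (enc_toks ts) i = nseq k true.
Proof.
elim: ts i => [|t ts IH] i; first by case: i.
rewrite enc_toks_cons sym_cat; case: ltnP => [lt|ge].
  case: i lt => [|i] lt; last by move/sym_tok => -[].
  case: t lt => [[k|Z]|[]] // _ _; exists k; first exact: mem_head.
  by rewrite /cont /= drop0 bits_cat bits_toks cats0.
move=> /IH[k kin e]; exists k; first by rewrite inE kin orbT.
by rewrite cont_cat.
Qed.

Lemma tok_letter ts k : tL k \in ts ->
  exists2 i, sym (enc_toks ts) i = Some LetterMark & cont (enc_toks ts) i = nseq k true.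
Proof.
elim: ts => [//|t ts IH]; rewrite enc_toks_cons inE.
case/orP => [/eqP <-|/IH[i s c]].
  by exists 0 => //; rewrite /cont /= drop0 bits_cat bits_toks cats0.
exists (size (enc_tok t) + i); first by rewrite sym_cat ltnNge leq_addr addKn.
by rewrite cont_cat ?leq_addr // addKn.
Qed.

Lemma rank_cat T U i : size T <= i -> rank (T ++ U) i = count_mem LetterMark T + rank U (i - size T).
Proof. by move=> le; rewrite /rank take_cat ltnNge le /= count_cat. Qed.

Lemma count_letter k : count_mem LetterMark (enc_tok (tL k)) = 1.
Proof. have -> : count_mem LetterMark (enc_tok (tL k)) = 1 + count_mem LetterMark (map Bit (nseq k true)).
  by rewrite /= eqxx.
by rewrite (count_memPn _) //; apply/negP => /mapP[]. Qed.

Definition tail_toks (us : seq tok) : bool := if us is t :: _ then t == tEqn else true.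

Lemma entry_tail us i : tail_toks us -> ~~ entry (enc_toks us) i.
Proof.
case: us => [|t us]; first by rewrite /entry /sym /= nth_nil.
by move=> /eqP ->; rewrite /entry enc_toks_cons; case: i => [|i]; apply/negP => /andP[]; [move=> /eqP | rewrite /= inE eqxx].
Qed.

Lemma tok_letter_free k : EqnMark \notin enc_tok (tL k).
Proof. by apply/negP; rewrite /= inE => /orP[/eqP|/mapP[]]. Qed.

Lemma entry_tok tb us i : tail_toks us -> entry (enc_toks (map tL tb ++ us)) i ->
  rank (enc_toks (map tL tb ++ us)) i < size tb /\
  cont (enc_toks (map tL tb ++ us)) i = nseq (nth 0 tb (rank (enc_toks (map tL tb ++ us)) i)) true.
Proof.
move=> tu; elim: tb i => [|k tb IH] i; first by rewrite (negPf (entry_tail _ tu)).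
rewrite map_cons cat_cons enc_toks_cons; case: (leqP (size (enc_tok (tL k))) i) => [ge|lt].
  rewrite rank_cat // cont_cat // count_letter add1n => h; apply: IH.
  move: h; rewrite /entry sym_cat ltnNge ge => /andP[-> ].
  by rewrite take_cat ltnNge ge mem_cat negb_or => /andP[].
rewrite /entry sym_cat lt; case: i lt => [|i] lt.
  by rewrite /rank take0 /= /cont /= drop0 bits_cat bits_toks cats0.
by case/andP => /eqP /sym_tok[].
Qed.

Lemma tok_entry tb us j : j < size tb ->
  exists2 i, entry (enc_toks (map tL tb ++ us)) i & rank (enc_toks (map tL tb ++ us)) i = j.
Proof.
elim: tb j => [//|k tb IH] [|j] lt.
  by exists 0; rewrite /rank ?take0 // /entry take0 andbT.
have [i e r] := IH j lt; exists (size (enc_tok (tL k)) + i);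
  rewrite map_cons cat_cons enc_toks_cons; last first.
  by rewrite rank_cat ?leq_addr // count_letter addKn r.
move: e; rewrite /entry sym_cat ltnNge leq_addr addKn take_cat ltnNge leq_addr addKn mem_cat.
case/andP => -> n; by rewrite negb_or n andbT; apply: tok_letter_free.
Qed.

(** * The format automaton *)

Definition fst_t : finType := (option bool * option bool)%type.
(* The first component is the part being read (table, left side, right side), the
   second one tells whether the current token is a letter or a variable. *)
Definition fstep (st : fst_t) (s : symbol) : option fst_t :=
  match s with
  | Bit b => if st.2 is Some v then if v || b then Some st else None else None
  | LetterMark => Some (st.1, Some false)
  | VarMark => if st.1 is None then None else Some (st.1, Some true)
  | EqnMark => if st.1 is Some false then None else Some (Some false, None)
  | EqualMark => if st.1 is Some false then Some (Some true, None) else None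
  end.
Fixpoint fmt (st : fst_t) (T : seq symbol) : bool :=
  if T is s :: T' then if fstep st s is Some st' then fmt st' T' else false
  else st.1 != Some false.

Definition enc_rword (w : rword) : seq symbol := enc_toks (map inl w).

Lemma fmt_bits p v bs r : (v || all id bs) -> fmt (p, Some v) (map Bit bs ++ r) = fmt (p, Some v) r.
Proof.
elim: bs => //= b bs IH h; rewrite (_ : v || b); last by case: (v) h => //= /andP[].
by apply: IH; case: (v) h => //= /andP[].
Qed.

Lemma fmt_word p (w : rword) r l : (forall l', fmt (p, l') r) ->
  (p = None -> forall Z, inr Z \notin w) -> fmt (p, l) (enc_rword w ++ r).
Proof.
move=> hr; elim: w l => [|[k|Z] w IH] l hp //.
  rewrite /enc_rword /= /enc_toks /= -catA fmt_bits ?all_nseq ?orbT //; apply: IH => pn Y.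
  by have := hp pn Y; rewrite inE negb_or => /andP[].
rewrite /enc_rword /= /enc_toks /= -catA; case: p hr hp IH => [b|] hr hp IH; last first.
  by have := hp erefl Z; rewrite inE eqxx.
by rewrite fmt_bits //; apply: IH.
Qed.

Lemma enc_eqns_cons U V es : enc_toks (eqns_toks ((U, V) :: es)) =
  EqnMark :: enc_rword U ++ EqualMark :: enc_rword V ++ enc_toks (eqns_toks es).
Proof.
rewrite /eqns_toks /= -/(eqns_toks es) enc_toks_cons /= -catA enc_toks_cat.
by congr (_ :: (_ ++ _)); rewrite cat_cons enc_toks_cons enc_toks_cat.
Qed.

Lemma fmt_eqns es l p : p != Some false -> fmt (p, l) (enc_toks (eqns_toks es)).
Proof.
elim: es l p => [|[U V] es IH] l p np //.
rewrite enc_eqns_cons /=.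
have -> : (if p is Some false then None else Some (Some false, None : option bool))
  = Some (Some false, None : option bool) by case: p np => [[]|].
apply: fmt_word => // l' /=.
by apply: fmt_word => // l2; apply: IH.
Qed.

Lemma fmt_toks tb es : fmt (None, None) (enc_toks (toks_of tb es)).
Proof.
rewrite /toks_of enc_toks_cat.
have -> : map tL tb = map inl (map inl tb : rword) by rewrite -map_comp.
apply: fmt_word => [l|_ Z]; first exact: fmt_eqns.
by apply/negP => /mapP[].
Qed.

(** Splits off one word: [bs] completes the token being read, [w] contains the tokens after it, and
    [r] starts with the mark that ends the word. *)
Lemma fmt_parse p l T : fmt (p, l) T ->
  exists bs (w : rword) r, [/\ T = map Bit bs ++ enc_rword w ++ r,
    (l = None -> bs = [::]) /\ (l = Some false -> all id bs),
    (p = None -> exists tb, w = map inl tb),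
    size r <= size T &
    if p is Some false then exists2 r', r = EqualMark :: r' & fmt (Some true, None) r'
    else r = [::] \/ exists2 r', r = EqnMark :: r' & fmt (Some false, None) r'].
Proof.
elim: T p l => [|s T IH] p l.
  move=> h; exists [::], [::], [::]; split=> //; first by exists [::].
  by case: p h => [[]|] //; left.
case: s => [b| | | |] /=.
- case: l => [v|//]; case: ifP => // vb /IH[bs [w [r [-> [h1 h2] hp sz hr]]]].
  exists (b :: bs), w, r; split=> //; last by apply: leq_trans sz _.
  by split=> // -[v0]; move: vb h2; rewrite v0 /= => -> ->.
- move=> /IH[bs [w [r [-> [_ h2] hp sz hr]]]].
  exists [::], (inl (size bs) :: w), r; split=> //; last exact: leq_trans sz _.
    rewrite [enc_rword (_ :: _)]enc_toks_cons /= -catA.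
    by rewrite -(_ : bs = nseq (size bs) true) //; apply/all_pred1P/sub_all/h2 => // -[].
  by move=> /hp[tb ->]; exists (size bs :: tb).
- case: p => [p|//] /IH[bs [w [r [-> _ hp sz hr]]]].
  exists [::], (inr bs :: w), r; split=> //; last exact: leq_trans sz _.
  by rewrite [enc_rword (_ :: _)]enc_toks_cons /= -catA.
- move=> h; exists [::], [::], (EqnMark :: T); split=> //; first by exists [::].
  by case: p h => [[]|] // h; right; exists T.
move=> h; exists [::], [::], (EqualMark :: T); split=> //; first by exists [::].
by case: p h => [[]|] // h; exists T.
Qed.

Lemma fmt_eqns_parse T : T = [::] \/ (exists2 r, T = EqnMark :: r & fmt (Some false, None) r) ->
  exists es, T = enc_toks (eqns_toks es).
Proof.
have [n] := ubnP (size T); elim: n T => // n IH T lt [->|[r eT]]; first by exists [::].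
move=> /fmt_parse[bs [U [r1 [er [/(_ erefl) b1 _] _ s1 [r2 e2]]]]].
move=> /fmt_parse[bs' [V [r3 [er3 [/(_ erefl) b2 _] _ s3 h3]]]].
case: (IH r3) => [|//|es ees].
  by move: lt; rewrite eT /=; rewrite e2 /= in s1; lia.
by exists ((U, V) :: es); rewrite enc_eqns_cons eT er e2 er3 ees b1 b2.
Qed.

Lemma fmtP T : fmt (None, None) T <-> exists tb es, T = enc_toks (toks_of tb es).
Proof.
split=> [|[tb [es ->]]]; last exact: fmt_toks.
move=> /fmt_parse[bs [w [r [-> [/(_ erefl) -> _] /(_ erefl) [tb ->] _ h]]]].
have [es ->] := fmt_eqns_parse h; exists tb, es.
by rewrite /toks_of enc_toks_cat /enc_rword -map_comp.
Qed.

(** * Instances *)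

Section Instances.
Variable A : invAlphabet.
Definition rk (x : A + var) : nat + var :=
  match x with inl a => inl (enum_rank a : nat) | inr Z => inr Z end.
Definition rk_eqn (e : equation A var) : rword * rword := (map rk e.1, map rk e.2).
Definition table : seq nat := [seq (enum_rank (bar a) : nat) | a <- enum A].

Lemma enc_word_toks (W : eqn_word A var) : enc_word W = enc_toks (map inl (map rk W)).
Proof.
rewrite /enc_word /enc_toks -!map_comp; congr flatten; apply: eq_map => -[a|Z] //=.
by rewrite /enc_letter map_nseq.
Qed.

Lemma enc_instance_toks (S : system A) :
  enc_instance S = enc_toks (toks_of table (map rk_eqn S)).
Proof.
rewrite /enc_instance /toks_of enc_toks_cat; congr (_ ++ _).
  rewrite /enc_alphabet /enc_toks /table -!map_comp; congr flatten; apply: eq_map => a /=.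
  by rewrite /enc_letter map_nseq.
elim: S => //= -[U V] S IH; rewrite IH enc_eqns_cons /enc_rword !enc_word_toks.
by rewrite -catA.
Qed.

Lemma size_table : size table = #|A|.
Proof. by rewrite size_map cardE. Qed.
Lemma nth_table (a : A) : nth 0 table (enum_rank a) = enum_rank (bar a).
Proof. by rewrite (nth_map a) ?nth_enum_rank // -cardE ltn_ord. Qed.

Lemma tail_eqns es : tail_toks (eqns_toks es).
Proof. by case: es. Qed.

Lemma letter_rank (S : system A) i : sym (enc_instance S) i = Some LetterMark ->
  exists a : A, cont (enc_instance S) i = nseq (enum_rank a) true.
Proof.
rewrite enc_instance_toks => /letter_tok[k kin ->]; suff [a ->] : exists a : A, k = enum_rank a by exists a.
move: kin; rewrite mem_cat => /orP[/mapP[k' /mapP[a _ ->] [->]]|]; first by exists (bar a).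
case/flattenP => s /mapP[e /mapP[[U V] _ ->] ->].
have E (W : eqn_word A var) : tL k \in map inl (map rk W) -> exists a : A, k = enum_rank a.
  by case/mapP => x /mapP[[a|Z] _ ->] // [->]; exists a.
by rewrite inE /= mem_cat inE /= => /orP[/E|/E].
Qed.

Lemma entry_letter (S : system A) i : entry (enc_instance S) i ->
  exists2 a : A, rank (enc_instance S) i = enum_rank a &
    cont (enc_instance S) i = nseq (enum_rank (bar a)) true.
Proof.
rewrite enc_instance_toks => /(entry_tok (tail_eqns _)).
rewrite -/(toks_of table _) size_table => -[lt ->].
exists (enum_val (Ordinal lt)); first by rewrite enum_valK.
by rewrite -nth_table enum_valK.
Qed.

Lemma letter_entry (S : system A) (a : A) :
  exists2 i, entry (enc_instance S) i & rank (enc_instance S) i = enum_rank a.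
Proof.
by rewrite enc_instance_toks; apply: tok_entry; rewrite size_table.
Qed.
End Instances.

(** Every letter of the text names an entry of the table, and the table is its own inverse. Besides
    the format nothing else distinguishes instances, as letters occur only through their numbers. *)
Definition tokens_ok (T : seq symbol) : Prop :=
  forall i, sym T i = Some LetterMark -> exists2 j, entry T j &
    size (cont T i) = rank T j /\ (entry T i -> size (cont T j) = rank T i).

Lemma instance_tokens A (S : system A) : tokens_ok (enc_instance S).
Proof.
move=> i /letter_rank[a ea]; have [j ej rj] := letter_entry S a.
exists j => //; rewrite ea size_nseq rj; split=> // /entry_letter[b rb cb].
have [a' ra' ->] := entry_letter ej; rewrite size_nseq rb.
have -> : a' = a by apply: enum_rank_inj; apply: val_inj; rewrite /= -ra' rj.
have -> : a = bar b.
  by apply: enum_rank_inj; apply: val_inj; rewrite /= -(size_nseq (enum_rank a) true) -ea cb size_nseq.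
by rewrite barK.
Qed.

(** The alphabet is rebuilt on the indices of the table, with the table as its involution. *)
Lemma tokens_instance tb es : tokens_ok (enc_toks (toks_of tb es)) ->
  exists (A : invAlphabet) (S : system A), enc_toks (toks_of tb es) = enc_instance S.
Proof.
set T := enc_toks _ => H; have ent i := @entry_tok tb (eqns_toks es) i (tail_eqns es).
rewrite -/(toks_of tb es) -/T in ent.
have ltk k : tL k \in toks_of tb es -> k < size tb.
  move=> /tok_letter[i s c]; have [j ej [r _]] := H i s.
  by rewrite -(size_nseq k true) -c r; have [] := ent _ ej.
have ltb k : k < size tb -> nth 0 tb k < size tb.
  by move=> lt; apply: ltk; rewrite mem_cat map_f ?mem_nth.
have inv k : k < size tb -> nth 0 tb (nth 0 tb k) = k.
  move=> lt; have [i ei ri] := tok_entry (eqns_toks es) lt; rewrite -/(toks_of tb es) -/T in ei ri.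
  have [_ ci] := ent _ ei; have /andP[/eqP si _] := ei.
  have [j ej [rj]] := H i si; rewrite ci size_nseq ri in rj.
  by move=> /(_ ei); have [_ ->] := ent _ ej; rewrite size_nseq ri -rj.
pose br (i : 'I_(size tb)) : 'I_(size tb) := insubd i (nth 0 tb i).
have brE i : br i = nth 0 tb i :> nat by rewrite /br val_insubd ltb.
have brK : involutive br by move=> i; apply: val_inj; rewrite /= !brE inv.
pose A := @InvAlphabet 'I_(size tb) br brK.
have rkE (a : A) : enum_rank a = a :> nat by rewrite enum_rank_ord.
have wd (w : rword) : (forall k, inl k \in w -> k < size tb) -> exists W : eqn_word A var, map (@rk A) W = w.
  elim: w => [|[k|Z] w IH] h; first by exists [::].
    have [|W eW] := IH; first by move=> k' kin; apply: h; rewrite inE kin orbT.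
    have lt : k < size tb by apply: h; apply: mem_head.
    by exists (inl (Ordinal lt : A) :: W); rewrite /= eW rkE.
  have [|W eW] := IH; first by move=> k' kin; apply: h; rewrite inE kin.
  by exists (inr Z :: W); rewrite /= eW.
have [S eS] : exists S : system A, map (@rk_eqn A) S = es.
  have : forall k, tL k \in eqns_toks es -> k < size tb.
    by move=> k kin; apply: ltk; rewrite mem_cat kin orbT.
  elim: (es) => [|[U V] es' IH] h; first by exists [::].
  have [|S eS] := IH; first by move=> k kin; apply: h; rewrite mem_cat kin orbT.
  have [|U' eU] := wd U.
    by move=> k kin; apply: h; rewrite /eqns_toks /= inE mem_cat mem_cat (map_f inl kin) ?orbT.
  have [|V' eV] := wd V.
    by move=> k kin; apply: h; rewrite /eqns_toks /= inE mem_cat mem_cat inE (map_f inl kin) ?orbT.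
  by exists ((U', V') :: S); rewrite /= eS /rk_eqn /= eU eV.
exists A, S; rewrite enc_instance_toks eS /T; congr (enc_toks (toks_of _ _)).
rewrite /table (eq_map (g := fun i : 'I_(size tb) => nth 0 tb i)); last first.
  by move=> a; rewrite rkE /= brE.
rewrite (map_comp (nth 0 tb) (@nat_of_ord _)) val_enum_ord.
by apply: (@eq_from_nth _ 0) => [|i lt]; rewrite ?size_map ?size_iota // (nth_map 0) ?size_iota // nth_iota.
Qed.

Lemma instanceP T :
  fmt (None, None) T /\ tokens_ok T <-> exists (A : invAlphabet) (S : system A), T = enc_instance S.
Proof.
split=> [[/fmtP[tb [es ->]]]|[A [S ->]]]; first exact: tokens_instance.
split; last exact: instance_tokens.
by apply/fmtP; exists (table A), (map (@rk_eqn A) S); apply: enc_instance_toks.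
Qed.

End InstanceTexts.

(** * Solutions as finite labelled trees *)

Module Labels.
Import SetEquations InstanceTexts.

Local Open Scope nat_scope.

(* A label at text position i of a node s of the Cayley tree: whether s lies in the
   set and is the group element of the word starting at i, whether s lies in the set
   of the variable at i, and the first two bits for the word after the next "=". *)
Definition lab : finType := ((bool * bool) * bool * (bool * bool))%type.
Definition zlab : lab := ((false, false), false, (false, false)).

(** The condition on the labels of one node at two consecutive positions. At an [EqnMark] the first
    bits of the two sides are compared, which expresses the equation at this node. *)
Definition base (root : bool) (x : option symbol) (n nn : lab) : bool :=
  match x with
  | None => n == ((root, root), false, (false, false))
  | Some (Bit _) => n == (nn.1.1, false, nn.2)
  | Some LetterMark => [&& ~~ n.1.2, n.2 == nn.2 & root ==> n.1.1.1]
  | Some VarMark => (n.1.1 == (n.1.2 || nn.1.1.1, nn.1.1.2)) && (n.2 == nn.2)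
  | Some EqnMark => (n == ((root, root), false, nn.2)) && (nn.1.1 == nn.2)
  | Some EqualMark => n == ((root, root), false, nn.1.1)
  end.

(* [l] is a legal label of the child of a node labelled [o] in the direction of the
   letter whose table entry is at [c]; for [m = None], of the root. *)
Definition label_ok (T : seq symbol) (m : option bool) (c : nat) (o l : nat -> lab) : Prop :=
  forall i, i <= size T ->
  [/\ base (m == None) (sym T i) (l i) (l i.+1),
      sym T i = Some VarMark -> forall j, i <= j -> sym T j = Some VarMark ->
        cont T i = cont T j -> (l i).1.2 = (l j).1.2 &
      forall r, m = Some r -> sym T i = Some LetterMark ->
        (size (cont T i) = rank T c -> (l i).1.1 = (o i.+1).1.1) /\
        (cont T i = cont T c -> (o i).1.1 = (r || (l i.+1).1.1.1, (l i.+1).1.1.2))].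

(** The tree is finite because the predicate is inductive, and a branch may stop only at a zero
    label. The side condition leaves out the child that would lead back to the parent: its letter is
    the inverse of the one at [c]. *)
Inductive good (T : seq symbol) : bool -> nat -> (nat -> lab) -> Prop :=
| GoodZero c l : (forall i, i <= size T -> l i = zlab) -> good T false c l
| GoodStep r c l :
    (forall c', entry T c' -> (r = false -> size (cont T c') <> rank T c) ->
       exists2 l', label_ok T (Some r) c' l l' & good T false c' l') -> good T r c l.

(** Subtrees occur under an existential, for which the generated principle gives no induction
    hypothesis. *)
Lemma good_ind' T (P : bool -> nat -> (nat -> lab) -> Prop) :
  (forall c l, (forall i, i <= size T -> l i = zlab) -> P false c l) ->
  (forall r c l, (forall c', entry T c' -> (r = false -> size (cont T c') <> rank T c) ->
     exists2 l', label_ok T (Some r) c' l l' & P false c' l') -> P r c l) ->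
  forall r c l, good T r c l -> P r c l.
Proof.
move=> h0 h1; fix IH 4 => r c l [c0 l0 z|r0 c0 l0 h]; first exact: h0.
apply: h1 => c' e n; case: (h c' e n) => l' ok g; exists l' => //; exact: IH g.
Qed.

Definition good_text (T : seq symbol) : Prop :=
  exists2 l, label_ok T None 0 l l & good T true 0 l.

Section Labels.
Variables (A : invAlphabet) (S : system A).
Let T := enc_instance S.

(** Decodes the word starting at any position; stray bits are skipped, so that positions inside a
    token have a word as well. *)
Fixpoint dec (r : seq symbol) : eqn_word A var :=
  match r with
  | Bit _ :: r' => dec r'
  | LetterMark :: r' =>
      if nth None (map Some (enum A)) (size (bits r')) is Some a then inl a :: dec r' else dec r'
  | VarMark :: r' => inr (bits r') :: dec r'
  | _ => [::]
  end.
Fixpoint aft (r : seq symbol) : option (seq symbol) :=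
  match r with
  | [::] => None
  | EqualMark :: r' => Some r'
  | _ :: r' => aft r'
  end.
Definition D (i : nat) := dec (drop i T).

Lemma nth_letter (a : A) : nth None (map Some (enum A)) (enum_rank a) = Some a.
Proof. by rewrite (nth_map a) ?nth_enum_rank // -cardE. Qed.

Lemma dec_letter i (a : A) : sym T i = Some LetterMark -> cont T i = nseq (enum_rank a) true ->
  D i = inl a :: D i.+1.
Proof. by move=> /drop_sym e c; rewrite /D e /= -/(cont T i) c size_nseq nth_letter. Qed.
Lemma dec_var i : sym T i = Some VarMark -> D i = inr (cont T i) :: D i.+1.
Proof. by move=> /drop_sym e; rewrite /D e. Qed.
Lemma dec_bit i b : sym T i = Some (Bit b) -> D i = D i.+1.
Proof. by move=> /drop_sym e; rewrite /D e. Qed.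
Lemma dec_eqn i : sym T i = Some EqnMark -> D i = [::].
Proof. by move=> /drop_sym e; rewrite /D e. Qed.
Lemma dec_equal i : sym T i = Some EqualMark -> D i = [::].
Proof. by move=> /drop_sym e; rewrite /D e. Qed.
Lemma sym_none i : sym T i = None -> size T <= i.
Proof. by rewrite leqNgt => h; apply/negP => /sym_some[x]; rewrite h. Qed.
Lemma dec_end i : sym T i = None -> D i = [::].
Proof. by move=> /sym_none le; rewrite /D drop_oversize. Qed.
Lemma aft_end i : sym T i = None -> aft (drop i T) = None.
Proof. by move=> /sym_none le; rewrite drop_oversize. Qed.
Lemma aft_step i x : sym T i = Some x ->
  aft (drop i T) = if x is EqualMark then Some (drop i.+1 T) else aft (drop i.+1 T).
Proof. by move=> /drop_sym ->; case: x. Qed.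

Lemma dec_word (W : eqn_word A var) r : dec r = [::] -> bits r = [::] -> dec (enc_word W ++ r) = W.
Proof.
move=> dr br; have bw V : bits (@enc_word A V ++ r) = [::] by case: V => [|[a|Z] V].
elim: W => // -[a|Z] W IH; rewrite /enc_word /= -/(enc_word W) -catA.
  rewrite -map_nseq bits_cat bw cats0 size_nseq nth_letter; congr (_ :: _).
  by elim: (nat_of_ord _).
rewrite bits_cat bw cats0; congr (_ :: _).
by elim: Z.
Qed.

Lemma aft_word (W : eqn_word A var) r : aft (enc_word W ++ r) = aft r.
Proof.
elim: W => // -[a|Z] W IH; rewrite /enc_word /= -/(enc_word W) -catA.
  by elim: (nat_of_ord _).
by elim: Z.
Qed.

Lemma word_marks (W : eqn_word A var) : EqnMark \notin enc_word W.
Proof.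
apply/negP => /flattenP[s /mapP[[a|Z] _ ->]]; rewrite inE => /orP[/eqP //|].
  by rewrite mem_nseq => /andP[_ /eqP].
by case/mapP.
Qed.

Let E (R : system A) := flatten [seq EqnMark :: enc_word e.1 ++ EqualMark :: enc_word e.2 | e <- R].
Definition eqn_at (t : seq symbol) i U V := [/\ sym t i = Some EqnMark,
  dec (drop i.+1 t) = U & exists2 r, aft (drop i.+1 t) = Some r & dec r = V].

Lemma sym_cons x t i : sym (x :: t) i.+1 = sym t i.
Proof. by []. Qed.

Lemma E_cons U V R : E ((U, V) :: R) = EqnMark :: (enc_word U ++ EqualMark :: enc_word V) ++ E R.
Proof. by rewrite /E /= . Qed.

Lemma E_head U V R : eqn_at (E ((U, V) :: R)) 0 U V.
Proof.
rewrite E_cons /eqn_at /= drop0 -catA; split=> //; first exact: dec_word.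
exists (enc_word V ++ E R); first exact: aft_word.
by apply: dec_word; case: R => [|[]].
Qed.

Lemma E_eqn R i : sym (E R) i = Some EqnMark -> exists U V, (U, V) \in R /\ eqn_at (E R) i U V.
Proof.
elim: R i => [|[U V] R IH] i; first by case: i.
case: i => [|i]; first by move=> _; exists U, V; split; [exact: mem_head | exact: E_head].
rewrite E_cons; set B := enc_word U ++ _; have nB : EqnMark \notin B.
  by rewrite mem_cat inE negb_or word_marks /= negb_or word_marks andbT; apply/eqP.
rewrite sym_cons sym_cat; case: ltnP => [lt e|ge].
  by move: nB; rewrite -(cat_take_drop i B) (drop_sym e) mem_cat inE eqxx orbT.
move=> /IH[U' [V' [m [e1 e2 e3]]]]; exists U', V'; split; first by rewrite inE m orbT.
have dc : drop i.+2 (EqnMark :: B ++ E R) = drop (i - size B).+1 (E R).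
  by rewrite /= drop_cat ltnNge (leqW ge) /= subSn.
by rewrite /eqn_at dc; split=> //; rewrite sym_cons sym_cat ltnNge ge.
Qed.

Lemma E_mem R U V : (U, V) \in R -> exists i, eqn_at (E R) i U V.
Proof.
elim: R => // -[U' V'] R IH; rewrite inE => /orP[/eqP[-> ->]|/IH[i [e1 e2 e3]]].
  by exists 0; apply: E_head.
rewrite E_cons; set B := enc_word U' ++ _; exists (size B + i).+1.
have dc : drop (size B + i).+2 (EqnMark :: B ++ E R) = drop i.+1 (E R).
  by rewrite /= drop_cat ltnNge -addnS leq_addr addKn.
by rewrite /eqn_at dc; split=> //; rewrite sym_cons sym_cat ltnNge leq_addr addKn.
Qed.

Lemma alphabet_marks : EqnMark \notin enc_alphabet A.
Proof.
apply/negP => /flattenP[s /mapP[a _ ->]]; rewrite inE => /orP[/eqP //|].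
by rewrite mem_nseq => /andP[_ /eqP].
Qed.

Lemma text_eqn i : sym T i = Some EqnMark -> exists U V, (U, V) \in S /\ eqn_at T i U V.
Proof.
rewrite /T /enc_instance -/(E S) => h; move: (h); rewrite sym_cat; case: ltnP => [lt e|ge].
  by move: alphabet_marks; rewrite -(cat_take_drop i (enc_alphabet A)) (drop_sym e) mem_cat inE eqxx orbT.
move=> /E_eqn[U [V [m [e1 e2 e3]]]]; exists U, V; split=> //; split=> //;
  by rewrite drop_cat ltnNge (leqW ge) /= subSn.
Qed.

Lemma eqn_text U V : (U, V) \in S -> exists i, eqn_at T i U V.
Proof.
move=> /E_mem[i [e1 e2 e3]]; rewrite /T /enc_instance -/(E S).
exists (size (enc_alphabet A) + i); have dc : drop (size (enc_alphabet A) + i).+1 (enc_alphabet A ++ E S) = drop i.+1 (E S).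
  by rewrite drop_cat ltnNge -addnS leq_addr addKn.
by rewrite /eqn_at dc sym_cat ltnNge leq_addr addKn.
Qed.

Lemma aft_drop r r' : aft r = Some r' -> exists k, r' = drop k r.
Proof.
elim: r => // x r IH; case: x => [b| | | |] /=;
  try by move=> /IH[k ->]; exists k.+1.
by case=> <-; exists 1; rewrite /= drop0.
Qed.

Section Solution.
Local Open Scope group_scope.
Variable X : var -> {fset FG A}.
Let XX Z s := s \in X Z.
Hypothesis HX : forall U V, (U, V) \in S ->
  (forall s, lang XX U s = lang XX V s) /\ grp U = grp V.

Definition val_lab W (s : FG A) : bool * bool := (lang XX W s, s == grp W).
Definition lb (s : FG A) (i : nat) : lab :=
  (val_lab (D i) s, (if sym T i is Some VarMark then XX (cont T i) s else false),
   (if aft (drop i T) is Some r then val_lab (dec r) s else (false, false))).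

Lemma lb_base s i : base (s == 1) (sym T i) (lb s i) (lb s i.+1).
Proof.
case e : (sym T i) => [x|]; last by rewrite /= /lb e aft_end // /val_lab dec_end //= eqxx.
have ea := aft_step e; case: x e ea => [b| | | |] e ea; rewrite /base /lb e /= ea.
- by rewrite (dec_bit e) eqxx.
- by rewrite eqxx /=; apply/implyP => /eqP ->; rewrite lang_1.
- by rewrite /val_lab (dec_var e) /= !eqxx.
- have [U [V [m [_ e2 [r e3 e4]]]]] := text_eqn e.
  rewrite /val_lab (dec_eqn e) /= eqxx /= e3 /D e2 e4; have [l ->] := HX m.
  by rewrite l.
by rewrite /val_lab (dec_equal e).
Qed.

Lemma lb_name s i j : sym T i = Some VarMark -> sym T j = Some VarMark ->
  cont T i = cont T j -> (lb s i).1.2 = (lb s j).1.2.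
Proof. by rewrite /lb => -> -> /= ->. Qed.

Lemma FG_mul_bar (a : A) (s : FG A) : (FG_letter (bar a))^-1 * s = FG_letter a * s.
Proof. by apply: val_inj; rewrite /= barK. Qed.

Lemma nseq_rank (a b : A) : nseq (enum_rank a) true = nseq (enum_rank b) true -> a = b.
Proof.
by move=> /(congr1 size); rewrite !size_nseq => h; apply: enum_rank_inj; apply: val_inj.
Qed.

(** Children arise by multiplication on the left, since [lang] strips letters on the left; a node is
    therefore reached by reading its letters from the last to the first. *)
Lemma lb_child s (b : A) c : FG_letter b * s != 1 -> entry T c -> rank T c = enum_rank b ->
  label_ok T (Some (s == 1)) c (lb s) (lb (FG_letter b * s)).
Proof.
move=> n1 ec rc i le; split.
- by have := lb_base (FG_letter b * s) i; rewrite (negPf n1).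
- by move=> ei j _; apply: lb_name.
move=> r [<-] ei; have [a ca] := letter_rank ei; have [b' rb cb] := entry_letter ec.
have eb : b' = b by apply: enum_rank_inj; apply: val_inj; rewrite /= -rb rc.
rewrite /lb /= /val_lab (dec_letter ei ca); split.
  rewrite ca size_nseq rc => rab; have -> : a = b by apply: enum_rank_inj; apply: val_inj.
  by rewrite /= (negPf n1) -/(grp (inl b :: _)) grp_cons mulgA mulVg mul1g.
rewrite ca cb eb => /nseq_rank ->.
by rewrite -/(grp (inl (bar b) :: _)) grp_cons /= FG_mul_bar.
Qed.

Lemma lang_bound W : exists m, forall s : FG A, lang XX W s -> (size s <= m)%N.
Proof.
elim: W => [|[a|Z] W [m IH]].
- by exists 0 => s /eqP ->.
- exists m.+1 => s /= /orP[/eqP -> //|/IH]; rewrite val_mulV.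
  by case: (s : seq A) => //= b w; case: ifP => /=; lia.
exists (m + \max_(s <- enum_fset (X Z)) size s) => s /= /orP[h|/IH h]; last by lia.
apply: leq_trans (leq_addl _ _).
by apply: (@leq_bigmax_seq _ _ xpredT (fun s : FG A => size s) s h isT).
Qed.

Lemma lang_grp W : lang XX W (grp W).
Proof. by elim: W => [|[a|Z] W IH] //=; rewrite ?mulgA ?mulVg ?mul1g IH orbT. Qed.

Lemma text_bound : exists m, forall i (s : FG A), lang XX (D i) s -> (size s <= m)%N.
Proof.
rewrite /D; elim: T => [|x t [m IH]]; first by exists 0 => -[|i] s /eqP ->.
have [m' H] := lang_bound (dec (x :: t)); exists (m + m') => -[|i] s.
  by rewrite drop0 => /H; lia.
by move=> /IH; lia.
Qed.

(** The sets are finite, so by [text_bound] all labels vanish beyond some depth; there the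
    derivation stops. *)
Lemma lb_good : good_text T.
Proof.
have [m bound] := text_bound; exists (lb 1).
  move=> i le; split=> //; first by have := lb_base 1 i; rewrite eqxx.
  by move=> ei j _; apply: lb_name.
(* [k] bounds the distance from [s] to the depth where the labels vanish. *)
have G k (s : FG A) c : (m < size s + k)%N ->
    (forall b w, s = b :: w :> seq A -> rank T c = enum_rank b) -> good T (s == 1) c (lb s).
  elim: k s c => [|k IH] s c lt hc.
    have n1 : s == 1 = false by apply/eqP => s1; rewrite s1 in lt.
    have z W : (lang XX W s -> size s <= m)%N -> val_lab W s = (false, false).
      move=> h; rewrite /val_lab; have nl : lang XX W s = false by apply/negP => /h; lia.
      rewrite nl; congr pair; apply/negP => /eqP e.
      by move: nl; rewrite e lang_grp.
    rewrite n1; apply: GoodZero => i le; rewrite /lb z; last exact: bound.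
    congr (_, _, _).
      case e : (sym T i) => [[]|] //; apply/negP => h.
      have := bound i s; rewrite (dec_var e) /= h => /(_ isT); lia.
    case e : (aft _) => [r|] //; have [j er] := aft_drop e; apply: z.
    by rewrite er drop_drop; apply: bound.
  apply: GoodStep => c' ec hcc; have [b rb cb] := entry_letter ec.
  have [w ew] : exists w, FG_letter b * s = b :: w :> seq A /\ w = s :> seq A.
    exists s; split=> //; rewrite val_mul; case es : (s : seq A) hcc => [|b1 w] //= hcc.
    case: eqP => // eb; case: hcc; first by apply/eqP => s1; rewrite s1 in es.
    by rewrite cb size_nseq (hc _ _ es) eb.
  case: ew => ew ws; have n1 : FG_letter b * s != 1 by apply/eqP => e; rewrite e in ew.
  exists (lb (FG_letter b * s)); first exact: lb_child.
  rewrite -(negPf n1); apply: IH; first by rewrite ew /= ws; lia.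
  by move=> b1 w1; rewrite ew => -[<- _].
by have := G m.+1 1 0; rewrite eqxx; apply=> //; lia.
Qed.
End Solution.

Section Construct.
Variable ep : A -> nat.
Hypothesis epE : forall a, entry T (ep a).
Hypothesis epR : forall a, rank T (ep a) = enum_rank a.

Lemma epC a : cont T (ep a) = nseq (enum_rank (bar a)) true.
Proof.
have [b rb ->] := entry_letter (epE a).
by have -> : b = a by apply: enum_rank_inj; apply: val_inj; rewrite /= -rb epR.
Qed.

Definition path_ok (r : bool) (c : nat) (u : seq A) : bool :=
  reduced u && (if u is b :: _ then r || (enum_rank (bar b) != rank T c :> nat) else true).

(** Choosing the subtrees of all directions simultaneously turns a derivation into a labelling of
    paths that is zero beyond a depth [B]. *)
Lemma good_tree r c l : good T r c l ->
  exists (F : seq A -> nat -> lab) (B : nat), [/\ F [::] = l,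
    forall u, B <= size u -> forall i, i <= size T -> F u i = zlab &
    forall u b, path_ok r c (rcons u b) ->
      label_ok T (Some (r && (u == [::]))) (ep b) (F u) (F (rcons u b))].
Proof.
elim/good_ind' => {r c l} [c l z|r c l H].
  exists (fun u => if u is [::] then l else fun=> zlab), 0; split=> //.
    by case=> //= _; apply: z.
  move=> u b _ i le; have -> : (if rcons u b is [::] then l else fun=> zlab) = fun=> zlab by case: u.
  split=> [|//|r]; first by case: (sym T i) => [[]|].
  move=> [<-] /sym_lt lt; split=> _; last by case: u => [|a u] //=; rewrite z.
  by case: u => [|a u] //; rewrite z.
have [b|FB HF] := @fin_all_exists A (fun=> ((seq A -> nat -> lab) * nat)%type) (fun b FB =>
   (r || (enum_rank (bar b) != rank T c :> nat)) ->
   [/\ label_ok T (Some r) (ep b) l (FB.1 [::]),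
    forall u, FB.2 <= size u -> forall i, i <= size T -> FB.1 u i = zlab &
    forall u b', path_ok false (ep b) (rcons u b') ->
      label_ok T (Some false) (ep b') (FB.1 u) (FB.1 (rcons u b'))]) _.
  case: (boolP (r || _)) => [h|]; last by exists ((fun _ _ => zlab), 0).
  have [|l' ok [F [B [e1 e2 e3]]]] := H (ep b) (epE b).
    by move=> r0; move: h; rewrite r0 /= epC size_nseq => /eqP.
  by exists (F, B) => _; split=> //=; rewrite e1.
exists (fun u => if u is b :: u' then if r || (enum_rank (bar b) != rank T c :> nat)
                   then (FB b).1 u' else fun=> zlab else l), (\max_b (FB b).2).+1.
split=> //.
  case=> // b u /= lt i le; case: ifP => // h; have [_ z _] := HF b h; apply: z => //.
  by apply: leq_trans (@leq_bigmax A (fun b => (FB b).2) b) _; rewrite -ltnS.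
case=> [|b u] b' /= /andP[rd]; first by move=> h; rewrite h andbT; have [] := HF b' h.
move=> h; rewrite h andbF; have [_ _] := HF b h; apply; apply/andP.
split; first exact: path_sorted rd.
have : b != bar (head b' (rcons u b')).
  move: rd; rewrite /reduced /=; case: u => [|b1 u] /= /andP[n _];
    by apply: contraNneq n => ->; rewrite barK.
case: (rcons u b') (size_rcons u b') => //= b1 u' _ n; rewrite epR.
by apply: contraNneq n => e; apply/eqP; apply: enum_rank_inj; apply: val_inj.
Qed.

Fixpoint awords (k : nat) : seq (seq A) :=
  if k is k'.+1 then [::] :: allpairs cons (enum A) (awords k') else [:: [::]].

Lemma mem_awords k w : size w <= k -> w \in awords k.
Proof.
elim: k w => [|k IH] [|a w] //= lt; rewrite inE; apply/orP; right.
by apply: allpairs_f; [rewrite mem_enum | apply: IH].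
Qed.

Section Tree.
Local Open Scope group_scope.
Variables (F : seq A -> nat -> lab) (B : nat).
Hypothesis F0 : label_ok T None 0 (F [::]) (F [::]).
Hypothesis FB : forall u, (B <= size u)%N -> forall i, (i <= size T)%N -> F u i = zlab.
Hypothesis FS : forall u b, reduced (rcons u b) ->
  label_ok T (Some (u == [::])) (ep b) (F u) (F (rcons u b)).
Let lbl (s : FG A) := F (rev s).

(** A node is put into [Z] if some occurrence of [Z] in the text says so; the condition on equal
    names in [label_ok] makes all occurrences agree. *)
Definition tree_set (Z : var) : {fset FG A} := seq_fset tt [seq s <- pmap insub (awords B) |
  [exists i : 'I_(size T), [&& sym T i == Some VarMark, cont T i == Z & (lbl s i).1.2]]].
Let XX Z s := s \in tree_set Z.

Lemma rev_reduced (w : seq A) : reduced w -> reduced (rev w).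
Proof.
rewrite /reduced rev_sorted; apply: sub_sorted => a b /=.
by apply: contraNneq => ->; rewrite barK.
Qed.

Lemma node_ok (s : FG A) : exists m o c, [/\ label_ok T m c o (lbl s), (m == None) = (s == 1) &
  forall b w, s = b :: w :> seq A ->
    exists t : FG A, [/\ t = w :> seq A, c = ep b, m = Some (t == 1) & o = lbl t]].
Proof.
case es : (s : seq A) => [|b w].
  have -> : s = 1 by apply: val_inj.
  by exists None, (F [::]), 0%N; rewrite eqxx; split.
have rs : reduced (b :: w) by rewrite -es FG_wordP.
pose t := MkFG (reduced_behead rs).
exists (Some (t == 1)), (lbl t), (ep b); split.
- have -> : lbl s = F (rcons (rev w) b) by rewrite /lbl es rev_cons.
  have -> : (t == 1) = (rev w == [::]).
    by rewrite -val_eqE /= -(inj_eq (can_inj (@revK A)) w).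
  by apply: FS; rewrite -rev_cons; apply: rev_reduced.
- by apply/esym/eqP => s1; rewrite s1 in es.
by move=> b' w' [<- <-]; exists t.
Qed.

Lemma node_base (s : FG A) i : (i <= size T)%N -> base (s == 1) (sym T i) (lbl s i) (lbl s i.+1).
Proof. by move=> le; have [m [o [c [ok <- _]]]] := node_ok s; have [] := ok i le. Qed.

Lemma node_var (s : FG A) i : sym T i = Some VarMark -> XX (cont T i) s = (lbl s i).1.2.
Proof.
move=> ei; have lt := sym_lt ei; have [m [o [c [ok _ _]]]] := node_ok s.
rewrite /XX /tree_set seq_fsetE mem_filter; apply/andP/idP => [[/existsP[j /and3P[/eqP ej /eqP cj h]] _]|h].
  case: (leqP i j) => ij; first by have [_ v _] := ok i (ltnW lt); rewrite (v ei j).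
  by have [_ v _] := ok j (ltnW (ltn_ord j)); rewrite -(v ej i (ltnW ij)).
split; first by apply/existsP; exists (Ordinal lt); rewrite /= ei !eqxx h.
rewrite mem_pmap; apply/mapP; exists (s : seq A); last by rewrite valK.
apply: mem_awords; rewrite leqNgt; apply/negP => le.
by move: h; rewrite /lbl FB ?size_rev // ltnW.
Qed.

(** Induction from the end of the text. At a letter [a] the value at [s] depends on the neighbour
    [a^-1 * s]. This is the parent of [s] if [s] begins with [a], and otherwise the child in the
    direction [bar a]; the two conditions on letters in [label_ok] serve these two cases. *)
Lemma node_val i : (i <= size T)%N -> forall s : FG A,
  (lbl s i).1.1 = val_lab tree_set (D i) s /\
  (lbl s i).2 = if aft (drop i T) is Some r then val_lab tree_set (dec r) s else (false, false).
Proof.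
have [k] := ubnP (size T - i); elim: k i => // k IH i lt le s.
have bs := node_base s le; case e : (sym T i) bs => [x|].
  have lti := sym_lt e; have {}IH := IH i.+1 _ lti; have {}IH := IH _ : _.
  have ea := aft_step e; have [v1 v2] := IH ltac:(lia) s.
  case: x e ea => [b| | | |] e ea /=; rewrite ea.
  - by move=> /eqP ->; rewrite (dec_bit e).
  - case/and3P => _ /eqP -> hr; split; last exact: v2.
    have [a ca] := letter_rank e; rewrite /val_lab (dec_letter e ca) -/(grp (inl a :: _)) grp_cons.
    rewrite -/(lang _ (inl a :: _)).
    have chl : (forall w, s <> a :: w :> seq A) ->
        (lbl s i).1.1 = ((s == 1) || lang (fun Z s => s \in tree_set Z) (D i.+1) ((FG_letter a)^-1 * s),
                  (FG_letter a)^-1 * s == grp (D i.+1)).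
      move=> nh; have es' : (FG_letter a)^-1 * s = bar a :: s :> seq A.
        rewrite val_mulV; case: (s : seq A) nh => //= b w nh; rewrite barK.
        by case: eqP => // eb; case: (nh w); rewrite eb.
      have [m [o [c [ok _ /(_ _ _ es')]]]] := node_ok ((FG_letter a)^-1 * s).
      case=> t [et ec em eo]; have [_ _ /(_ _ em e) [_ bb]] := ok i le.
      have ts : t = s by apply: val_inj.
      rewrite ts in em eo; rewrite eo in bb; rewrite bb; last by rewrite ec epC barK.
      by have [-> _] := IH ltac:(lia) ((FG_letter a)^-1 * s); rewrite ts.
    case es : (s : seq A) => [|b w].
      by apply: chl => w; rewrite es.
    have n1 : s == 1 = false by apply/eqP => s1; rewrite s1 in es.
    have [eab|nab] := eqVneq a b; last first.
      by apply: chl => w'; rewrite es => -[eb]; rewrite eb eqxx in nab.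
    have [m [o [c [ok _ /(_ _ _ es)]]]] := node_ok s.
    case=> t [et ec em eo]; have [_ _ /(_ _ em e) [bb _]] := ok i le.
    rewrite bb; last by rewrite ca size_nseq ec epR eab.
    rewrite eo; have -> : (FG_letter a)^-1 * s = t.
      by apply: val_inj; rewrite [LHS]val_mulV es /= barK eab eqxx -et.
    rewrite /= n1 /=; have [-> _] := IH ltac:(lia) t; rewrite /val_lab; congr (lang _ _ _, _).
    by apply: val_inj; rewrite [RHS]val_mulV es /= barK eab eqxx -et.
  - case/andP => /eqP -> /eqP ->; split; last exact: v2.
    by rewrite v1 /val_lab (dec_var e) /= -(node_var s e).
  - by case/andP => /eqP -> _ /=; rewrite /val_lab (dec_eqn e) /=.
  by move=> /eqP ->; rewrite /val_lab (dec_equal e) /= v1.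
by move=> /eqP ->; rewrite aft_end // /val_lab dec_end.
Qed.

Lemma tree_solvable : solvable S.
Proof.
apply: (@lang_solvable A _ S tree_set) => U V m.
have [i [e e2 [r e3 e4]]] := eqn_text m; have lt := sym_lt e.
have H (s : FG A) : val_lab tree_set U s = val_lab tree_set V s.
  have := node_base s (ltnW lt); rewrite e /= => /andP[_ /eqP h].
  by have [v1 v2] := node_val lt s; rewrite v1 v2 e3 e4 /D e2 in h.
split=> [s|]; first by have [] := H s.
by have [_] := H (grp U); rewrite eqxx => /esym /eqP.
Qed.
End Tree.
End Construct.

Lemma solvable_text : solvable S <-> good_text T.
Proof.
split=> [/solvable_lang[X [_ HX]]|[l okl gl]]; first exact: lb_good HX.
have [a|ep epP] := @fin_all_exists A (fun=> nat)
    (fun a i => entry T i /\ rank T i = enum_rank a) _.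
  by have [i e r] := letter_entry S a; exists i.
have epE a := (epP a).1; have epR a := (epP a).2.
have [F [B [e1 e2 e3]]] := good_tree epE epR gl.
apply: (@tree_solvable ep epE epR F B) => //; first by rewrite e1.
move=> u b rd; have := e3 u b; rewrite andTb; apply; rewrite /path_ok rd.
by case: (rcons u b).
Qed.
End Labels.

End Labels.

(** * The reduction from an arbitrary exponential time problem *)

Module Hardness.
Import StackPrograms QueueMachines HeadMachines Simulation SetEquations QueueSystems Generator InstanceTexts Labels.

Local Open Scope nat_scope.

(** By [solvable_text], solvability is a property of the text, so it is irrelevant which system a
    text is decoded to. *)
Lemma solvable_two_text A (S : system A) : size S = 2 ->
  idempotent_systems_two A (enc_instance S) <-> solvable S.
Proof.
move=> s2; split=> [[S' [e _]]|sol]; last by exists S.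
by rewrite !solvable_text e.
Qed.

Section Hardness.
Variables (N : TM) (Sigma : finType) (i : Sigma -> tape_sym N).
Local Notation M := (sim_mach N).
Local Notation G := (aq_sym (aqm_of M)).
Definition plain (x : option (dcell N)) : G := (Some x, [ffun=> false]).
Definition sim_start : aq_state (aqm_of M) := qSt (M := M) (inl (inl (inl (inl (inl tt))))).
Definition sim_first : G := (None, [ffun=> true]).
(** The initial configuration behind the start mark. Both heads stand on that mark, so each input
    letter yields one fixed letter of the queue, as [gen_word] requires. *)
Definition sim_word (r : nat) (w : seq Sigma) : seq G :=
  [seq plain (Some (true, false, Some (i x))) | x <- w] ++
  nseq r (plain (Some (pad_cell N))) ++ [:: plain (Some (false, false, None)); plain None].

Lemma sim_hword r w :
  sim_first :: sim_word r w = hword (M := M) (cellsof (icells (map i w) r)) (P 0).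
Proof.
have P0 b : P 0 b = 0 by case: b.
rewrite hword_cons; congr (_ :: _).
  by congr pair; apply/ffunP => b; rewrite !ffunE P0.
have -> : sim_word r w = map plain (cellsof (icells (map i w) r)).
  by rewrite /cellsof /icells /sim_word !map_cat !map_nseq -!map_comp -!catA.
move: (cellsof _) => cs; apply: (@eq_from_nth _ sim_first) => [|k lt].
  by rewrite !size_map size_iota.
rewrite size_map in lt; have d : option (dcell N) := None.
rewrite (nth_map d) // (nth_map 0) ?size_iota // nth_iota // /hletter /rdc /= (nth_map d) //.
by congr pair; apply/ffunP => b; rewrite !ffunE P0.
Qed.

Lemma sim_word_accepts r w :
  @accepts (aqm_of M) sim_start (sim_first :: sim_word r w) <->
  accepting (cstate (conf (map i w) (2 ^ (size w + r) - 1))).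
Proof.
rewrite sim_hword -hacc_accepts; last by case.
by rewrite sim_accept size_map.
Qed.
End Hardness.

Lemma two_equations_hard (A : invAlphabet) (al be : A) :
  uniq [:: al; bar al; be; bar be] -> DEXPTIME_hard (idempotent_systems_two A).
Proof.
move=> Hu Sigma L [p [c [d pb]] [N [i [_ HN]]]].
(* With [c.+1] in place of [c] the number of time bits exceeds [p], which makes up for the -1 in the
   starting time. *)
pose f w := enc_instance (red_system (sim_start N) (sim_first N) al be
  (sim_word i (npad c.+1 d (size w)) w)).
exists f; first exact: gen_poly_time.
move=> w; rewrite /f solvable_two_text // red_systemP // sim_word_accepts.
have [t le [hlt <-]] := HN w.
suff -> : conf (map i w) (2 ^ (size w + npad c.+1 d (size w)) - 1) = conf (map i w) t by [].
apply: conf_halt => //; apply: leq_trans le _; have := pb (size w).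
rewrite /npad => pl; set e := size w + _.
have lt : p (size w) < e by rewrite /e; lia.
have : 2 ^ p (size w) < 2 ^ e by rewrite ltn_exp2l.
by lia.
Qed.

End Hardness.

(** * Membership by an alternating machine that guesses the tree *)

Module Membership.
Import StackPrograms QueueMachines HeadMachines InstanceTexts Labels.

Local Open Scope nat_scope.

Section Reach.
Variables (M : hmach) (stop : pred (hq M)) (B : hq M -> seq (hC M) -> (hI M -> nat) -> Prop).

(* Acceptance with the stop states as leaves. What a round of the main loop does is
   proved for an arbitrary B, and then read with B := the specification of the loop
   (soundness) and with B := acceptance (completeness). *)
Inductive hreach : hq M -> seq (hC M) -> (hI M -> nat) -> Prop :=
| HStop q cells pos : stop q -> B q cells pos -> hreach q cells pos
| HStep q cells pos o : ~~ stop q -> o \in hdelta q (view cells pos) ->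
    (forall q' wr mv, (q', (wr, mv)) \in o -> forall i, hmove mv pos i <= size cells) ->
    (forall q' wr mv, (q', (wr, mv)) \in o ->
       hreach q' (hwrite wr cells (pos (hw M))) (hmove mv pos)) -> hreach q cells pos.

Definition target (a : hq M * (option (hC M) * {ffun hI M -> hI M * bool})) cells pos : Prop :=
  (forall i, hmove a.2.2 pos i <= size cells) /\
  hreach a.1 (hwrite a.2.1 cells (pos (hw M))) (hmove a.2.2 pos).
Definition steps q cells pos : Prop :=
  exists2 o, o \in hdelta q (view cells pos) & forall a, a \in o -> target a cells pos.

Lemma hreachE q cells pos : ~~ stop q -> hreach q cells pos <-> steps q cells pos.
Proof.
move=> ns; split=> [h|[o oin H]].
  case: h ns => {}q {}cells {}pos; first by move=> ->.
  by move=> o _ oin hb hr _; exists o => // -[q' [wr mv]] ain; split; [apply: hb ain | apply: hr].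
by apply: (HStep ns oin) => q' wr mv ain; have [] := H _ ain.
Qed.

Lemma hreach_stop q cells pos : stop q -> hreach q cells pos <-> B q cells pos.
Proof.
move=> st; split=> [h|]; last exact: HStop.
by case: h st => // {}q {}cells {}pos o /negPf ->.
Qed.

Lemma hreach_hacc : (forall q cells pos, B q cells pos -> hacc q cells pos) ->
  forall q cells pos, hreach q cells pos -> hacc q cells pos.
Proof.
move=> HB q cells pos; elim=> {q cells pos} [q cells pos _|q cells pos o _ oin hb _ IH].
  exact: HB.
exact: Hacc oin hb IH.
Qed.

Lemma hacc_hreach : (forall q cells pos, stop q -> steps q cells pos -> B q cells pos) ->
  forall q cells pos, hacc q cells pos -> hreach q cells pos.
Proof.
move=> HB q cells pos; elim=> {q cells pos} q cells pos o oin hb _ IH.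
case: (boolP (stop q)) => [st|ns]; last exact: HStep oin hb IH.
apply: HStop => //; apply: HB => //; exists o => // -[q' [wr mv]] ain; split; [exact: hb ain | exact: IH].
Qed.

End Reach.

(** A head moving right with a universal check at every position; [scan_ex] is the existential
    counterpart. *)
Lemma scan_all n (P loc : nat -> Prop) :
  (forall i, i <= n -> P i <-> loc i /\ (i < n -> P i.+1)) ->
  forall i, i <= n -> P i <-> forall j, i <= j <= n -> loc j.
Proof.
move=> H i le; have [k] := ubnP (n - i); elim: k i le => // k IH i le lt.
rewrite H //; split=> [[li h] j /andP[ij jn]|h].
  case: (ltngtP i j) ij => // [ij|<-] _ //; apply: (IH i.+1 _ _).1; [lia | lia | | by rewrite ij].
  by apply: h; lia.
split=> [|lt']; first by apply: h; rewrite leqnn.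
by apply/IH => // [|j /andP[ij jn]]; [lia | apply: h; rewrite jn ltnW].
Qed.

Lemma scan_ex n (P loc : nat -> Prop) :
  (forall i, i <= n -> P i <-> loc i \/ (i < n /\ P i.+1)) ->
  forall i, i <= n -> P i <-> exists2 j, i <= j <= n & loc j.
Proof.
move=> H i le; have [k] := ubnP (n - i); elim: k i le => // k IH i le lt.
rewrite H //; split=> [[li|[lt' /IH]]|[j /andP[ij jn] lj]].
- by exists i; rewrite ?leqnn.
- by case=> [|| j /andP[ij jn] lj]; [lia | lia | exists j; rewrite // jn ltnW].
case: (ltngtP i j) ij => // [ij|eij] _; last by left; rewrite eij.
right; split; first by lia.
by apply/IH; [lia | lia | exists j; rewrite // ij].
Qed.

(** * The machine *)

(** What a comparison of a letter number with an index is for. [Kisb]: is the letter at P the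
    current direction; [Kdir]: does the new direction lead back to the parent; [Kent]: is the entry
    at Q the one named at P; [Kinv]: does that entry name P in turn. The kinds below concern
    equality of bit strings: an inverse direction, or the name of a variable. *)
Inductive rkind := Kisb | Kdir | Kent of bool | Kinv.
Inductive ekind := Kbar of bool | Kname.
Inductive mstate :=
| qInit | qFmt of fst_t | qTok of bool | qEnt of bool
| qRk of rkind | qRks of rkind | qRes of rkind & bool | qEq of ekind
| qLoop of bool | qZero | qDir of bool | qGuess of option bool
| qChk of option bool | qLoc of option bool | qName.

Definition mcode : Type := (bool * bool * bool * bool * (option bool * option bool * bool))%type.
Definition rk_code (k : rkind) : option bool * option bool :=
  match k with
  | Kisb => (None, None) | Kdir => (None, Some false) | Kent t => (Some t, None) | Kinv => (None, Some true)
  end.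
Definition rk_decode (c : option bool * option bool) : rkind :=
  match c with
  | (Some t, _) => Kent t | (None, None) => Kisb | (None, Some false) => Kdir | (None, Some true) => Kinv
  end.
Definition mstate_code (s : mstate) : mcode :=
  match s with
  | qInit => (false, false, false, false, (None, None, false))
  | qFmt f => (false, false, false, true, (f, false))
  | qTok b => (false, false, true, false, (None, None, b))
  | qEnt b => (false, false, true, true, (None, None, b))
  | qRk k => (false, true, false, false, (rk_code k, false))
  | qRks k => (false, true, false, true, (rk_code k, false))
  | qRes k b => (false, true, true, false, (rk_code k, b))
  | qEq k => (false, true, true, true, (if k is Kbar b then (Some b, None) else (None, None), false))
  | qLoop b => (true, false, false, false, (None, None, b))
  | qZero => (true, false, false, true, (None, None, false))
  | qDir b => (true, false, true, false, (None, None, b))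
  | qGuess m => (true, false, true, true, (m, None, false))
  | qChk m => (true, true, false, false, (m, None, false))
  | qLoc m => (true, true, false, true, (m, None, false))
  | qName => (true, true, true, false, (None, None, false))
  end.
Definition mstate_decode (c : mcode) : mstate :=
  let: (t, p) := c in
  match t with
  | (false, false, false, false) => qInit
  | (false, false, false, true) => qFmt p.1
  | (false, false, true, false) => qTok p.2
  | (false, false, true, true) => qEnt p.2
  | (false, true, false, false) => qRk (rk_decode p.1)
  | (false, true, false, true) => qRks (rk_decode p.1)
  | (false, true, true, false) => qRes (rk_decode p.1) p.2
  | (false, true, true, true) => qEq (if p.1.1 is Some b then Kbar b else Kname)
  | (true, false, false, false) => qLoop p.2
  | (true, false, false, true) => qZero
  | (true, false, true, false) => qDir p.2
  | (true, false, true, true) => qGuess p.1.1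
  | (true, true, false, false) => qChk p.1.1
  | (true, true, false, true) => qLoc p.1.1
  | _ => qName
  end.
Lemma mstate_codeK : cancel mstate_code mstate_decode.
Proof. by case=> [|f|t|t|[||t|]|[||t|]|[||t|] b|[r|]|b||b|m|m|m|] //; case: f. Qed.
HB.instance Definition _ := Countable.copy mstate (can_type mstate_codeK).
HB.instance Definition _ : isFinite mstate := CanIsFinite mstate_codeK.

(** Six heads; [hZ] never leaves the start mark, and the others return to the beginning by moving to
    its position. *)
Definition mhead : finType := (bool * option bool)%type.
Notation hZ := (false, None).
Notation hC := (false, Some false).
Notation hP := (false, Some true).
Notation hQ := (true, None).
Notation hD := (true, Some false).
Notation hE := (true, Some true).
Definition at_ (h : mhead) : mhead * bool := (h, false).
Definition nx_ (h : mhead) : mhead * bool := (h, true).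
Definition pos5 (c p q d e : nat) (h : mhead) : nat :=
  match h with
  | (false, None) => 0 | (false, Some false) => c | (false, Some true) => p
  | (true, None) => q | (true, Some false) => d | (true, Some true) => e
  end.
Definition mv5 (c p q d e : mhead * bool) : {ffun mhead -> mhead * bool} :=
  [ffun h : mhead => match h with
  | (false, None) => (hZ, false) | (false, Some false) => c | (false, Some true) => p
  | (true, None) => q | (true, Some false) => d | (true, Some true) => e
  end].

(** A symbol of the text with the labels of the parent and of the current node at its position. The
    only branch ever stored is the last edge of the path. *)
Definition mcell : finType := (option symbol * (lab * lab))%type.
Definition mview : Type := {ffun mhead -> option mcell * {ffun mhead -> bool}}.
Definition mact : Type := (mstate * (option mcell * {ffun mhead -> mhead * bool}))%type.
Definition go s c p q d e : mact := (s, (None, mv5 c p q d e)).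
Definition rdm (v : mview) (h : mhead) : mcell := odflt (None, (zlab, zlab)) (v h).1.
Definition test (b : bool) : seq (seq mact) := if b then [:: [::]] else [::].
Definition yhead (k : rkind) : mhead :=
  match k with Kisb => hC | Kdir => hC | Kent _ => hQ | Kinv => hP end.
Definition eq_test (k : ekind) (x y : mcell) : bool :=
  match k with
  | Kbar r => x.2.1.1.1 == (r || y.2.2.1.1.1, y.2.2.1.1.2)
  | Kname => x.2.2.1.2 == y.2.2.1.2
  end.

(* Heads: P is the position treated, Q its successor or a second position, C the table
   entry of the current direction, and D and E run along two tokens to be compared. A
   rank is compared with a table index by moving E one entry per bit under D. *)
Definition mdelta (s : mstate) (v : mview) : seq (seq mact) :=
  let X h := (rdm v h).1 in
  let o := at_ hZ in
  match s with
  | qInit => [:: [:: go (qFmt (None, None)) o (nx_ hZ) o o o;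
                     go (qTok true) o (nx_ hZ) o o o; go (qGuess None) o (nx_ hZ) o o o]]
  | qFmt f => match X hP with
      | None => test (f.1 != Some false)
      | Some x => if fstep f x is Some f' then [:: [:: go (qFmt f') o (nx_ hP) o o o]] else [::]
      end
  | qTok t => match X hP with
      | None => test true
      | Some LetterMark => [:: [:: go (qTok t) o (nx_ hP) o o o; go (qEnt t) o (at_ hP) (nx_ hZ) o o]]
      | Some EqnMark => [:: [:: go (qTok false) o (nx_ hP) o o o]]
      | Some _ => [:: [:: go (qTok t) o (nx_ hP) o o o]]
      end
  | qEnt t => match X hQ with
      | None => [::]
      | Some EqnMark => [::]
      | Some LetterMark => [:: [:: go (qEnt t) o (at_ hP) (nx_ hQ) o o];
                               [:: go (qRk (Kent t)) o (at_ hP) (at_ hQ) (nx_ hP) (nx_ hZ)]]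
      | Some _ => [:: [:: go (qEnt t) o (at_ hP) (nx_ hQ) o o]]
      end
  | qRk k => match X hE with
      | Some LetterMark => match X hD with
          | Some (Bit _) => [:: [:: go (qRks k) (at_ hC) (at_ hP) (at_ hQ) (nx_ hD) (nx_ hE)]]
          | _ => [:: [:: go (qRes k ((v hE).2 (yhead k))) (at_ hC) (at_ hP) (at_ hQ) o o]]
          end
      | _ => [:: [:: go (qRes k false) (at_ hC) (at_ hP) (at_ hQ) o o]]
      end
  | qRks k => match X hE with
      | Some (Bit _) => [:: [:: go (qRks k) (at_ hC) (at_ hP) (at_ hQ) (at_ hD) (nx_ hE)]]
      | _ => [:: [:: go (qRk k) (at_ hC) (at_ hP) (at_ hQ) (at_ hD) (at_ hE)]]
      end
  | qRes k b => match k with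
      | Kisb => test (b ==> ((rdm v hP).2.2.1.1 == (rdm v hQ).2.1.1.1))
      | Kdir => if b then test true else [:: [:: go (qGuess (Some false)) (at_ hP) (nx_ hZ) o o o]]
      | Kent t => if b then if t then
            [:: [:: go (qRk Kinv) (at_ hC) (at_ hP) (at_ hQ) (nx_ hQ) (nx_ hZ)]] else test true
          else [::]
      | Kinv => test b
      end
  | qEq k => match X hD, X hE with
      | Some (Bit a), Some (Bit b) => if a == b then
          [:: [:: go (qEq k) (at_ hC) (at_ hP) (at_ hQ) (nx_ hD) (nx_ hE)]] else test true
      | Some (Bit _), _ => test true
      | _, Some (Bit _) => test true
      | _, _ => test (eq_test k (rdm v hP) (rdm v hQ))
      end
  | qLoop r => (if r then [::] else [:: [:: go qZero o (nx_ hZ) o o o]]) ++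
               [:: [:: go (qDir r) (at_ hC) (nx_ hZ) o o o]]
  | qZero => if (rdm v hP).2.2 == zlab then
        if X hP is None then test true else [:: [:: go qZero o (nx_ hP) o o o]]
      else [::]
  | qDir r => match X hP with
      | None => test true
      | Some EqnMark => test true
      | Some LetterMark => [:: [:: go (qDir r) (at_ hC) (nx_ hP) o o o;
           if r then go (qGuess (Some true)) (at_ hP) (nx_ hZ) o o o
           else go (qRk Kdir) (at_ hC) (at_ hP) o (nx_ hP) (nx_ hZ)]]
      | Some _ => [:: [:: go (qDir r) (at_ hC) (nx_ hP) o o o]]
      end
  | qGuess m =>
      [seq let wr := Some (X hP, ((rdm v hP).2.2, l)) in
           if X hP is None then
             [:: (qLoop (m == None), (wr, mv5 (at_ hC) o o o o));
                 (qChk m, (wr, mv5 (at_ hC) (nx_ hZ) o o o))]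
           else [:: (qGuess m, (wr, mv5 (at_ hC) (nx_ hP) o o o))] | l <- enum lab]
  | qChk m => if X hP is None then test (base (m == None) None (rdm v hP).2.2 zlab)
      else [:: [:: go (qChk m) (at_ hC) (nx_ hP) o o o; go (qLoc m) (at_ hC) (at_ hP) (nx_ hP) o o]]
  | qLoc m => if base (m == None) (X hP) (rdm v hP).2.2 (rdm v hQ).2.2 then
        match X hP, m with
        | Some LetterMark, Some r =>
            [:: [:: go (qRk Kisb) (at_ hC) (at_ hP) (at_ hQ) (nx_ hP) (nx_ hZ);
                    go (qEq (Kbar r)) (at_ hC) (at_ hP) (at_ hQ) (nx_ hP) (nx_ hC)]]
        | Some VarMark, _ => [:: [:: go qName (at_ hC) (at_ hP) (nx_ hP) o o]]
        | _, _ => test true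
        end
      else [::]
  | qName => match X hQ with
      | None => test true
      | Some VarMark => [:: [:: go qName (at_ hC) (at_ hP) (nx_ hQ) o o;
           go (qEq Kname) (at_ hC) (at_ hP) (at_ hQ) (nx_ hP) (nx_ hQ)]]
      | Some _ => [:: [:: go qName (at_ hC) (at_ hP) (nx_ hQ) o o]]
      end
  end.

Definition sys_mach : hmach := @HM mstate mcell mhead hP mdelta.
Definition isloop (s : hq sys_mach) : bool := if s is qLoop _ then true else false.


Arguments rdm : simpl never.
Arguments test : simpl never.
Arguments view : simpl never.
Arguments hmove : simpl never.

Section Options.
Variables (T : eqType) (P : T -> Prop).
Implicit Types (a b c : T).
Local Notation opts s := (exists2 o : seq T, o \in s & forall a, a \in o -> P a).
Lemma opts0 : opts [::] <-> False.
Proof. by split=> // -[]. Qed.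
Lemma opts_true : opts [:: [::]] <-> True.
Proof. by split=> // _; exists [::]; rewrite ?inE. Qed.
Lemma opts1 a : opts [:: [:: a]] <-> P a.
Proof.
split=> [[o]|h]; first by rewrite inE => /eqP ->; apply; apply: mem_head.
by exists [:: a]; rewrite ?inE // => b; rewrite inE => /eqP ->.
Qed.
Lemma opts2 a b : opts [:: [:: a; b]] <-> P a /\ P b.
Proof.
split=> [[o]|[ha hb]]; first by rewrite inE => /eqP -> h; split; apply: h; rewrite !inE eqxx ?orbT.
by exists [:: a; b]; rewrite ?inE // => c; rewrite !inE => /orP[]/eqP ->.
Qed.
Lemma opts3 a b c : opts [:: [:: a; b; c]] <-> [/\ P a, P b & P c].
Proof.
split=> [[o]|[ha hb hc]].
  by rewrite inE => /eqP -> h; split; apply: h; rewrite !inE eqxx ?orbT.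
by exists [:: a; b; c]; rewrite ?inE // => d; rewrite !inE => /or3P[]/eqP ->.
Qed.
Lemma opts_or a b : opts [:: [:: a]; [:: b]] <-> P a \/ P b.
Proof.
split=> [[o]|[h|h]]; first by rewrite !inE => /orP[]/eqP -> h; [left | right]; apply: h; apply: mem_head.
  by exists [:: a]; rewrite ?mem_head // => c; rewrite inE => /eqP ->.
by exists [:: b]; rewrite ?inE ?eqxx ?orbT // => c; rewrite inE => /eqP ->.
Qed.
End Options.

Lemma opts_test (P : _ -> Prop) b : (exists2 o, o \in test b & forall a, a \in o -> P a) <-> b.
Proof. by case: b; rewrite /test ?opts_true ?opts0. Qed.

Section Run.
Variable B : hq sys_mach -> seq mcell -> (mhead -> nat) -> Prop.
Variable T : seq symbol.
Local Notation n := (size T).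
Local Notation acc := (@hreach sys_mach isloop B).
Local Notation msteps := (@steps sys_mach isloop B).
Local Notation mtarget := (@target sys_mach isloop B).
Definition cellF (o l : nat -> lab) (i : nat) : mcell := (sym T i, (o i, l i)).
Definition cellsF (o l : nat -> lab) : seq mcell := mkseq (cellF o l) n.+1.
Arguments cellsF : simpl never.

Lemma size_cellsF o l : size (cellsF o l) = n.+1.
Proof. exact: size_mkseq. Qed.

Lemma rdm_cells o l (pos : mhead -> nat) (h : mhead) i : pos h = i.+1 -> i <= n ->
  rdm (view (M := sys_mach) (cellsF o l) pos) h = cellF o l i.
Proof.
move=> e le; rewrite /rdm /view ffunE /hletter /rdc e.
rewrite -nth_behead (_ : behead _ = map Some (cellsF o l)) //.
by rewrite (nth_map (cellF o l 0)) ?size_mkseq // nth_mkseq.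
Qed.

Lemma mark_cells o l (pos : mhead -> nat) (h h' : mhead) :
  (view (M := sys_mach) (cellsF o l) pos h).2 h' = (pos h' == pos h).
Proof. by rewrite /view ffunE /hletter /= ffunE. Qed.

Definition newpos (pos : mhead -> nat) (a : mhead * bool) : nat :=
  if a.2 then (pos a.1).+1 else pos a.1.

Lemma hmove5 a b x y z C P Q D E :
  hmove (M := sys_mach) (mv5 a b x y z) (pos5 C P Q D E) =
  pos5 (newpos (pos5 C P Q D E) a) (newpos (pos5 C P Q D E) b) (newpos (pos5 C P Q D E) x)
       (newpos (pos5 C P Q D E) y) (newpos (pos5 C P Q D E) z).
Proof.
have e p : pos5 C P Q D E p.1 + (p.2 : bool) = newpos (pos5 C P Q D E) p.
  by rewrite /newpos; case: p.2; rewrite ?addn1 ?addn0.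
by apply: functional_extensionality => -[[] [[]|]]; rewrite /hmove ffunE //= e.
Qed.

Lemma target_wr s wr a b x y z o l C P Q D E (pos := pos5 C P Q D E) :
  [&& newpos pos a <= n.+1, newpos pos b <= n.+1, newpos pos x <= n.+1,
      newpos pos y <= n.+1 & newpos pos z <= n.+1] ->
  mtarget (s, (wr, mv5 a b x y z)) (cellsF o l) pos <->
  acc s (hwrite wr (cellsF o l) P)
    (pos5 (newpos pos a) (newpos pos b) (newpos pos x) (newpos pos y) (newpos pos z)).
Proof.
move=> /and5P[h1 h2 h3 h4 h5]; rewrite /target /pos /= hmove5; split=> [[]//|h]; split=> // i.
by rewrite size_map size_iota; case: i => -[] [[]|].
Qed.

Lemma target_go s a b x y z o l C P Q D E (pos := pos5 C P Q D E) :
  [&& newpos pos a <= n.+1, newpos pos b <= n.+1, newpos pos x <= n.+1,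
      newpos pos y <= n.+1 & newpos pos z <= n.+1] ->
  mtarget (go s a b x y z) (cellsF o l) pos <->
  acc s (cellsF o l)
    (pos5 (newpos pos a) (newpos pos b) (newpos pos x) (newpos pos y) (newpos pos z)).
Proof. exact: target_wr. Qed.

Ltac tgo := rewrite target_go; last (by rewrite /newpos /=; lia); rewrite /newpos /=.

Lemma stepsE s cs pos : msteps s cs pos <->
  exists2 o, o \in mdelta s (view (M := sys_mach) cs pos) & forall a, a \in o -> mtarget a cs pos.
Proof. by []. Qed.

Lemma accE s cs pos : ~~ isloop s -> acc s cs pos <->
  exists2 o, o \in mdelta s (view (M := sys_mach) cs pos) & forall a, a \in o -> mtarget a cs pos.
Proof. exact: hreachE. Qed.

Section Fixed.
Variables o l : nat -> lab.
Local Notation cs := (cellsF o l).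
Let rdP C P Q D E i (e : P = i.+1) := @rdm_cells o l (pos5 C P Q D E) hP i e.
Let rdQ C P Q D E i (e : Q = i.+1) := @rdm_cells o l (pos5 C P Q D E) hQ i e.
Let rdD C P Q D E i (e : D = i.+1) := @rdm_cells o l (pos5 C P Q D E) hD i e.
Let rdE C P Q D E i (e : E = i.+1) := @rdm_cells o l (pos5 C P Q D E) hE i e.

Lemma acc_fmt f i : i <= n -> acc (qFmt f) cs (pos5 0 i.+1 0 0 0) <-> fmt f (drop i T).
Proof.
have [k] := ubnP (n - i); elim: k f i => // k IH f i lt le.
rewrite accE // /mdelta (rdP _ _ _ _ erefl le) /=; case e : (sym T i) => [x|].
  have lti := sym_lt e; rewrite (drop_sym e) /=; case: (fstep f x) => [f'|].
    by rewrite opts1; tgo; apply: IH; lia.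
  by rewrite opts0.
by rewrite opts_test drop_oversize // leqNgt; apply/negP => /sym_some[x]; rewrite e.
Qed.

Lemma bits_step i b : sym T i = Some (Bit b) -> bits (drop i T) = b :: bits (drop i.+1 T).
Proof. by move=> /drop_sym ->. Qed.
Lemma bits_stop i : (forall b, sym T i <> Some (Bit b)) -> bits (drop i T) = [::].
Proof.
rewrite sym_drop; case: (drop i T) => [|[b| | | |] r] //= h.
by case: (h b).
Qed.

Lemma acc_eq k C i j D E : C <= n.+1 -> i <= n -> j <= n -> D <= n -> E <= n ->
  acc (qEq k) cs (pos5 C i.+1 j.+1 D.+1 E.+1) <->
  (bits (drop D T) = bits (drop E T) -> eq_test k (cellF o l i) (cellF o l j)).
Proof.
move=> leC lei lej; have [m] := ubnP (n - D); elim: m D E => // m IH D E lt leD leE.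
rewrite accE // /mdelta (rdP _ _ _ _ erefl lei) (rdQ _ _ _ _ erefl lej).
rewrite (rdD _ _ _ _ erefl leD) (rdE _ _ _ _ erefl leE) /=.
have nb x F : sym T F = x -> (if x is Some (Bit _) then false else true) -> bits (drop F T) = [::].
  by move=> <- h; apply: bits_stop => b e; rewrite e in h.
have tt b' F G : bits (drop F T) = b' :: bits (drop F.+1 T) -> bits (drop G T) = [::] ->
  (bits (drop F T) = bits (drop G T) -> eq_test k (cellF o l i) (cellF o l j)) <-> True.
  by move=> -> ->.
have tt' b' F G : bits (drop F T) = b' :: bits (drop F.+1 T) -> bits (drop G T) = [::] ->
  (bits (drop G T) = bits (drop F T) -> eq_test k (cellF o l i) (cellF o l j)) <-> True.
  by move=> -> ->.
have ff F G : bits (drop F T) = [::] -> bits (drop G T) = [::] ->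
  (bits (drop F T) = bits (drop G T) -> eq_test k (cellF o l i) (cellF o l j)) <->
  eq_test k (cellF o l i) (cellF o l j).
  by move=> -> ->; split=> [->|].
case eD : (sym T D) => [[a| | | |]|]; case eE : (sym T E) => [[b| | | |]|];
  try (rewrite opts_test; first [rewrite (ff _ _ (nb _ _ eD isT) (nb _ _ eE isT)) //
     | rewrite (tt _ _ _ (bits_step eD) (nb _ _ eE isT)) //
     | rewrite (tt' _ _ _ (bits_step eE) (nb _ _ eD isT)) //]).
have lD := sym_lt eD; have lE := sym_lt eE.
rewrite (bits_step eD) (bits_step eE); case: eqP => [<-|nab].
  rewrite opts1; tgo.
  rewrite IH //; [|lia]; split=> h; [by case=> /h | by move=> e; apply: h; rewrite e].
by rewrite opts_test; split=> // _ [].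
Qed.

Lemma acc_zero i : i <= n ->
  acc qZero cs (pos5 0 i.+1 0 0 0) <-> forall j, i <= j <= n -> l j = zlab.
Proof.
move: i; apply: scan_all => i le.
rewrite accE // /mdelta (rdP _ _ _ _ erefl le) /=; case: eqP => [->|nz]; last by rewrite opts0; split=> // -[].
case e : (sym T i) => [x|].
  have lti := sym_lt e; rewrite opts1; tgo.
  by split=> [h|[_ /(_ lti)]].
rewrite opts_test; split=> // _; split=> // /sym_some[x]; by rewrite e.
Qed.

Lemma sym_end i : sym T i = None -> ~ i < n.
Proof. by move=> e /sym_some[x]; rewrite e. Qed.

Lemma take_symS t i x : sym t i = Some x -> take i.+1 t = rcons (take i t) x.
Proof.
elim: t i => [|y t IH] [|i] //=; first by case=> ->; rewrite take0.
by move=> /IH ->.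
Qed.

Lemma rankS i : rank T i.+1 = rank T i + (sym T i == Some LetterMark).
Proof.
rewrite /rank; case: (ltnP i n) => [lt|ge].
  have [x e] := sym_some lt; rewrite (take_symS e) -cats1 count_cat /= addn0 e.
  by rewrite (inj_eq Some_inj).
by rewrite !take_oversize ?(leqW ge) // sym_size // addn0.
Qed.
Lemma rank_le i j : i <= j -> rank T i <= rank T j.
Proof. by elim: j => [|j IH]; rewrite leq_eqVlt => /orP[/eqP-> //|] // /IH; rewrite rankS; lia. Qed.
Lemma rank_lt i j : sym T i = Some LetterMark -> i < j -> rank T i < rank T j.
Proof. by move=> e /rank_le; rewrite rankS e eqxx; lia. Qed.
Lemma entry_inj i j : entry T i -> entry T j -> rank T i = rank T j -> i = j.
Proof.
move=> /andP[/eqP ei _] /andP[/eqP ej _] e.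
by case: (ltngtP i j) => // /rank_lt; [move=> /(_ ei) | move=> /(_ ej)]; lia.
Qed.

Lemma take_sym i x : i < n -> (x \in take i.+1 T) = (x \in take i T) || (sym T i == Some x).
Proof.
move=> /sym_some[y e]; rewrite (take_symS e) mem_rcons inE orbC e (inj_eq Some_inj).
by rewrite eq_sym.
Qed.

Lemma mem_takeS i j x : i <= j -> x \notin take j T -> x \notin take i T.
Proof. by move=> ij; apply: contra; rewrite -(subnKC ij) takeD mem_cat => ->. Qed.

Hypothesis Hf : fmt (None, None) T.

Lemma table_sym i : EqnMark \notin take i T ->
  sym T i <> Some VarMark /\ sym T i <> Some EqualMark.
Proof.
have H f t j : fmt (None, f) t -> EqnMark \notin take j t ->
    sym t j <> Some VarMark /\ sym t j <> Some EqualMark.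
  elim: t j f => [|x t IH] j f; first by case: j.
  case: x => [b| | | |] /=; case: j => [|j] //=; rewrite ?inE ?eqxx //.
    by case: f => // v; case: ifP => // _ h /norP[_]; apply: IH h.
  by move=> h /norP[_]; apply: IH h.
exact: H Hf.
Qed.

Lemma first_not_bit b : sym T 0 <> Some (Bit b).
Proof. by move: Hf; case: T => [|[]]. Qed.

(** By the format, the table consists of letter marks and bits; any other position in front of which
    no equation has begun is its end. *)
Lemma entry_stop i j : EqnMark \notin take i T -> (forall b, sym T i <> Some (Bit b)) ->
  sym T i <> Some LetterMark -> entry T j -> rank T j < rank T i.
Proof.
move=> ni nb nl /andP[/eqP ej nj]; apply: rank_lt => //; rewrite ltnNge; apply/negP => le.
have [nv nq] := table_sym ni; case e : (sym T i) nb nl nv nq => [[b| | | |]|] // nb _ _ _.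
- exact: nb b erefl.
- have ij : i < j by case: (ltngtP i j) le => // eij; rewrite eij ej in e.
  by have := mem_takeS ij nj; rewrite take_sym ?(sym_lt e) // e eqxx orbT.
by have := sym_lt ej; apply/negP; rewrite -leqNgt; apply: leq_trans le; rewrite leqNgt; apply/negP/sym_end.
Qed.

Lemma bits_skip E : E <= n -> EqnMark \notin take E T ->
  let F := E + size (bits (drop E T)) in
  [/\ F <= n, EqnMark \notin take F T, rank T F = rank T E & forall b, sym T F <> Some (Bit b)].
Proof.
have [k] := ubnP (n - E); elim: k E => // k IH E lt le nE.
case e : (sym T E) => [[b| | | |]|]; try by rewrite bits_stop ?addn0 ?e //; split; rewrite ?e.
have lE := sym_lt e; rewrite (bits_step e) /= addnS -addSn.
have r : rank T E.+1 = rank T E by rewrite rankS e addn0.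
rewrite -r; apply: IH => //; first by lia.
by rewrite take_sym // negb_or nE e.
Qed.

Section Rank.
Variables (k : rkind) (C P Q y : nat).
Hypothesis bC : C <= n.+1.
Hypothesis bP : P <= n.+1.
Hypothesis bQ : Q <= n.+1.
Hypothesis ye : entry T y.
Hypothesis yE : forall D E, pos5 C P Q D E (yhead k) = y.+1.

Lemma acc_rks D E : D <= n -> E <= n ->
  acc (qRks k) cs (pos5 C P Q D.+1 E.+1) <->
  acc (qRk k) cs (pos5 C P Q D.+1 (E + size (bits (drop E T))).+1).
Proof.
move=> leD; have [m] := ubnP (n - E); elim: m E => // m IH E lt leE.
rewrite accE // /mdelta (rdE _ _ _ _ erefl leE) /=.
case e : (sym T E) => [[b| | | |]|]; rewrite opts1; try by (tgo; rewrite bits_stop ?addn0 // e).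
have lE := sym_lt e; tgo; rewrite IH //; last by lia.
by rewrite (bits_step e) /= addnS -addSn.
Qed.

(** Each bit under D takes E to the next entry. When the bits are used up, the presence of the head
    [yhead k] under E decides; if the table ends before, the numbers differ. *)
Lemma acc_rk D E : D <= n -> E <= n -> EqnMark \notin take E T ->
  (forall b, sym T E <> Some (Bit b)) ->
  acc (qRk k) cs (pos5 C P Q D.+1 E.+1) <->
  acc (qRes k (rank T E + size (bits (drop D T)) == rank T y)) cs (pos5 C P Q 0 0).
Proof.
have [m] := ubnP (n - D); elim: m D E => // m IH D E lt leD leE nE nb.
rewrite accE // /mdelta (rdE _ _ _ _ erefl leE) (rdD _ _ _ _ erefl leD) /=.
have [eE|/eqP nl] := eqVneq (sym T E) (Some LetterMark); last first.
  have -> : (rank T E + size (bits (drop D T)) == rank T y) = false.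
    by apply/eqP; have := entry_stop nE nb nl ye; lia.
  case e : (sym T E) nl => [[b| | | |]|] // _; rewrite opts1; by tgo.
rewrite eE /= mark_cells yE /=; have lE := sym_lt eE; have enE : entry T E by rewrite /entry eE eqxx.
have stop : (forall b, sym T D <> Some (Bit b)) ->
    (y.+1 == E.+1) = (rank T E + size (bits (drop D T)) == rank T y).
  move=> nbD; rewrite bits_stop // addn0 eqSS eq_sym; apply/eqP/eqP => [-> //|e].
  exact: entry_inj e.
case eD : (sym T D) => [[b| | | |]|]; rewrite opts1; try by (tgo; rewrite stop // eD).
have lD := sym_lt eD; tgo; rewrite acc_rks //.
have nE1 : EqnMark \notin take E.+1 T by rewrite take_sym // negb_or nE eE; apply/eqP.
have [F1 F2 F3 F4] := bits_skip lE nE1.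
rewrite IH //; last by lia.
by rewrite F3 rankS eE eqxx (bits_step eD) /= -addnA add1n.
Qed.

Lemma acc_rank i : i < n -> acc (qRk k) cs (pos5 C P Q i.+2 1) <->
  acc (qRes k (size (cont T i) == rank T y)) cs (pos5 C P Q 0 0).
Proof.
move=> lt; rewrite acc_rk ?take0 //; last exact: first_not_bit.
by rewrite /rank take0 add0n.
Qed.
End Rank.

Lemma acc_inv (b : bool) i j : i <= n -> j <= n ->
  acc (qRes Kinv b) cs (pos5 0 i.+1 j.+1 0 0) <-> b.
Proof. by move=> li lj; rewrite accE // /mdelta opts_test. Qed.

Lemma acc_ent_res (t b : bool) i j : i < n -> j < n -> (t -> entry T i) ->
  acc (qRes (Kent t) b) cs (pos5 0 i.+1 j.+1 0 0) <-> b /\ (t -> size (cont T j) = rank T i).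
Proof.
move=> li lj ei; rewrite accE // /mdelta; case: b; last by rewrite opts0; split=> // -[].
case: t ei => [/(_ isT) ei|_]; last by rewrite opts_test.
rewrite opts1; tgo; rewrite (@acc_rank Kinv 0 i.+1 j.+1 i) // ?acc_inv; try lia.
Qed.

Lemma acc_ent (t : bool) i : i < n -> (t -> entry T i) -> acc (qEnt t) cs (pos5 0 i.+1 1 0 0) <->
  exists2 j, entry T j & size (cont T i) = rank T j /\ (t -> size (cont T j) = rank T i).
Proof.
move=> li ei; pose R j := EqnMark \notin take j T /\ acc (qEnt t) cs (pos5 0 i.+1 j.+1 0 0).
pose loc j := entry T j /\ (size (cont T i) = rank T j /\ (t -> size (cont T j) = rank T i)).
have H j : j <= n -> R j <-> loc j \/ (j < n /\ R j.+1).
  move=> le; case: (boolP (EqnMark \notin take j T)) => nj; last first.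
    split=> [[h]|[[/andP[_ h]]|[_ [h]]]]; [by rewrite h in nj | by rewrite h in nj |].
    by rewrite (mem_takeS (leqnSn j) h) in nj.
  have -> : R j <-> acc (qEnt t) cs (pos5 0 i.+1 j.+1 0 0) by split=> [[]|].
  have [nv nq] := table_sym nj.
  rewrite accE // /mdelta (rdQ _ _ _ _ erefl le) /=.
  case e : (sym T j) nv nq => [[b| | | |]|] // nv nq.
  - have lj := sym_lt e; rewrite opts1; tgo; split=> [h|[[/andP[]]|[_ []]//]]; last by rewrite e.
    by right; split=> //; split=> //; rewrite take_sym // negb_or nj e.
  - have lj := sym_lt e; have ej : entry T j by rewrite /entry e eqxx.
    rewrite opts_or; tgo; tgo; rewrite (@acc_rank (Kent t) 0 i.+1 j.+1 j) //; try lia.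
    rewrite acc_ent_res //; split=> [[h|[/eqP h1 h2]]|[[_ [-> h]]|[_ [_ h]]]].
    + by right; split=> //; split=> //; rewrite take_sym // negb_or nj e; apply/eqP.
    + by left.
    + by right.
    + by left.
  - rewrite opts0; split=> // -[[/andP[]]|[lj [h]]]; first by rewrite e => /eqP.
    by rewrite take_sym // e eqxx orbT in h.
  - rewrite opts0; split=> // -[[/andP[]]|[lj]]; first by rewrite e => /eqP.
    by case: (sym_end e).
have -> : acc (qEnt t) cs (pos5 0 i.+1 1 0 0) <-> R 0 by rewrite /R take0; split=> [|[]].
rewrite (scan_ex H) //; split=> [[j _ [e h]]|[j e h]]; first by exists j.
exists j => //; have /andP[/eqP /sym_lt lt _] := e; lia.
Qed.

Lemma acc_tok : acc (qTok true) cs (pos5 0 1 0 0 0) <-> tokens_ok T.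
Proof.
pose R i := acc (qTok (EqnMark \notin take i T)) cs (pos5 0 i.+1 0 0 0).
pose loc i := sym T i = Some LetterMark -> exists2 j, entry T j &
    size (cont T i) = rank T j /\ (entry T i -> size (cont T j) = rank T i).
have H i : i <= n -> R i <-> loc i /\ (i < n -> R i.+1).
  move=> le; rewrite /R accE // /mdelta (rdP _ _ _ _ erefl le) /=.
  case e : (sym T i) => [x|]; last first.
    by rewrite opts_test; split=> // _; split; rewrite /loc ?e // => /(sym_end e).
  have lt := sym_lt e; rewrite take_sym // e negb_or.
  have nx : loc i /\ (i < n -> acc (qTok ((EqnMark \notin take i T) && (Some x != Some EqnMark))) cs (pos5 0 i.+2 0 0 0))
    <-> loc i /\ acc (qTok ((EqnMark \notin take i T) && (Some x != Some EqnMark))) cs (pos5 0 i.+2 0 0 0).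
    by split=> -[h1 h2]; split=> //; apply: h2.
  rewrite nx => {nx}; have L : x <> LetterMark -> loc i by rewrite /loc e => h [].
  have Y a : x <> EqnMark -> a && (Some x != Some EqnMark) = a.
    by move=> h; rewrite (_ : Some x != _) ?andbT //; apply/eqP => -[].
  case: x e L Y => [b| | | |] e L Y; rewrite ?opts1 ?opts2.
  - by rewrite Y //; tgo; split=> [|[]//]; split=> //; apply: L.
  - rewrite Y //; tgo; tgo; rewrite acc_ent //; last by move=> h; rewrite /entry e eqxx.
    split=> [[h1 [j ej [h2 h3]]]|[h1 h2]]; split=> //.
      by move=> _; exists j => //; split=> // /andP[_ /h3].
    have [j ej [h3 h4]] := h1 e; exists j => //; split=> // h; apply: h4.
    by rewrite /entry e eqxx.
  - by rewrite Y //; tgo; split=> [|[]//]; split=> //; apply: L.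
  - by tgo; rewrite eqxx andbF; split=> [|[]//]; split=> //; apply: L.
  by rewrite Y //; tgo; split=> [|[]//]; split=> //; apply: L.
have -> : acc (qTok true) cs (pos5 0 1 0 0 0) <-> R 0 by rewrite /R take0.
rewrite (scan_all H) //; split=> h i; first by move=> ei; apply: h => //; have := sym_lt ei; lia.
by move=> _; apply: h.
Qed.

Lemma acc_name C i : C <= n.+1 -> sym T i = Some VarMark -> forall j, j <= n ->
  acc qName cs (pos5 C i.+1 j.+1 0 0) <-> forall j', j <= j' <= n -> sym T j' = Some VarMark ->
    cont T i = cont T j' -> (l i).1.2 = (l j').1.2.
Proof.
move=> leC ei; have li := sym_lt ei; apply: scan_all => j le.
rewrite accE // /mdelta (rdQ _ _ _ _ erefl le) /=; case e : (sym T j) => [x|]; last first.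
  by rewrite opts_test; split=> // _; split=> // /(sym_end e).
have lj := sym_lt e; case: x e => [b| | | |] e; rewrite ?opts1 ?opts2;
  try by (tgo; split=> [h|[_ /(_ lj)]//]; split).
tgo; tgo; rewrite acc_eq //; try lia.
split=> [[h1 h2]|[h1 h2]]; split=> //; try exact: h2.
  by move=> _ /h2 /eqP.
by move=> h; apply/eqP; apply: h1.
Qed.

Section Check.
Variables (m : option bool) (C c : nat).
Hypothesis bC : C <= n.+1.
Hypothesis hc : m <> None -> C = c.+1 /\ entry T c.

Let local i := [/\ base (m == None) (sym T i) (l i) (l i.+1),
      sym T i = Some VarMark -> forall j, i <= j -> sym T j = Some VarMark ->
        cont T i = cont T j -> (l i).1.2 = (l j).1.2 &
      forall r, m = Some r -> sym T i = Some LetterMark ->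
        (size (cont T i) = rank T c -> (l i).1.1 = (o i.+1).1.1) /\
        (cont T i = cont T c -> (o i).1.1 = (r || (l i.+1).1.1.1, (l i.+1).1.1.2))].

Lemma acc_isb (b : bool) i : i < n -> acc (qRes Kisb b) cs (pos5 C i.+1 i.+2 0 0) <->
  (b -> (l i).1.1 = (o i.+1).1.1).
Proof.
move=> lt; rewrite accE // /mdelta (rdP _ _ _ _ erefl (ltnW lt)) (rdQ _ _ _ _ erefl lt) opts_test /=.
by case: b => //=; split=> [/eqP //|h]; apply/eqP/h.
Qed.

Lemma acc_loc i : i < n -> acc (qLoc m) cs (pos5 C i.+1 i.+2 0 0) <-> local i.
Proof.
move=> lt; rewrite accE // /mdelta (rdP _ _ _ _ erefl (ltnW lt)) (rdQ _ _ _ _ erefl lt) /= /local.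
case: ifP => bs; last by rewrite opts0; split=> // -[].
case e : (sym T i) bs => [[b| | | |]|] bs; try by (rewrite opts_test; split).
- case em : m hc bs => [r|] hc' bs; last by rewrite opts_test; split.
  have [|eC ec] := hc'; first by [].
  have lc : c < n by have /andP[/eqP /sym_lt] := ec.
  rewrite opts2; tgo; tgo; rewrite (@acc_rank Kisb C i.+1 i.+2 c) //; try lia.
  rewrite acc_isb // eC acc_eq //; try lia.
  split=> [[h1 h2]|[_ _ /(_ r erefl erefl) [h1 h2]]].
    split=> // r' [<-] _; split=> [h|/h2 /eqP //]; apply: h1; exact/eqP.
  by split=> [/eqP //|h]; apply/eqP/h2.
rewrite opts1; tgo; rewrite acc_name //.
split=> [h|[_ h _] j /andP[ij jn]]; last by apply: h => //; apply: ltnW.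
split=> // _ j; rewrite leq_eqVlt => /orP[/eqP -> //|ij] ej; apply: h => //.
by rewrite ij; have := sym_lt ej; lia.
Qed.

Lemma acc_chk : acc (qChk m) cs (pos5 C 1 0 0 0) <-> label_ok T m c o l.
Proof.
pose R i := acc (qChk m) cs (pos5 C i.+1 0 0 0).
have H i : i <= n -> R i <-> local i /\ (i < n -> R i.+1).
  move=> le; rewrite /R accE // /mdelta (rdP _ _ _ _ erefl le) /=.
  case e : (sym T i) => [x|]; last first.
    rewrite opts_test /local e; split=> [h|[[]]//].
    by split=> // /(sym_end e).
  have lt := sym_lt e; rewrite opts2; tgo; tgo; rewrite acc_loc //.
  by split=> [[h1 h2]|[h1 h2]]; split=> //; apply: h2.
have -> : acc (qChk m) cs (pos5 C 1 0 0 0) <-> R 0 by [].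
by rewrite (scan_all H).
Qed.
End Check.

Lemma acc_dir r c : (r = false -> entry T c) ->
  acc (qDir r) cs (pos5 (if r then 0 else c.+1) 1 0 0 0) <->
  forall c', entry T c' -> (r = false -> size (cont T c') <> rank T c) ->
    acc (qGuess (Some r)) cs (pos5 c'.+1 1 0 0 0).
Proof.
move=> hc; have bC : (if r then 0 else c.+1) <= n.+1.
  by case: r hc => // /(_ erefl) /andP[/eqP /sym_lt]; lia.
set C := if r then _ else _ in bC *.
pose R i := EqnMark \notin take i T -> acc (qDir r) cs (pos5 C i.+1 0 0 0).
pose loc i := entry T i -> (r = false -> size (cont T i) <> rank T c) ->
    acc (qGuess (Some r)) cs (pos5 i.+1 1 0 0 0).
have H i : i <= n -> R i <-> loc i /\ (i < n -> R i.+1).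
  move=> le; case: (boolP (EqnMark \notin take i T)) => ni; last first.
    split=> [_|_ h]; last by rewrite h in ni.
    split=> [/andP[_ h]|_ h]; first by rewrite h in ni.
    by rewrite (mem_takeS (leqnSn i) h) in ni.
  have -> : R i <-> acc (qDir r) cs (pos5 C i.+1 0 0 0) by rewrite /R; split=> [/(_ ni)|].
  have [nv nq] := table_sym ni.
  rewrite accE // /mdelta (rdP _ _ _ _ erefl le) /=.
  case e : (sym T i) nv nq => [[b| | | |]|] // nv nq.
  - have lt := sym_lt e; rewrite opts1; tgo; split=> [h|[_ /(_ lt)]].
      by split=> [/andP[]|_ _ //]; rewrite e.
    by apply; rewrite take_sym // negb_or ni e.
  - have lt := sym_lt e; have ei : entry T i by rewrite /entry e eqxx.
    have nx : acc (qDir r) cs (pos5 C i.+2 0 0 0) <-> (i < n -> R i.+1).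
      split=> [h _ _ //|/(_ lt)]; apply; rewrite take_sym // negb_or ni e; exact/eqP.
    rewrite opts2; tgo; rewrite nx => {nx}.
    have K : mtarget (if r then go (qGuess (Some true)) (at_ hP) (nx_ hZ) (at_ hZ) (at_ hZ) (at_ hZ)
       else go (qRk Kdir) (at_ hC) (at_ hP) (at_ hZ) (nx_ hP) (nx_ hZ)) cs (pos5 C i.+1 0 0 0) <-> loc i.
      have lC : r = false -> c < n by move=> /hc /andP[/eqP /sym_lt].
      rewrite /loc /C; case er : (r); tgo.
        by split=> [h _ _ //|]; apply.
      have ec := hc er; have lc := lC er.
      rewrite (@acc_rank Kdir c.+1 i.+1 0 c) //; last by lia.
      rewrite accE // /mdelta; case: eqP => [eq|ne].
        by rewrite opts_test; split=> // _ _ /(_ erefl).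
      by rewrite opts1; tgo; split=> [h _ _ //|]; apply.
    by rewrite K; split=> [] [].
  - rewrite opts_test; split=> // _; split=> [/andP[/eqP]|lt]; first by rewrite e.
    by rewrite /R take_sym // e eqxx orbT.
  - rewrite opts_test; split=> // _; split=> [/andP[/eqP]|lt]; first by rewrite e.
    by case: (sym_end e).
have -> : acc (qDir r) cs (pos5 C 1 0 0 0) <-> R 0 by rewrite /R take0; split=> [|/(_ isT)].
rewrite (scan_all H) //; split=> h i; last by move=> _; apply: h.
by move=> ei; apply: h => //; have /andP[/eqP /sym_lt lt _] := ei; lia.
Qed.
End Fixed.

Definition upd (f : nat -> lab) (i : nat) (x : lab) (j : nat) : lab := if j == i then x else f j.

Lemma cellsF_ext o l o' l' : (forall i, i <= n -> o i = o' i /\ l i = l' i) ->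
  cellsF o l = cellsF o' l'.
Proof.
move=> H; apply: (@eq_from_nth _ (cellF o l 0)); first by rewrite !size_cellsF.
move=> i; rewrite size_cellsF ltnS => le; rewrite !nth_mkseq //.
by rewrite /cellF; have [-> ->] := H i le.
Qed.

Lemma write_cells o l i x : i <= n ->
  hwrite (M := sys_mach) (Some (sym T i, (l i, x))) (cellsF o l) i.+1 =
  cellsF (upd o i (l i)) (upd l i x).
Proof.
move=> le; apply: (@eq_from_nth _ (cellF o l 0)).
  by rewrite size_set_nth !size_cellsF; apply/maxn_idPr.
move=> j; rewrite size_set_nth size_cellsF (maxn_idPr _) // ltnS => lj.
rewrite (set_nth_default (sym T i, (l i, x))) ?size_set_nth ?size_cellsF ?leq_max ?ltnS ?lj ?orbT //.
by rewrite nth_set_nth /= !nth_mkseq // /cellF /upd; case: eqP => [->|].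
Qed.

(** The scan moves each label to the parent track and writes a guessed one. [oi i o l] is the final
    parent track as seen when the scan has reached [i]: before [i] the shift is done, from [i] on
    its content is still in [l]. *)
Lemma acc_guess m C o l (R : (nat -> lab) -> (nat -> lab) -> Prop) : C <= n.+1 ->
  (forall o l, R o l <-> acc (qLoop (m == None)) (cellsF o l) (pos5 C 0 0 0 0) /\
                         acc (qChk m) (cellsF o l) (pos5 C 1 0 0 0)) ->
  acc (qGuess m) (cellsF o l) (pos5 C 1 0 0 0) <-> exists l', R l l'.
Proof.
move=> bC HR; pose oi i o l j : lab := if j < i then o j else l j.
have oiE i o1 l1 x j : oi i o1 l1 j = oi i.+1 (upd o1 i (l1 i)) (upd l1 i x) j.
  by rewrite /oi /upd ltnS; case: ltngtP => // ->.
have Rext o1 l1 o2 l2 : (forall i, i <= n -> o1 i = o2 i /\ l1 i = l2 i) -> R o1 l1 -> R o2 l2.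
  by move=> /cellsF_ext e; rewrite !HR e.
have H i o1 l1 : i <= n -> acc (qGuess m) (cellsF o1 l1) (pos5 C i.+1 0 0 0) <->
    exists2 l', (forall j, j < i -> l' j = l1 j) & R (oi i o1 l1) l'.
  have [k] := ubnP (n - i); elim: k i o1 l1 => // k IH i o1 l1 lt le.
  rewrite accE // /mdelta (rdm_cells o1 l1 (pos := pos5 C i.+1 0 0 0) (h := hP) erefl le) /=.
  have wr x := write_cells o1 l1 x le.
  case e : (sym T i) => [x|].
    have li := sym_lt e; split.
      case=> acts /mapP[y _ ->] /(_ _ (mem_head _ _)).
      rewrite target_wr; last by rewrite /newpos /=; lia.
      rewrite -e wr /newpos /= IH //; last by lia.
      case=> l' h1 h2; exists l'; first by move=> j ji; rewrite h1 ?ltnS 1?ltnW // /upd ltn_eqF.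
      by apply: Rext h2 => j _; rewrite -oiE.
    case=> l' h1 h2; eexists; first by apply/mapP; exists (l' i); rewrite ?mem_enum.
    move=> a; rewrite inE => /eqP ->.
    rewrite target_wr; last by rewrite /newpos /=; lia.
    rewrite -e wr /newpos /= IH //; last by lia.
    exists l'; first by move=> j; rewrite ltnS leq_eqVlt /upd; case: eqP => [->|_] //= /h1.
    by apply: Rext h2 => j _; rewrite -oiE.
  have ein : i = n by apply/eqP; rewrite eqn_leq le leqNgt; apply/negP/sym_end.
  have ext l' : (forall j, j < i -> l' j = l1 j) -> forall j, j <= n ->
      oi i o1 l1 j = upd o1 i (l1 i) j /\ l' j = upd l1 i (l' i) j.
    rewrite -ein => h j; rewrite /oi /upd leq_eqVlt => /orP[/eqP ->|ji]; first by rewrite ltnn eqxx.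
    by rewrite ji ltn_eqF // h.
  split.
    case=> acts /mapP[y _ ->] h.
    have := h _ (mem_head _ _); rewrite target_wr; last by rewrite /newpos /=; lia.
    have := h _ (mem_last _ _); rewrite [last _ _]/= target_wr; last by rewrite /newpos /=; lia.
    rewrite -e wr /newpos /= => h1 h2; exists (upd l1 i y).
      by move=> j ji; rewrite /upd ltn_eqF.
    apply: (Rext (upd o1 i (l1 i)) (upd l1 i y)); last exact/HR.
    move=> j le'; have [] := ext (upd l1 i y) _ j le'; first by move=> j' ji; rewrite /upd ltn_eqF.
    by move=> -> _.
  case=> l' h1 h2; eexists; first by apply/mapP; exists (l' i); rewrite ?mem_enum.
  have /HR[g1 g2] : R (upd o1 i (l1 i)) (upd l1 i (l' i)) by apply: Rext h2; apply: ext.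
  by move=> a; rewrite !inE => /orP[]/eqP ->; rewrite target_wr; try (by rewrite /newpos /=; lia);
    rewrite -e wr /newpos /=.
rewrite H //; split=> [[l' _ h]|[l' h]]; exists l' => //; exact: Rext h.
Qed.

Hypothesis Hf : fmt (None, None) T.

(** A round of the main loop is one step in the definition of [good]: stop at a zero label, or guess
    legal labels for the children in all directions except back. *)
Lemma loop_steps r c o l : (r = false -> entry T c) ->
  msteps (qLoop r) (cellsF o l) (pos5 (if r then 0 else c.+1) 0 0 0 0) <->
  (r = false /\ forall i, i <= n -> l i = zlab) \/
  (forall c', entry T c' -> (r = false -> size (cont T c') <> rank T c) ->
     exists l', B (qLoop false) (cellsF l l') (pos5 c'.+1 0 0 0 0) /\
       label_ok T (Some r) c' l l').
Proof.
move=> hc; have bC : (if r then 0 else c.+1) <= n.+1.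
  by case: r hc => // /(_ erefl) /andP[/eqP /sym_lt]; lia.
have D : acc (qDir r) (cellsF o l) (pos5 (if r then 0 else c.+1) 1 0 0 0) <->
  (forall c', entry T c' -> (r = false -> size (cont T c') <> rank T c) ->
     exists l', B (qLoop false) (cellsF l l') (pos5 c'.+1 0 0 0 0) /\
       label_ok T (Some r) c' l l').
  rewrite acc_dir //.
  have G c' : entry T c' -> acc (qGuess (Some r)) (cellsF o l) (pos5 c'.+1 1 0 0 0) <->
     exists l', B (qLoop false) (cellsF l l') (pos5 c'.+1 0 0 0 0) /\ label_ok T (Some r) c' l l'.
    move=> ec; have lc : c' < n by have /andP[/eqP /sym_lt] := ec.
    apply: (@acc_guess (Some r) c'.+1 o l (fun o1 l1 =>
      B (qLoop false) (cellsF o1 l1) (pos5 c'.+1 0 0 0 0) /\ label_ok T (Some r) c' o1 l1)); first by lia.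
    move=> o1 l1; rewrite hreach_stop // (@acc_chk o1 l1 Hf (Some r) c'.+1 c') //; lia.
  by split=> h c' ec hn; apply/G/h.
rewrite stepsE /mdelta; case: r hc bC D => hc bC D /=.
  rewrite opts1; tgo; rewrite D; split=> [|[[]|]//]; by right.
rewrite opts_or; tgo; tgo; rewrite D acc_zero //.
by split=> [[h|h]|[[_ h]|h]]; [left; split | right | left | right].
Qed.
End Run.

Section Accept.
Variable T : seq symbol.
Local Notation hac := (@hacc sys_mach).
Let z (i : nat) : lab := zlab.

Definition loop_good (q : hq sys_mach) (cells : seq mcell) (pos : mhead -> nat) : Prop :=
  forall r c o l, q = qLoop r -> cells = cellsF T o l -> pos = pos5 (if r then 0 else c.+1) 0 0 0 0 ->
    (r = false -> entry T c) -> good T r c l.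

Lemma init_steps B : @hreach sys_mach isloop B qInit (cellsF T z z) (pos5 0 0 0 0 0) <->
  [/\ fmt (None, None) T, @hreach sys_mach isloop B (qTok true) (cellsF T z z) (pos5 0 1 0 0 0) &
      @hreach sys_mach isloop B (qGuess None) (cellsF T z z) (pos5 0 1 0 0 0)].
Proof.
rewrite accE // /mdelta opts3.
have t s : @target sys_mach isloop B (go s (at_ hZ) (nx_ hZ) (at_ hZ) (at_ hZ) (at_ hZ)) (cellsF T z z)
    (pos5 0 0 0 0 0) <-> @hreach sys_mach isloop B s (cellsF T z z) (pos5 0 1 0 0 0) by apply: target_go.
have f := @acc_fmt B T z z (None, None) 0 (leq0n _); rewrite drop0 in f.
by split=> [[/t/f h1 /t h2 /t h3]|[h1 h2 h3]]; split=> //; apply/t => //; apply/f.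
Qed.

Lemma guess_root B : fmt (None, None) T ->
  @hreach sys_mach isloop B (qGuess None) (cellsF T z z) (pos5 0 1 0 0 0) <->
  exists l, B (qLoop true) (cellsF T z l) (pos5 0 0 0 0 0) /\ label_ok T None 0 z l.
Proof.
move=> Hf; apply: (@acc_guess B T None 0 z z (fun o l =>
  B (qLoop true) (cellsF T o l) (pos5 0 0 0 0 0) /\ label_ok T None 0 o l)) => // o l.
by rewrite hreach_stop // (@acc_chk B T o l Hf None 0 0).
Qed.

Lemma label_root c o o' l : label_ok T None c o l -> label_ok T None 0 o' l.
Proof. by move=> h i /h[h1 h2 _]. Qed.

Lemma hacc_good : hac qInit (cellsF T z z) (pos5 0 0 0 0 0) ->
  [/\ fmt (None, None) T, tokens_ok T & good_text T].
Proof.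
move=> h; have [|Hf tk _] := (init_steps (fun _ _ _ => True)).1.
  exact: hacc_hreach h.
split=> //; first exact: (@acc_tok (fun _ _ _ => True) T z z Hf).1 tk.
have [|_ _] := (init_steps loop_good).1.
  apply: hacc_hreach h => -[] // r cells pos _ st r' c o l [<-] ec ep hc; subst cells pos.
  have [[-> zl]|H] := (@loop_steps loop_good T Hf r c o l hc).1 st; first exact: GoodZero.
  apply: GoodStep => c' ec hn; have [l' [Bl ok]] := H c' ec hn; exists l' => //.
  exact: (Bl false c' l l').
rewrite guess_root // => -[l [Bl ok]]; exists l; first exact: label_root ok.
exact: (Bl true 0 z l).
Qed.

Lemma steps_hacc q cells pos : @steps sys_mach isloop hac q cells pos -> hac q cells pos.
Proof.
case=> o oin H; apply: (Hacc oin) => q' wr mv ain; have [h1 h2] := H _ ain => //.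
exact: (hreach_hacc _ h2).
Qed.

Lemma good_hacc r c l : fmt (None, None) T -> good T r c l -> (r = false -> entry T c) -> forall o,
  hac (qLoop r) (cellsF T o l) (pos5 (if r then 0 else c.+1) 0 0 0 0).
Proof.
move=> Hf; elim/good_ind' => {r c l} [c l zl|r c l H] hc o; apply: steps_hacc.
  by apply: (@loop_steps hac T Hf false c o l hc).2; left.
apply: (@loop_steps hac T Hf r c o l hc).2; right=> c' ec hn; have [l' ok IH] := H c' ec hn.
by exists l'; split=> //; apply: IH.
Qed.

Lemma sys_machP : hac qInit (cellsF T z z) (pos5 0 0 0 0 0) <->
  [/\ fmt (None, None) T, tokens_ok T & good_text T].
Proof.
split=> [|[Hf tk [l ok g]]]; first exact: hacc_good.
apply: (@hreach_hacc sys_mach isloop hac) => //; apply/init_steps; split=> //; first exact/acc_tok.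
apply/guess_root => //; exists l; split; last exact: label_root ok.
by apply: (@good_hacc true 0 l Hf g).
Qed.
End Accept.

Lemma idempotent_systems_text T : idempotent_systems T <->
  [/\ fmt (None, None) T, tokens_ok T & good_text T].
Proof.
split=> [[A [S [-> sol]]]|[h1 h2 h3]].
  have [] := (instanceP (enc_instance S)).2; first by exists A, S.
  by move=> h1 h2; split=> //; apply/solvable_text.
have [A [S e]] := (instanceP T).1 (conj h1 h2); exists A, S; split=> //.
by apply/solvable_text; rewrite -e.
Qed.

(** The queue starts with a mark carrying all heads, then one cell per symbol and one without a
    symbol for the position [size T], all with zero labels; so it arises from the input letter by
    letter. *)
Lemma idempotent_systems_DEXPTIME : DEXPTIME idempotent_systems.
Proof.
pose mk (x : option symbol) : aq_sym (aqm_of sys_mach) := (Some (x, (zlab, zlab)), [ffun=> false]).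
apply: (@aqm_DEXPTIME (aqm_of sys_mach) _ (fun x => mk (Some x)) [:: (None, [ffun=> true])]
  [:: mk None] (qSt (M := sys_mach) qInit)) => // T.
rewrite idempotent_systems_text -sys_machP hacc_accepts; last by case=> -[] [[]|].
suff -> : hword (M := sys_mach) (cellsF T (fun=> zlab) (fun=> zlab)) (pos5 0 0 0 0 0) =
  queue (fun x => mk (Some x)) [:: (None, [ffun=> true])] [:: mk None] T by [].
have P0 h : pos5 0 0 0 0 0 h = 0 by case: h => -[] [[]|].
rewrite hword_cons /queue cat1s; congr (_ :: _).
  by congr pair; apply/ffunP => h; rewrite !ffunE P0.
rewrite size_cellsF; apply: (@eq_from_nth _ (mk None)).
  by rewrite size_map size_iota size_cat size_map addn1.
move=> i; rewrite size_map size_iota => lt.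
rewrite (nth_map 0) ?size_iota // nth_iota // add0n.
have -> : nth (mk None) ([seq mk (Some x) | x <- T] ++ [:: mk None]) i = mk (sym T i).
  rewrite nth_cat size_map; case: ltnP => [lti|ge].
    by have [x e] := sym_some lti; rewrite /sym !(nth_map x).
  by rewrite (sym_size ge) (eqP (_ : i - size T == 0)) // subn_eq0 -ltnS.
rewrite /hletter /mk; congr pair.
  rewrite /rdc -nth_behead (_ : behead _ = map Some (cellsF T (fun=> zlab) (fun=> zlab))) //.
  by rewrite (nth_map (cellF T (fun=> zlab) (fun=> zlab) 0)) ?size_cellsF // nth_mkseq.
by apply/ffunP => h; rewrite !ffunE P0.
Qed.

End Membership.

Theorem theorem5p1 :
  DEXPTIME idempotent_systems /\
  (forall (A : invAlphabet) (alpha beta : A),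
     uniq [:: alpha; bar alpha; beta; bar beta] ->
     DEXPTIME_hard (idempotent_systems_two A)).
Proof.
split; first exact: Membership.idempotent_systems_DEXPTIME.
exact: Hardness.two_equations_hard.
Qed.
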